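(* Let $H$ be a triangular Hopf algebra, $A$ a braided commutative left $H$-module algebra, let the module $\mathfrak X(A)$ of braided derivations be finitely generated and projective as an $A$-module, let $\Omega(A):={}^*\mathfrak X(A)$ be the right dual module of one-forms and let $\mathsf g\in\Omega(A)\otimes_A\Omega(A)$ be a metric on $A$. There exists a unique torsion free metric compatible left connection $\nabla:\mathfrak X(A)\to\Omega(A)\otimes_A\mathfrak X(A)$ (the Levi-Civita connection). In terms of the inverse metric tensor $\bar{\mathsf g}=\bar{\mathsf g}^b\otimes_A\bar{\mathsf g}_b$, a dual basis $\{e_i,\omega^i:i=1,\dots,n\}$ of $\mathfrak X(A)$ and the exact pairings $\langle\ ,\ \rangle:\mathfrak X(A)\otimes_A\Omega(A)\to A$ and $\langle\ ,\ \rangle':\Omega(A)\otimes_A\mathfrak X(A)\to A$, it is explicitly given, for all $v,z\in\mathfrak X(A)$, by $$\nabla_v(z)=\tfrac12\big\langle\omega^i\,K_{\mathsf g}(\bar R^\alpha\triangleright v\otimes_A\bar R_\alpha\triangleright e_i\otimes z)\,,\,\bar{\mathsf g}^b\big\rangle'\,\bar{\mathsf g}_b,$$ where, for all $u,v,z\in\mathfrak X(A)$, $$\begin{aligned}K_{\mathsf g}(u\otimes v\otimes z)=\ &\mathcal L_u\langle v\otimes_Az,\mathsf g\rangle-\mathcal L_{\bar R^\alpha\triangleright v}\langle\bar R_\alpha\triangleright u\otimes_Az,\mathsf g\rangle+\mathcal L_{\bar R^\alpha\bar R^\beta\triangleright z}\langle\bar R_\alpha\triangleright u\otimes_A\bar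 R_\beta\triangleright v,\mathsf g\rangle\\&-\langle[u,v]\otimes_Az,\mathsf g\rangle+\langle u\otimes_A[v,z],\mathsf g\rangle+\langle[u,\bar R^\beta\triangleright z]\otimes_A\bar R_\beta\triangleright v,\mathsf g\rangle .\end{aligned}$$
   Context: $\Bbbk$ is a field of characteristic zero, or the ring of formal power series over such a field; $\otimes$ is over $\Bbbk$; algebras are associative and unital; Hopf algebras have invertible antipode $S$; $\Delta(h)=h_{(1)}\otimes h_{(2)}$. $H$ is triangular with universal R-matrix $\mathcal R$ ($\Delta^{cop}(h)=\mathcal R\Delta(h)\mathcal R^{-1}$, $(\Delta\otimes\mathrm{id})\mathcal R=\mathcal R_{13}\mathcal R_{23}$, $(\mathrm{id}\otimes\Delta)\mathcal R=\mathcal R_{13}\mathcal R_{12}$, $\mathcal R_{21}=\mathcal R^{-1}$); write $\mathcal R^{-1}=\bar R^\alpha\otimes\bar R_\alpha$, summation understood. $A$ is a left $H$-module algebra, braided commutative: $ab=(\bar R^\alpha\triangleright b)(\bar R_\alpha\triangleright a)$. Tensor products carry the diagonal $H$-action; the braiding is $\tau(v\otimes_A w)=\bar R^\alpha\triangleright w\otimes_A\bar R_\alpha\triangleright v$. Vector fields. $\mathfrak X(A)$ is the set of braided derivations: $\Bbbk$-linear $u:A\to A$ with $u(ab)=u(a)b+(\bar R^\alpha\triangleright a)(\bar R_\alpha\triangleright u)(b)$, where $(h\triangleright u)(a)=h_{(1)}\triangleright(u(S(h_{(2)})\triangleright a))$; it is an $H$-equivariant $A$-bimodule with $(au)(b)=a\,u(b)$,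 $ua=(\bar R^\alpha\triangleright a)(\bar R_\alpha\triangleright u)$; bracket $[u,v]=u\circ v-(\bar R^\alpha\triangleright v)\circ(\bar R_\alpha\triangleright u)\in\mathfrak X(A)$. On $a\in A$, $\mathcal L_u(a)=u(a)$. Forms. ${}^*\mathfrak X(A)$ is the module of left $A$-linear maps $\mathfrak X(A)\to A$, $\langle u,\omega\rangle:=\omega(u)$, with $(\omega a)(u)=\omega(u)a$, $(a\omega)(u)=\omega(ua)$, $(h\triangleright\omega)(u)=h_{(2)}\triangleright\omega(S^{-1}(h_{(1)})\triangleright u)$; $\mathrm d:A\to\Omega(A)$, $\langle u,\mathrm da\rangle=u(a)$. A dual basis satisfies $u=\langle u,\omega^i\rangle e_i$ for all $u$. $\langle\theta,u\rangle':=\langle\bar R^\alpha\triangleright u,\bar R_\alpha\triangleright\theta\rangle$. For $\mathsf g=\mathsf g^a\otimes_A\mathsf g_a$ (sum understood), $\langle u\otimes_Av,\mathsf g\rangle=\langle u,\langle v,\mathsf g^a\rangle\mathsf g_a\rangle$. Metric. A (pseudo-Riemannian) metric on $A$ is $\mathsf g\in\Omega(A)\otimes_A\Omega(A)$ with $\tau(\mathsf g)=\mathsf g$ and such that $\mathsf g^\flat:\mathfrak X(A)\to\Omega(A)$, $u\mapsto\langle u,\mathsf g^a\rangle\mathsf g_a$, is an isomorphism. The inverse metric $\bar{\mathsf g}=\bar{\mathsf g}^b\otimes_A\bar{\mathsf g}_b\in\mathfrak X(A)\otimes_A\mathfrak X(A)$ is the unique element with $(\mathsf g^\flat)^{-1}(\theta)=\langle\theta,\bar{\mathsf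 g}^b\rangle'\bar{\mathsf g}_b$ for all $\theta\in\Omega(A)$. Connections. A left connection on $\mathfrak X(A)$ is a $\Bbbk$-linear $\nabla:\mathfrak X(A)\to\Omega(A)\otimes_A\mathfrak X(A)$ with $\nabla(av)=\mathrm da\otimes_Av+a\nabla(v)$; $\nabla_uv:=\mathrm i_u(\nabla v)$ with $\mathrm i_u(\theta\otimes_Av)=\langle u,\theta\rangle v$. It is torsion free if $\nabla_uv-\nabla_{\bar R^\alpha\triangleright v}(\bar R_\alpha\triangleright u)-[u,v]=0$ for all $u,v$. Its dual right connection ${}^*\nabla:\Omega(A)\to\Omega(A)\otimes_A\Omega(A)$ is defined by $\mathrm d\langle v,\theta\rangle=\langle\nabla v,\theta\rangle+\langle v,{}^*\nabla\theta\rangle$, where $\langle\eta\otimes_Av,\theta\rangle=\eta\langle v,\theta\rangle$ and $\langle v,\theta\otimes_A\eta\rangle=\langle v,\theta\rangle\eta$. It lifts to $\Omega(A)\otimes_A\Omega(A)$ by ${}^*\nabla(\theta\otimes_A\eta)=\tau_{23}({}^*\nabla(\theta)\otimes_A\eta)+\bar R^\beta\triangleright\theta\otimes_A(\bar R_\beta\triangleright{}^*\nabla)(\eta)$, with $h\triangleright{}^*\nabla:=h_{(1)}\triangleright\circ{}^*\nabla\circ S(h_{(2)})\triangleright$ and $\tau_{23}$ the braiding of the last two factors. $\nabla$ is metric compatible if ${}^*\nabla(\mathsf g)=0$. *)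

(* Defs.v *)
From HB Require Import structures.
From mathcomp Require Import all_boot all_algebra.
From mathcomp Require Import boolp classical_sets.

Set Implicit Arguments.
Unset Strict Implicit.
Unset Printing Implicit Defensive.

Import GRing.Theory.
Local Open Scope ring_scope.
Local Open Scope quotient_scope.

(* M (x)_S N: finite formal sums of pairs modulo the congruence generated by *)
(* biadditivity and (m s) (x) n = m (x) (s n).                               *)
Section Tensor.
Variables (S : Type) (M N : zmodType) (ra : M -> S -> M) (la : S -> N -> N).

Inductive tensor_rel : seq (M * N) -> seq (M * N) -> Prop :=
| TRrefl s : tensor_rel s s
| TRsym s t : tensor_rel s t -> tensor_rel t s
| TRtrans t s u : tensor_rel s t -> tensor_rel t u -> tensor_rel s u
| TRcat s s' t t' :
    tensor_rel s s' -> tensor_rel t t' -> tensor_rel (s ++ t) (s' ++ t')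
| TRcatC s t : tensor_rel (s ++ t) (t ++ s)
| TRzero n : tensor_rel [:: (0, n)] [::]
| TRaddl m m' n : tensor_rel [:: (m + m', n)] [:: (m, n); (m', n)]
| TRaddr m n n' : tensor_rel [:: (m, n + n')] [:: (m, n); (m, n')]
| TRbal m s n : tensor_rel [:: (ra m s, n)] [:: (m, la s n)].

Definition tensor_relb : rel (seq (M * N)) := fun s t => `[< tensor_rel s t >].

Fact tensor_relb_equiv : equiv_class_of tensor_relb.
Proof.
split=> [s|s t|t s u].
- by apply/asboolP; exact: TRrefl.
- by apply/asboolP/asboolP; exact: TRsym.
- by move=> /asboolP h1 /asboolP h2; apply/asboolP; exact: TRtrans h1 h2.
Qed.

Canonical tensor_equiv := EquivRelPack tensor_relb_equiv.

Definition tensor := {eq_quot tensor_equiv}.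
HB.instance Definition _ := Choice.on tensor.

Definition tpi (s : seq (M * N)) : tensor := \pi s.
Definition trepr (t : tensor) : seq (M * N) := repr t.

Lemma treprK t : tpi (trepr t) = t.
Proof. exact: reprK. Qed.

Lemma tpiP s t : tpi s = tpi t <-> tensor_rel s t.
Proof.
split=> [/eqP|h]; last by apply/eqP; rewrite eqmodE; apply/asboolP.
by rewrite eqmodE => /asboolP.
Qed.

Definition tens m n : tensor := tpi [:: (m, n)].

Definition tadd (t u : tensor) : tensor := tpi (trepr t ++ trepr u).
Definition topp (t : tensor) : tensor := tpi [seq (- p.1, p.2) | p <- trepr t].

Lemma tpi_cat s t : tadd (tpi s) (tpi t) = tpi (s ++ t).
Proof. by apply/tpiP/TRcat; apply/tpiP; rewrite treprK. Qed.

Fact taddA : associative tadd.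
Proof.
move=> x y z; rewrite -[x]treprK -[y]treprK -[z]treprK.
by rewrite !tpi_cat catA.
Qed.

Fact taddC : commutative tadd.
Proof.
by move=> x y; rewrite -[x]treprK -[y]treprK !tpi_cat; apply/tpiP/TRcatC.
Qed.

Fact tadd0 : left_id (tpi [::]) tadd.
Proof. by move=> x; rewrite -[x]treprK tpi_cat. Qed.

Fact taddN : left_inverse (tpi [::]) topp tadd.
Proof.
move=> x; rewrite -{2}[x]treprK /topp tpi_cat.
elim: (trepr x) => [//|[m n] s IHs] /=.
have -> : (- m, n) :: [seq (- p.1, p.2) | p <- s] ++ (m, n) :: s =
  [:: (- m, n)] ++ ([seq (- p.1, p.2) | p <- s] ++ [:: (m, n)] ++ s) by [].
rewrite -!tpi_cat [X in tadd _ X]taddA [X in tadd _ (tadd X _)]taddC.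
rewrite -taddA tpi_cat IHs taddA [RHS]/=.
rewrite tpi_cat taddC tadd0; apply/tpiP => /=.
apply: (@TRtrans [:: (0, n)]); last exact: TRzero.
by rewrite -(addNr m); apply/TRsym/TRaddl.
Qed.

HB.instance Definition _ :=
  GRing.isZmodule.Build tensor taddA taddC tadd0 taddN.

(* The value at t of the additive map sending m (x) n to f m n; it does not  *)
(* depend on the representative of t as soon as f is balanced (tsum_tens,    *)
(* tsumD).                                                                   *)
Definition tsum (V : nmodType) (f : M -> N -> V) (t : tensor) : V :=
  \sum_(p <- trepr t) f p.1 p.2.

Record balanced (V : zmodType) (f : M -> N -> V) : Prop := Balanced {
  balDl : forall m m' n, f (m + m') n = f m n + f m' n;
  balDr : forall m n n', f m (n + n') = f m n + f m n';
  balS : forall m s n, f (ra m s) n = f m (la s n) }.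

Section Balanced.
Variables (V : zmodType) (f : M -> N -> V) (bf : balanced f).

Lemma tsum_rel s t : tensor_rel s t ->
  \sum_(p <- s) f p.1 p.2 = \sum_(p <- t) f p.1 p.2.
Proof.
elim=> {s t} //.
- by move=> t s u _ -> _ ->.
- by move=> s s' t t' _ e1 _ e2; rewrite !big_cat /= e1 e2.
- by move=> s t; rewrite !big_cat /= addrC.
- move=> n; rewrite big_seq1 big_nil /=.
  by apply: (addrI (f 0 n)); rewrite -(balDl bf) !addr0.
- by move=> m m' n; rewrite !big_cons !big_nil /= !addr0 (balDl bf).
- by move=> m n n'; rewrite !big_cons !big_nil /= !addr0 (balDr bf).
- by move=> m s n; rewrite !big_seq1 /= (balS bf).
Qed.

Lemma tsum_pi s : tsum f (tpi s) = \sum_(p <- s) f p.1 p.2.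
Proof. by apply: tsum_rel; apply/tpiP; rewrite treprK. Qed.

Lemma tsum_tens m n : tsum f (tens m n) = f m n.
Proof. by rewrite tsum_pi big_seq1. Qed.

Lemma tsumD t u : tsum f (t + u) = tsum f t + tsum f u.
Proof. by rewrite tsum_pi big_cat. Qed.

Lemma tsum0 : tsum f 0 = 0.
Proof. by apply: (addrI (tsum f 0)); rewrite -tsumD !addr0. Qed.

End Balanced.

Lemma tens_balanced : balanced tens.
Proof.
split=> *; rewrite /tens.
- by rewrite [RHS]tpi_cat; apply/tpiP/TRaddl.
- by rewrite [RHS]tpi_cat; apply/tpiP/TRaddr.
- by apply/tpiP/TRbal.
Qed.

Lemma tsumE t : tsum tens t = t.
Proof.
rewrite /tsum -[RHS]treprK; elim: (trepr t) => [|[m n] s IHs].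
  by rewrite big_nil.
by rewrite big_cons IHs [LHS]tpi_cat.
Qed.

Lemma tensor_ind (P : tensor -> Prop) :
  P 0 -> (forall m n, P (tens m n)) -> (forall t u, P t -> P u -> P (t + u)) ->
  forall t, P t.
Proof.
move=> P0 Pt PD t; rewrite -(tsumE t) /tsum.
by elim/big_ind: _ => // p _; exact: Pt.
Qed.

Lemma tsum_split (V : nmodType) (f g : M -> N -> V) t :
  tsum (fun m n => f m n + g m n) t = tsum f t + tsum g t.
Proof. exact: big_split. Qed.

Lemma tsum_zero (V : nmodType) t : tsum (fun _ _ => 0 : V) t = 0.
Proof. exact: big1. Qed.

Lemma eq_tsum (V : nmodType) (f g : M -> N -> V) t :
  (forall m n, f m n = g m n) -> tsum f t = tsum g t.
Proof. by move=> fg; apply: eq_bigr => p _. Qed.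

Lemma map_tsum (V W : zmodType) (h : V -> W) (f : M -> N -> V) t :
  {morph h : x y / x + y} -> h (tsum f t) = tsum (fun m n => h (f m n)) t.
Proof.
move=> hD; apply: (big_morph h hD).
by apply: (addrI (h 0)); rewrite -hD !addr0.
Qed.

End Tensor.

Arguments tens {S M N ra la}.
Arguments tsumE {S M N ra la}.

Lemma tsum_exchange (S S' : Type) (M N M' N' : zmodType) ra la ra' la'
    (V : nmodType) (f : M -> N -> M' -> N' -> V)
    (t : @tensor S M N ra la) (t' : @tensor S' M' N' ra' la') :
  tsum (fun m n => tsum (f m n) t') t =
  tsum (fun m' n' => tsum (fun m n => f m n m' n') t) t'.
Proof. exact: exchange_big. Qed.

Section KTensor.
Variables (k : comUnitRingType).

Definition ktensor (M N : lmodType k) : Type :=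
  tensor (fun (m : M) (c : k) => c *: m) (fun (c : k) (n : N) => c *: n).
HB.instance Definition _ M N := GRing.Zmodule.on (ktensor M N).

Definition kbilin (M N : lmodType k) (V : zmodType) (f : M -> N -> V) :=
  balanced (fun (m : M) (c : k) => c *: m) (fun (c : k) (n : N) => c *: n) f.

Section Scale.
Variables (M N : lmodType k).

Definition ktens (m : M) (n : N) : ktensor M N := tens m n.

Definition kscale (c : k) (t : ktensor M N) : ktensor M N :=
  tsum (fun m n => ktens (c *: m) n) t.

Fact ktens_bilin : kbilin ktens. Proof. exact: tens_balanced. Qed.

Fact kscale_bilin c : kbilin (fun m n => ktens (c *: m) n).
Proof.
split=> *.
- by rewrite scalerDr (balDl ktens_bilin).
- by rewrite (balDr ktens_bilin).
- by rewrite scalerA mulrC -scalerA (balS ktens_bilin).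
Qed.

Fact kscale_tens c m n : kscale c (ktens m n) = ktens (c *: m) n.
Proof. exact: (tsum_tens (kscale_bilin c)). Qed.

Fact kscaleDr c : {morph kscale c : x y / x + y}.
Proof. exact: (tsumD (kscale_bilin c)). Qed.

Fact kscale0 c : kscale c 0 = 0.
Proof. by apply: (addrI (kscale c 0)); rewrite -kscaleDr !addr0. Qed.

Fact kscaleA a b v : kscale a (kscale b v) = kscale (a * b) v.
Proof.
elim/tensor_ind: v => [|m n|t u IHt IHu]; first by rewrite !kscale0.
  by rewrite !kscale_tens scalerA.
by rewrite !kscaleDr IHt IHu.
Qed.

Fact kscale1 : left_id 1 kscale.
Proof.
move=> v; elim/tensor_ind: v => [|m n|t u IHt IHu]; first by rewrite !kscale0.
  by rewrite !kscale_tens scale1r.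
by rewrite !kscaleDr IHt IHu.
Qed.

Fact kscaleDl v : {morph kscale^~ v : a b / a + b}.
Proof.
move=> a b /=; elim/tensor_ind: v => [|m n|t u IHt IHu].
- by rewrite !kscale0 addr0.
- by rewrite !kscale_tens scalerDl (balDl ktens_bilin).
- by rewrite !kscaleDr IHt IHu addrACA.
Qed.

HB.instance Definition _ := GRing.Zmodule_isLmodule.Build k (ktensor M N)
  kscaleA kscale1 kscaleDr kscaleDl.

End Scale.

Section KSum.
Variables (M N : lmodType k).

Definition ksum (V : nmodType) (f : M -> N -> V) (t : ktensor M N) : V :=
  tsum f t.

Lemma eq_ksum (V : nmodType) (f g : M -> N -> V) t :
  (forall m n, f m n = g m n) -> ksum f t = ksum g t.
Proof. exact: eq_tsum. Qed.

Lemma map_ksum (V W : zmodType) (h : V -> W) (f : M -> N -> V) t :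
  {morph h : x y / x + y} -> h (ksum f t) = ksum (fun m n => h (f m n)) t.
Proof. exact: map_tsum. Qed.

Lemma ksum_split (V : nmodType) (f g : M -> N -> V) t :
  ksum (fun m n => f m n + g m n) t = ksum f t + ksum g t.
Proof. exact: tsum_split. Qed.

Lemma ktensor_ind (P : ktensor M N -> Prop) :
  P 0 -> (forall m n, P (ktens m n)) -> (forall t u, P t -> P u -> P (t + u)) ->
  forall t, P t.
Proof. exact: tensor_ind. Qed.

End KSum.

Lemma ksum_exchange (M N M' N' : lmodType k) (V : nmodType)
    (f : M -> N -> M' -> N' -> V) (t : ktensor M N) (t' : ktensor M' N') :
  ksum (fun m n => ksum (f m n) t') t =
  ksum (fun m' n' => ksum (fun m n => f m n m' n') t) t'.
Proof. exact: tsum_exchange. Qed.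
End KTensor.

Section Linearity.
Variables (k : comUnitRingType).

Definition klinear (M V : lmodType k) (f : M -> V) : Prop :=
  forall c x y, f (c *: x + y) = c *: f x + f y.

Section Facts0.
Variables (M V : lmodType k).

Lemma klinD (f : M -> V) : klinear f -> {morph f : x y / x + y}.
Proof. by move=> lf x y; have := lf 1 x y; rewrite !scale1r. Qed.

Lemma klin0 (f : M -> V) : klinear f -> f 0 = 0.
Proof. by move=> /klinD fD; apply: (addrI (f 0)); rewrite -fD !addr0. Qed.

Lemma klinZ (f : M -> V) c x : klinear f -> f (c *: x) = c *: f x.
Proof. by move=> lf; have := lf c x 0; rewrite klin0 // !addr0. Qed.

End Facts0.

Section Facts.
Variables (M N P V W : lmodType k).

Lemma klin_bilin (f : M -> N -> V) :
  (forall n, klinear (f^~ n)) -> (forall m, klinear (f m)) -> kbilin f.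
Proof.
move=> l1 l2; split=> [m m' n|m n n'|m c n].
- exact: (klinD (l1 n)).
- exact: (klinD (l2 m)).
- by rewrite (klinZ _ _ (l1 n)) (klinZ _ _ (l2 m)).
Qed.

Lemma klin_id : klinear (fun x : M => x). Proof. by []. Qed.

Lemma klin_morph (g : {linear N -> V}) (f : M -> N) :
  klinear f -> klinear (fun x => g (f x)).
Proof. by move=> lf c x y; rewrite lf linearP. Qed.

Lemma klin_comp (g : N -> V) (f : M -> N) :
  klinear g -> klinear f -> klinear (fun x => g (f x)).
Proof. by move=> lg lf c x y; rewrite lf lg. Qed.

Lemma klin_add (f g : M -> V) :
  klinear f -> klinear g -> klinear (fun x => f x + g x).
Proof. by move=> lf lg c x y; rewrite lf lg scalerDr addrACA. Qed.

Lemma klin_sub (f g : M -> V) :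
  klinear f -> klinear g -> klinear (fun x => f x - g x).
Proof. by move=> lf lg c x y; rewrite lf lg scalerBr opprD addrACA. Qed.

Lemma klin_tens1 (f : M -> N) (p : P) :
  klinear f -> klinear (fun x => ktens (f x) p).
Proof.
by move=> lf c x y; rewrite lf (balDl (ktens_bilin _ _)) -kscale_tens.
Qed.

Lemma klin_tens2 (f : M -> N) (p : P) :
  klinear f -> klinear (fun x => ktens p (f x)).
Proof.
move=> lf c x y; rewrite lf (balDr (ktens_bilin _ _)).
by rewrite -(balS (ktens_bilin _ _)) -kscale_tens.
Qed.

Lemma klin_sum (X Y : lmodType k) (f : X -> Y -> M -> V) (t : ktensor X Y) :
  (forall x y, klinear (f x y)) -> klinear (fun z => ksum (fun x y => f x y z) t).
Proof.
move=> lf c x y; rewrite /ksum /tsum scaler_sumr -big_split /=.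
by apply: eq_bigr => p _; rewrite lf.
Qed.

Lemma ksumD (f : M -> N -> V) : kbilin f ->
  {morph (fun t : ktensor M N => ksum f t) : t u / t + u}.
Proof. by move=> bf t u; exact: tsumD. Qed.

Lemma ksum0 (f : M -> N -> V) : kbilin f -> ksum f 0 = 0.
Proof. exact: tsum0. Qed.

Lemma ksum_tens (f : M -> N -> V) m n : kbilin f -> ksum f (ktens m n) = f m n.
Proof. by move=> bf; exact: (tsum_tens bf). Qed.

Lemma klin_ksum (f : M -> N -> V) :
  (forall n, klinear (f^~ n)) -> (forall m, klinear (f m)) ->
  klinear (fun t : ktensor M N => ksum f t).
Proof.
move=> l1 l2 c x y; have bf := klin_bilin l1 l2.
rewrite (ksumD bf); congr (_ + _).
elim/ktensor_ind: x => [|m n|t u IHt IHu].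
- by rewrite scaler0 (ksum0 bf) scaler0.
- rewrite [_ *: _]kscale_tens (ksum_tens _ _ bf).
  by rewrite (klinZ _ _ (l1 n)) -(ksum_tens _ _ bf).
- by rewrite scalerDr !(ksumD bf) IHt IHu scalerDr.
Qed.

End Facts.

Section Facts2.
Variables (M N P V : lmodType k).

Lemma klin_ksumf (f : M -> N -> V) (g : P -> ktensor M N) :
  (forall n, klinear (f^~ n)) -> (forall m, klinear (f m)) -> klinear g ->
  klinear (fun z => ksum f (g z)).
Proof. by move=> l1 l2 lg; apply: (klin_comp _ lg); exact: klin_ksum. Qed.

Lemma klin_scale (g : M -> k^o) (v : V) :
  klinear g -> klinear (fun x => (g x : k) *: v).
Proof. by move=> lg c x y; rewrite lg scalerDl scalerA. Qed.

Lemma klin_scaler (c : k) (f : M -> V) :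
  klinear f -> klinear (fun x => c *: f x).
Proof.
by move=> lf d x y; rewrite lf scalerDr !scalerA [c * d]mulrC.
Qed.

Lemma ksum_ktens (f : M -> N -> V) m n :
  (forall n, klinear (f^~ n)) -> (forall m, klinear (f m)) ->
  ksum f (ktens m n) = f m n.
Proof. by move=> l1 l2; exact: ksum_tens (klin_bilin l1 l2). Qed.

End Facts2.

Section Mul.
Variables (M : lmodType k) (B : algType k).

Lemma klin_mull (f : M -> B) b : klinear f -> klinear (fun x => f x * b).
Proof. by move=> lf c x y; rewrite lf mulrDl scalerAl. Qed.

Lemma klin_mulr (f : M -> B) b : klinear f -> klinear (fun x => b * f x).
Proof. by move=> lf c x y; rewrite lf mulrDr scalerAr. Qed.

End Mul.

Section Tri.
Variables (M N P V : lmodType k) (f : M -> N -> P -> V).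
Hypotheses (l1 : forall n p, klinear (fun m => f m n p))
  (l2 : forall m p, klinear (fun n => f m n p))
  (l3 : forall m n, klinear (f m n)).

Definition ksum3 (t : ktensor (ktensor M N) P) : V :=
  ksum (fun u p => ksum (fun m n => f m n p) u) t.

Lemma ksum3_lin1 p : klinear (fun u : ktensor M N => ksum (fun m n => f m n p) u).
Proof. by apply: klin_ksum. Qed.

Lemma ksum3_lin2 (u : ktensor M N) : klinear (fun p => ksum (fun m n => f m n p) u).
Proof. by apply: klin_sum. Qed.

Lemma ksum3D : {morph ksum3 : x y / x + y}.
Proof.
exact: klinD (klin_ksum ksum3_lin1 ksum3_lin2).
Qed.

Lemma ksum3_tens u p : ksum3 (ktens u p) = ksum (fun m n => f m n p) u.
Proof. exact: (ksum_tens _ _ (klin_bilin ksum3_lin1 ksum3_lin2)). Qed.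

Lemma ksum3_tens3 m n p : ksum3 (ktens (ktens m n) p) = f m n p.
Proof.
by rewrite ksum3_tens (ksum_tens _ _ (klin_bilin _ _)).
Qed.

End Tri.
End Linearity.

Definition tmul (k : comUnitRingType) (H : algType k) (t u : ktensor H H) :
    ktensor H H :=
  ksum (fun a b => ksum (fun c d => ktens (a * c) (b * d)) u) t.

Definition tswap (k : comUnitRingType) (M N : lmodType k) (t : ktensor M N) :
    ktensor N M :=
  ksum (fun m n => ktens n m) t.

Record hopfAlgebra (k : comUnitRingType) (H : algType k) := HopfAlgebra {
  Delta : {linear H -> ktensor H H};
  counit : {linear H -> k^o};
  antip : {linear H -> H};
  antipV : H -> H;
  Delta1 : Delta 1 = ktens 1 1;
  DeltaM : forall g h, Delta (g * h) = tmul (Delta g) (Delta h);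
  counit1 : counit 1 = 1;
  counitM : forall g h, counit (g * h) = (counit g : k) * counit h;
  Delta_coassoc : forall h,
    ksum (fun x y => ktens (Delta x) y) (Delta h) =
    ksum (fun x y => ksum (fun y1 y2 => ktens (ktens x y1) y2) (Delta y))
         (Delta h);
  counitL : forall h, ksum (fun x y => (counit x : k) *: y) (Delta h) = h;
  counitR : forall h, ksum (fun x y => (counit y : k) *: x) (Delta h) = h;
  antipL : forall h, ksum (fun x y => antip x * y) (Delta h) = (counit h : k)%:A;
  antipR : forall h, ksum (fun x y => x * antip y) (Delta h) = (counit h : k)%:A;
  antipK : cancel antip antipV;
  antipVK : cancel antipV antip
}.

(* With R = R^a (x) R_a: R_13 R_23 = R^a (x) R^b (x) R_a R_b, and            *)
(* R_13 R_12 = R^a R^b (x) R_b (x) R_a.                                      *)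
Record triangularHopf (k : comUnitRingType) (H : algType k) := TriangularHopf {
  hopf_of :> hopfAlgebra H;
  Rmat : ktensor H H;
  Rbar : ktensor H H;
  Rmat_mulV : tmul Rmat Rbar = ktens 1 1;
  Rmat_mulVl : tmul Rbar Rmat = ktens 1 1;
  Delta_cop : forall h,
    tswap (Delta hopf_of h) = tmul (tmul Rmat (Delta hopf_of h)) Rbar;
  Rmat_Delta1 :
    ksum (fun a b => ktens (Delta hopf_of a) b) Rmat =
    ksum (fun a b => ksum (fun a' b' => ktens (ktens a a') (b * b')) Rmat) Rmat;
  Rmat_Delta2 :
    ksum (fun a b => ksum (fun b1 b2 => ktens (ktens a b1) b2)
                          (Delta hopf_of b)) Rmat =
    ksum (fun a b => ksum (fun a' b' => ktens (ktens (a * a') b') b) Rmat) Rmat;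
  Rmat_triang : tswap Rmat = Rbar
}.

Record moduleAlgebra (k : comUnitRingType) (H : algType k)
    (T : hopfAlgebra H) (A : algType k) := ModuleAlgebra {
  hopf_act : H -> {linear A -> A};
  act_linear : forall a, klinear (fun h => hopf_act h a);
  actM : forall g h a, hopf_act (g * h) a = hopf_act g (hopf_act h a);
  act1 : forall a, hopf_act 1 a = a;
  act_mul : forall h a b,
    hopf_act h (a * b) = ksum (fun x y => hopf_act x a * hopf_act y b) (Delta T h);
  act_one : forall h, hopf_act h 1 = (counit T h : k)%:A
}.

Definition braided_commutative (k : comUnitRingType) (H : algType k)
    (T : triangularHopf H) (A : algType k) (X : moduleAlgebra T A) : Prop :=
  forall a b, a * b = ksum (fun r1 r2 => hopf_act X r1 b * hopf_act X r2 a) (Rbar T).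

Record bcModuleAlgebra (k : comUnitRingType) (H : algType k)
    (T : triangularHopf H) (A : algType k) := BCModuleAlgebra {
  modalg_of :> moduleAlgebra T A;
  bcomm : braided_commutative modalg_of
}.

Ltac klin := repeat (
  repeat match goal with |- forall _, _ => intro end; cbv beta; first
  [ exact: klin_id
  | assumption
  | apply: act_linear
  | apply: klin_mull | apply: klin_mulr
  | apply: klin_tens1 | apply: klin_tens2
  | apply: klin_scale | apply: klin_scaler
  | apply: klin_ksumf | apply: klin_sum
  | apply: klin_morph
  | apply: (klin_comp (@act_linear _ _ _ _ _ _))
  | match goal with l : forall _, klinear _ |- _ => exact: l end
  | match goal with l : forall _ _, klinear _ |- _ => exact: l end
  | match goal with l : klinear _ |- _ => apply: (klin_comp l) end
  | match goal with l : forall _, klinear _ |- _ => apply: (klin_comp (l _)) end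
  | match goal with l : forall _ _, klinear _ |- _ =>
      apply: (klin_comp (l _ _)) end
  ]).

Section Hopf.
Variables (k : comUnitRingType) (H : algType k) (T : triangularHopf H).
Local Notation D := (Delta T).
Local Notation S := (antip T).
Local Notation eps := (counit T).

Section Sweedler.
Variable V : lmodType k.

Lemma sw_coassoc (f : H -> H -> H -> V) h :
  (forall y z, klinear (fun x => f x y z)) ->
  (forall x z, klinear (fun y => f x y z)) ->
  (forall x y, klinear (f x y)) ->
  ksum (fun x z => ksum (fun x1 x2 => f x1 x2 z) (D x)) (D h) =
  ksum (fun x z => ksum (fun z1 z2 => f x z1 z2) (D z)) (D h).
Proof.
move=> l1 l2 l3; have := congr1 (ksum3 f) (Delta_coassoc T h).
rewrite !(map_ksum _ _ (ksum3D l1 l2 l3)) => e.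
etransitivity; first (etransitivity; last exact: e).
  by apply: eq_ksum => x z; rewrite ksum3_tens.
apply: eq_ksum => x z; rewrite (map_ksum _ _ (ksum3D l1 l2 l3)).
by apply: eq_ksum => y1 y2; rewrite ksum3_tens3.
Qed.

Lemma sw_DM (f : H -> H -> V) g h :
  (forall y, klinear (f^~ y)) -> (forall x, klinear (f x)) ->
  ksum f (D (g * h)) =
  ksum (fun a b => ksum (fun c d => f (a * c) (b * d)) (D h)) (D g).
Proof.
move=> l1 l2; have bf := klin_bilin l1 l2.
rewrite DeltaM /tmul (map_ksum _ _ (ksumD bf)).
apply: eq_ksum => a b; rewrite (map_ksum _ _ (ksumD bf)).
by apply: eq_ksum => c d; rewrite (ksum_tens _ _ bf).
Qed.

Lemma sw_D1 (f : H -> H -> V) :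
  (forall y, klinear (f^~ y)) -> (forall x, klinear (f x)) ->
  ksum f (D 1) = f 1 1.
Proof. by move=> l1 l2; rewrite Delta1 (ksum_tens _ _ (klin_bilin l1 l2)). Qed.

Lemma sw_counitL (f : H -> V) h : klinear f ->
  ksum (fun x y => (eps x : k) *: f y) (D h) = f h.
Proof.
move=> lf; rewrite -{2}(counitL T h) (map_ksum _ _ (klinD lf)).
by apply: eq_ksum => x y; rewrite (klinZ _ _ lf).
Qed.

Lemma sw_counitR (f : H -> V) h : klinear f ->
  ksum (fun x y => (eps y : k) *: f x) (D h) = f h.
Proof.
move=> lf; rewrite -{2}(counitR T h) (map_ksum _ _ (klinD lf)).
by apply: eq_ksum => x y; rewrite (klinZ _ _ lf).
Qed.

Lemma sw_antipL (f : H -> V) h : klinear f ->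
  ksum (fun x y => f (S x * y)) (D h) = (eps h : k) *: f 1.
Proof.
by move=> lf; rewrite -(klinZ _ _ lf) -antipL (map_ksum _ _ (klinD lf)).
Qed.

Lemma sw_antipR (f : H -> V) h : klinear f ->
  ksum (fun x y => f (x * S y)) (D h) = (eps h : k) *: f 1.
Proof.
by move=> lf; rewrite -(klinZ _ _ lf) -antipR (map_ksum _ _ (klinD lf)).
Qed.

End Sweedler.

Lemma tmul_tens (a b c d : H) :
  tmul (ktens a b) (ktens c d) = ktens (a * c) (b * d).
Proof.
by rewrite /tmul ksum_ktens; try klin; rewrite ksum_ktens; klin.
Qed.

Lemma tmul_lin1 (u : ktensor H H) : klinear (fun t => tmul t u).
Proof. by rewrite /tmul; klin. Qed.

Lemma tmul_lin2 (t : ktensor H H) : klinear (tmul t).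
Proof. by rewrite /tmul; klin. Qed.

Lemma klin_ind (M N V : lmodType k) (f g : ktensor M N -> V) :
  klinear f -> klinear g -> (forall m n, f (ktens m n) = g (ktens m n)) ->
  f =1 g.
Proof.
move=> lf lg e t; elim/ktensor_ind: t => [|m n|t u IHt IHu].
- by rewrite (klin0 lf) (klin0 lg).
- exact: e.
- by rewrite (klinD lf) (klinD lg) IHt IHu.
Qed.

Lemma tmulA (t u v : ktensor H H) : tmul t (tmul u v) = tmul (tmul t u) v.
Proof.
move: t; apply: klin_ind => [||a b].
- exact: tmul_lin1.
- by apply: (klin_comp (tmul_lin1 v)); exact: tmul_lin1.
move: u; apply: klin_ind => [||c d].
- by apply: (klin_comp (tmul_lin2 _)); exact: tmul_lin1.
- by apply: (klin_comp (tmul_lin1 v)); exact: tmul_lin2.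
move: v; apply: klin_ind => [||x y].
- by apply: (klin_comp (tmul_lin2 _)); exact: tmul_lin2.
- exact: tmul_lin2.
by rewrite !tmul_tens !mulrA.
Qed.

Lemma tmul1 (t : ktensor H H) : tmul (ktens 1 1) t = t.
Proof.
move: t; apply: klin_ind => [||a b]; [exact: tmul_lin2|exact: klin_id|].
by rewrite tmul_tens !mul1r.
Qed.

Lemma tmulr1 (t : ktensor H H) : tmul t (ktens 1 1) = t.
Proof.
move: t; apply: klin_ind => [||a b]; [exact: tmul_lin1|exact: klin_id|].
by rewrite tmul_tens !mulr1.
Qed.

Lemma Delta_Rbar h : tmul (D h) (Rbar T) = tmul (Rbar T) (tswap (D h)).
Proof. by rewrite Delta_cop !tmulA Rmat_mulVl tmul1. Qed.

Section SweedlerR.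
Variable V : lmodType k.

Lemma ksum_mul (f : H -> H -> V) t u :
  (forall y, klinear (f^~ y)) -> (forall x, klinear (f x)) ->
  ksum f (tmul t u) =
  ksum (fun a b => ksum (fun c d => f (a * c) (b * d)) u) t.
Proof.
move=> l1 l2; have bf := klin_bilin l1 l2.
rewrite /tmul (map_ksum _ _ (ksumD bf)).
apply: eq_ksum => a b; rewrite (map_ksum _ _ (ksumD bf)).
by apply: eq_ksum => c d; rewrite (ksum_tens _ _ bf).
Qed.

Lemma ksum_swap (f : H -> H -> V) t :
  (forall y, klinear (f^~ y)) -> (forall x, klinear (f x)) ->
  ksum f (tswap t) = ksum (fun a b => f b a) t.
Proof.
move=> l1 l2; have bf := klin_bilin l1 l2.
rewrite /tswap (map_ksum _ _ (ksumD bf)).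
by apply: eq_ksum => a b; rewrite (ksum_tens _ _ bf).
Qed.

Lemma sw_Rcop (f : H -> H -> V) h :
  (forall y, klinear (f^~ y)) -> (forall x, klinear (f x)) ->
  ksum (fun x y => ksum (fun r1 r2 => f (x * r1) (y * r2)) (Rbar T)) (D h) =
  ksum (fun r1 r2 => ksum (fun x y => f (r1 * y) (r2 * x)) (D h)) (Rbar T).
Proof.
move=> l1 l2; rewrite -ksum_mul // Delta_Rbar ksum_mul //.
by apply: eq_ksum => r1 r2; rewrite ksum_swap //; klin.
Qed.

Lemma Rbar_swap (f : H -> H -> V) :
  (forall y, klinear (f^~ y)) -> (forall x, klinear (f x)) ->
  ksum f (Rbar T) = ksum (fun a b => f b a) (Rmat T).
Proof. by move=> l1 l2; rewrite -Rmat_triang ksum_swap. Qed.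

Lemma Rmat_swap (f : H -> H -> V) :
  (forall y, klinear (f^~ y)) -> (forall x, klinear (f x)) ->
  ksum f (Rmat T) = ksum (fun a b => f b a) (Rbar T).
Proof. by move=> l1 l2; rewrite Rbar_swap. Qed.

(* (id (x) Delta) Rbar = Rbar_12 Rbar_13 *)
Lemma sw_RD2 (f : H -> H -> H -> V) :
  (forall y z, klinear (fun x => f x y z)) ->
  (forall x z, klinear (fun y => f x y z)) ->
  (forall x y, klinear (f x y)) ->
  ksum (fun r1 r2 => ksum (fun x y => f r1 x y) (D r2)) (Rbar T) =
  ksum (fun r1 r2 => ksum (fun s1 s2 => f (r1 * s1) r2 s2) (Rbar T)) (Rbar T).
Proof.
move=> l1 l2 l3; pose g x y z := f z x y.
have := congr1 (ksum3 g) (Rmat_Delta1 T).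
have gD : {morph ksum3 g : x y / x + y} by apply: ksum3D; rewrite /g.
rewrite !(map_ksum _ _ gD) => e.
rewrite Rbar_swap; try by klin.
etransitivity; first (etransitivity; last exact: e).
  by apply: eq_ksum => a b; rewrite ksum3_tens //; rewrite /g.
rewrite [RHS]Rbar_swap; last 2 first.
- by move=> y; apply: klin_sum => s1 s2; exact: (klin_comp (l1 _ _) (klin_mull _ (@klin_id _ _))).
- by klin.
apply: eq_ksum => a b; rewrite (map_ksum _ _ gD) Rbar_swap; last 2 first.
- by move=> y; exact: (klin_comp (l1 _ _) (klin_mulr _ (@klin_id _ _))).
- by klin.
by apply: eq_ksum => a' b'; rewrite ksum3_tens3 //; rewrite /g.
Qed.

(* (Delta (x) id) Rbar = Rbar_23 Rbar_13 *)
Lemma sw_RD1 (f : H -> H -> H -> V) :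
  (forall y z, klinear (fun x => f x y z)) ->
  (forall x z, klinear (fun y => f x y z)) ->
  (forall x y, klinear (f x y)) ->
  ksum (fun r1 r2 => ksum (fun x y => f x y r2) (D r1)) (Rbar T) =
  ksum (fun r1 r2 => ksum (fun s1 s2 => f s1 r1 (r2 * s2)) (Rbar T)) (Rbar T).
Proof.
move=> l1 l2 l3; pose g x y z := f y z x.
have := congr1 (ksum3 g) (Rmat_Delta2 T).
have gD : {morph ksum3 g : x y / x + y} by apply: ksum3D; rewrite /g.
rewrite !(map_ksum _ _ gD) => e.
rewrite Rbar_swap; try by klin.
etransitivity; first (etransitivity; last exact: e).
  apply: eq_ksum => a b; rewrite (map_ksum _ _ gD).
  by apply: eq_ksum => b1 b2; rewrite ksum3_tens3 //; rewrite /g.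
rewrite [RHS]Rbar_swap; last 2 first.
- by klin.
- by move=> x; apply: klin_sum => s1 s2; exact: (klin_comp (l3 _ _) (klin_mull _ (@klin_id _ _))).
apply: eq_ksum => a b; rewrite (map_ksum _ _ gD) Rbar_swap; last 2 first.
- by klin.
- by move=> x; exact: (klin_comp (l3 _ _) (klin_mulr _ (@klin_id _ _))).
by apply: eq_ksum => a' b'; rewrite ksum3_tens3 //; rewrite /g.
Qed.

(* Rbar Rbar_21 = 1 (x) 1 *)
Lemma sw_Rbar21 (f : H -> H -> V) :
  (forall y, klinear (f^~ y)) -> (forall x, klinear (f x)) ->
  ksum (fun r1 r2 => ksum (fun s1 s2 => f (r1 * s2) (r2 * s1)) (Rbar T))
    (Rbar T) = f 1 1.
Proof.
move=> l1 l2; rewrite -(ksum_tens 1 1 (klin_bilin l1 l2)) -(Rmat_mulVl T).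
rewrite ksum_mul //; apply: eq_ksum => r1 r2; rewrite Rmat_swap //.
- by move=> y; exact: (klin_comp (l1 _) (klin_mulr _ (@klin_id _ _))).
- by move=> y; exact: (klin_comp (l2 _) (klin_mulr _ (@klin_id _ _))).
Qed.

End SweedlerR.

Lemma antip1 : S 1 = 1.
Proof.
have := sw_antipL 1 (@klin_id _ H); rewrite sw_D1; try by klin.
by rewrite mulr1 counit1 scale1r.
Qed.

Lemma antipM g h : S (g * h) = S h * S g.
Proof.
pose F x1 x2 x3 y1 y2 y3 := S (x1 * y1) * (x2 * y2) * (S y3 * S x3).
transitivity (ksum (fun x1 x => ksum (fun y1 y =>
   ksum (fun x2 x3 => ksum (fun y2 y3 => F x1 x2 x3 y1 y2 y3) (D y)) (D x))
   (D h)) (D g)).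
  symmetry; transitivity (ksum (fun x1 x => ksum (fun y1 y =>
     (eps y : k) *: ((eps x : k) *: S (x1 * y1))) (D h)) (D g)).
    apply: eq_ksum => x1 x; apply: eq_ksum => y1 y.
    transitivity (ksum (fun x2 x3 =>
       (eps y : k) *: (S (x1 * y1) * (x2 * S x3))) (D x)).
      apply: eq_ksum => x2 x3.
      transitivity (ksum (fun y2 y3 => S (x1 * y1) *
                       (x2 * (y2 * S y3) * S x3)) (D y)).
        by apply: eq_ksum => y2 y3; rewrite /F !mulrA.
      rewrite (sw_antipR (f := fun z => S (x1 * y1) * (x2 * z * S x3))).
        by rewrite mulr1.
      by klin.
    rewrite (sw_antipR (f := fun z => (eps y : k) *: (S (x1 * y1) * z))).
      by rewrite mulr1 !scalerA mulrC.
    by klin.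
  transitivity (ksum (fun x1 x => (eps x : k) *: S (x1 * h)) (D g)).
    apply: eq_ksum => x1 x.
    by rewrite (sw_counitR (f := fun z => (eps x : k) *: S (x1 * z))) //; klin.
  by rewrite (sw_counitR (f := fun z => S (z * h))) //; klin.
transitivity (ksum (fun x x3 => ksum (fun y y3 =>
   ksum (fun x1 x2 => ksum (fun y1 y2 => F x1 x2 x3 y1 y2 y3) (D y)) (D x))
   (D h)) (D g)).
  symmetry; transitivity (ksum (fun x x3 => ksum (fun x1 x2 =>
      ksum (fun y y3 => ksum (fun y1 y2 => F x1 x2 x3 y1 y2 y3) (D y))
     (D h)) (D x)) (D g)).
    by apply: eq_ksum => x x3; rewrite ksum_exchange.
  rewrite (sw_coassoc (f := fun x1 x2 x3 => ksum (fun y y3 =>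
     ksum (fun y1 y2 => F x1 x2 x3 y1 y2 y3) (D y)) (D h))); try by rewrite /F; klin.
  apply: eq_ksum => x1 x; rewrite [RHS]ksum_exchange.
  apply: eq_ksum => x2 x3.
  by rewrite (sw_coassoc (f := fun y1 y2 y3 => F x1 x2 x3 y1 y2 y3)) //;
    rewrite /F; klin.
transitivity (ksum (fun x x3 => ksum (fun y y3 =>
     (eps y : k) *: ((eps x : k) *: (S y3 * S x3))) (D h)) (D g)).
  apply: eq_ksum => x x3; apply: eq_ksum => y y3; rewrite /F.
  rewrite -(sw_DM (f := fun a b => S a * b * (S y3 * S x3))); try by klin.
  rewrite (sw_antipL (f := fun z => z * (S y3 * S x3))); try by klin.
  by rewrite mul1r counitM scalerA [X in _ = X *: _]mulrC.
transitivity (ksum (fun x x3 => (eps x : k) *: (S h * S x3)) (D g)).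
  apply: eq_ksum => x x3.
  by rewrite (sw_counitL (f := fun z => (eps x : k) *: (S z * S x3))) //; klin.
by rewrite (sw_counitL (f := fun z => S h * S z)) //; klin.
Qed.

End Hopf.

Section VectorFields.
Variables (k : comUnitRingType) (H : algType k) (T : triangularHopf H).
Variables (A : algType k) (X : bcModuleAlgebra T A).
Local Notation D := (Delta T).
Local Notation S := (antip T).
Local Notation eps := (counit T).
Local Notation R := (Rbar T).
Local Notation "h |> a" := (hopf_act X h a) (at level 38, right associativity).

(* The adjoint action (h |> f)(a) = h_(1) |> f(S(h_(2)) |> a) on maps A -> A. *)
Definition hend (h : H) (f : A -> A) (a : A) : A :=
  ksum (fun x y => x |> f (S y |> a)) (D h).

Definition braided_derivation (u : A -> A) : Prop :=
  klinear u /\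
  forall a b, u (a * b) =
    u a * b + ksum (fun r1 r2 => (r1 |> a) * hend r2 u b) R.

Section Hend.
Implicit Types (f g u : A -> A) (h : H) (a b : A).

Lemma eq_hend h f g a : f =1 g -> hend h f a = hend h g a.
Proof. by move=> e; apply: eq_ksum => x y; rewrite e. Qed.

Lemma hend_lin f h : klinear f -> klinear (hend h f).
Proof. by move=> lf; rewrite /hend; klin. Qed.

Lemma hend_linh f a : klinear f -> klinear (fun h => hend h f a).
Proof. by move=> lf; rewrite /hend; klin. Qed.

Lemma hend_linh2 (M : lmodType k) (p : M -> H) f a :
  klinear f -> klinear p -> klinear (fun m => hend (p m) f a).
Proof. by move=> lf lp; exact: (klin_comp (hend_linh a lf) lp). Qed.

Lemma hend_lin2 (M : lmodType k) (p : M -> A) f h :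
  klinear f -> klinear p -> klinear (fun m => hend h f (p m)).
Proof. by move=> lf lp; exact: (klin_comp (hend_lin h lf) lp). Qed.

Lemma hend_linf (M : lmodType k) (f : M -> A -> A) h a :
  (forall b, klinear (f^~ b)) -> klinear (fun m => hend h (f m) a).
Proof. by move=> lf; rewrite /hend; klin. Qed.

Lemma hend_add h f g a : hend h (fun b => f b + g b) a = hend h f a + hend h g a.
Proof. by rewrite -ksum_split; apply: eq_ksum => x y; rewrite linearD. Qed.

Lemma hend_sub h f g a : hend h (fun b => f b - g b) a = hend h f a - hend h g a.
Proof.
rewrite /hend /ksum /tsum -sumrN -big_split.
by apply: eq_bigr => p _; rewrite linearB.
Qed.

Lemma hend_ksum (M N : lmodType k) h (f : M -> N -> A -> A) (t : ktensor M N) a :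
  hend h (fun b => ksum (fun m n => f m n b) t) a =
  ksum (fun m n => hend h (f m n) a) t.
Proof.
rewrite /hend ksum_exchange; apply: eq_ksum => x y.
by rewrite (map_ksum _ _ (raddfD _)).
Qed.

Lemma hendM (h h1 : H) f a : klinear f ->
  hend (h * h1) f a = hend h (hend h1 f) a.
Proof.
move=> lf; rewrite /hend sw_DM; try by klin.
apply: eq_ksum => x y; rewrite (map_ksum _ _ (raddfD _)).
by apply: eq_ksum => c d; rewrite antipM !actM.
Qed.

Lemma hend1 f a : klinear f -> hend 1 f a = f a.
Proof.
by move=> lf; rewrite /hend sw_D1; try klin; rewrite antip1 !act1.
Qed.

Lemma hend_comp h f g b : klinear f -> klinear g ->
  hend h (fun a => f (g a)) b = ksum (fun x y => hend x f (hend y g b)) (D h).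
Proof.
move=> lf lg; symmetry.
transitivity (ksum (fun x y => ksum (fun x1 x2 => ksum (fun y1 y2 =>
    x1 |> f ((S x2 * y1) |> g (S y2 |> b))) (D y)) (D x)) (D h)).
  apply: eq_ksum => x y; apply: eq_ksum => x1 x2; rewrite /hend.
  rewrite (map_ksum _ _ (raddfD _)) (map_ksum _ _ (klinD lf)).
  rewrite (map_ksum _ _ (raddfD _)).
  by apply: eq_ksum => y1 y2; rewrite actM.
rewrite (sw_coassoc T (f := fun x1 x2 y => ksum (fun y1 y2 =>
    x1 |> f ((S x2 * y1) |> g (S y2 |> b))) (D y))); try by klin.
apply: eq_ksum => x z.
rewrite -(sw_coassoc T (f := fun z1 y1 y2 =>
    x |> f ((S z1 * y1) |> g (S y2 |> b)))); try by klin.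
transitivity (ksum (fun w y2 => (eps w : k) *: (x |> f (g (S y2 |> b)))) (D z)).
  apply: eq_ksum => w y2.
  rewrite (sw_antipL T (f := fun c => x |> f (c |> g (S y2 |> b)))); try by klin.
  by rewrite act1.
by rewrite (sw_counitL T (f := fun c => x |> f (g (S c |> b)))) //; klin.
Qed.

Lemma hend_mull h a b : hend h (fun c => a * c) b = (h |> a) * b.
Proof.
transitivity (ksum (fun x y => ksum (fun x1 x2 =>
    (x1 |> a) * ((x2 * S y) |> b)) (D x)) (D h)).
  apply: eq_ksum => x y; rewrite act_mul; apply: eq_ksum => x1 x2.
  by rewrite actM.
rewrite (sw_coassoc T (f := fun x1 x2 y => (x1 |> a) * ((x2 * S y) |> b)));
  try by klin.
transitivity (ksum (fun x z => (eps z : k) *: ((x |> a) * b)) (D h)).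
  apply: eq_ksum => x z.
  rewrite (sw_antipR T (f := fun c => (x |> a) * (c |> b))); try by klin.
  by rewrite act1.
by rewrite (sw_counitR T (f := fun c => (c |> a) * b)) //; klin.
Qed.

Lemma act_app h f a : klinear f ->
  h |> f a = ksum (fun x y => hend x f (y |> a)) (D h).
Proof.
move=> lf; symmetry.
transitivity (ksum (fun x y => ksum (fun x1 x2 =>
    x1 |> f ((S x2 * y) |> a)) (D x)) (D h)).
  by apply: eq_ksum => x y; apply: eq_ksum => x1 x2; rewrite actM.
rewrite (sw_coassoc T (f := fun x1 x2 y => x1 |> f ((S x2 * y) |> a)));
  try by klin.
transitivity (ksum (fun x z => (eps z : k) *: (x |> f a)) (D h)).
  apply: eq_ksum => x z.
  rewrite (sw_antipL T (f := fun c => x |> f (c |> a))); try by klin.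
  by rewrite act1.
by rewrite (sw_counitR T (f := fun c => c |> f a)) //; klin.
Qed.

Lemma hend_mul h f a b : klinear f ->
  hend h f (a * b) = ksum (fun x y => hend x (fun c => f ((S y |> a) * c)) b) (D h).
Proof.
move=> lf; symmetry.
transitivity (ksum (fun x y => ksum (fun x1 x2 =>
    hend x1 f (((x2 * S y) |> a) * b)) (D x)) (D h)).
  apply: eq_ksum => x y.
  rewrite hend_comp //; try by klin.
  by apply: eq_ksum => x1 x2; rewrite hend_mull actM.
have lh := fun z c => @hend_linh f c lf.
rewrite (sw_coassoc T (f := fun x1 x2 y => hend x1 f (((x2 * S y) |> a) * b)));
  last 3 first.
- by move=> y z; exact: hend_linh.
- by move=> y z; apply: hend_lin2; klin.
- by move=> y z; apply: hend_lin2; klin.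
transitivity (ksum (fun x z => (eps z : k) *: hend x f (a * b)) (D h)).
  apply: eq_ksum => x z.
  rewrite (sw_antipR T (f := fun c => hend x f ((c |> a) * b))).
    by rewrite act1.
  by apply: hend_lin2; klin.
by rewrite (sw_counitR T (f := fun c => hend c f (a * b))) //; exact: hend_linh.
Qed.

Lemma bder_hend h u : braided_derivation u -> braided_derivation (hend h u).
Proof.
case=> lu du; split=> [|a b]; first exact: hend_lin.
rewrite hend_mul //.
transitivity (ksum (fun x y => (x |> u (S y |> a)) * b +
    ksum (fun r1 r2 => ksum (fun x1 x2 =>
      ((x1 * r1 * S y) |> a) * hend (x2 * r2) u b) (D x)) R) (D h)).
  apply: eq_ksum => x y.
  rewrite (eq_hend _ _ (du _)) hend_add hend_mull; congr (_ + _).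
  rewrite hend_ksum; apply: eq_ksum => r1 r2.
  rewrite (@hend_comp x (fun c => (r1 |> S y |> a) * c)); last 2 first.
  - by klin.
  - exact: hend_lin.
  by apply: eq_ksum => x1 x2; rewrite hend_mull -hendM // !actM.
rewrite ksum_split; congr (_ + _).
  by rewrite /hend (map_ksum (h := fun c => c * b) _ _ (fun c d => mulrDl c d b)).
transitivity (ksum (fun x y => ksum (fun r1 r2 => ksum (fun x1 x2 =>
      ((r1 * x2 * S y) |> a) * hend (r2 * x1) u b) (D x)) R) (D h)).
  apply: eq_ksum => x y; rewrite ksum_exchange.
  rewrite (sw_Rcop T (f := fun p q => ((p * S y) |> a) * hend q u b)) //.
    by klin.
  by move=> p; apply: klin_mulr; exact: hend_linh.
rewrite ksum_exchange; apply: eq_ksum => r1 r2.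
rewrite (sw_coassoc T (f := fun x1 x2 y =>
  ((r1 * x2 * S y) |> a) * hend (r2 * x1) u b)); last 3 first.
- by move=> p q; apply: klin_mulr; apply: hend_linh2 => //; klin.
- by klin.
- by klin.
transitivity (ksum (fun x z =>
    (eps z : k) *: ((r1 |> a) * hend (r2 * x) u b)) (D h)).
  apply: eq_ksum => x z.
  transitivity (ksum (fun z1 z2 => ((r1 * (z1 * S z2)) |> a) *
       hend (r2 * x) u b) (D z)).
    by apply: eq_ksum => z1 z2; rewrite mulrA.
  rewrite (sw_antipR T (f := fun c => ((r1 * c) |> a) * hend (r2 * x) u b)).
    by rewrite mulr1.
  by klin.
rewrite (sw_counitR T (f := fun c => (r1 |> a) * hend (r2 * c) u b)).
  by rewrite hendM.
by apply: klin_mulr; apply: hend_linh2 => //; klin.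
Qed.

Lemma hend_mull_comp h a f b : klinear f ->
  hend h (fun c => a * f c) b = ksum (fun x y => (x |> a) * hend y f b) (D h).
Proof.
move=> lf; rewrite (@hend_comp h (fun c => a * c)) //; last by klin.
by apply: eq_ksum => x y; rewrite hend_mull.
Qed.

Lemma bcomm_R a b (V : lmodType k) (F : H -> A -> V) :
  (forall c, klinear (F^~ c)) -> (forall h, klinear (F h)) ->
  ksum (fun r1 r2 => ksum (fun x y => F y ((r1 |> b) * (x |> a))) (D r2)) R =
  ksum (fun s1 s2 => F s2 (a * (s1 |> b))) R.
Proof.
move=> l1 l2; rewrite (sw_RD2 T (f := fun r x y => F y ((r |> b) * (x |> a))));
  try by klin.
rewrite ksum_exchange; apply: eq_ksum => s1 s2.
rewrite (bcomm X a (s1 |> b)) (map_ksum _ _ (klinD (l2 s2))).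
by apply: eq_ksum => r1 r2; rewrite actM.
Qed.

Lemma bder_mull a u : braided_derivation u ->
  braided_derivation (fun c => a * u c).
Proof.
case=> lu du; split=> [|b c]; first by klin.
rewrite du mulrDr mulrA; congr (_ + _).
transitivity (ksum (fun r1 r2 => ksum (fun x y =>
    ((r1 |> b) * (x |> a)) * hend y u c) (D r2)) R).
  rewrite (@bcomm_R a b _ (fun h d => d * hend h u c)); last 2 first.
  - by move=> d; apply: klin_mulr; exact: hend_linh.
  - by klin.
  rewrite (map_ksum _ _ (mulrDr a)); apply: eq_ksum => r1 r2.
  by rewrite mulrA.
apply: eq_ksum => r1 r2; rewrite hend_mull_comp // (map_ksum _ _ (mulrDr _)).
by apply: eq_ksum => x y; rewrite mulrA.
Qed.

Lemma bder_zero : braided_derivation (fun=> 0).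
Proof.
split=> [c x y|a b]; first by rewrite scaler0 addr0.
rewrite mul0r add0r; symmetry; apply: big1 => r _.
by rewrite (_ : hend _ _ _ = 0) ?mulr0 //; apply: big1 => p _; rewrite raddf0.
Qed.

Lemma bder_add u v : braided_derivation u -> braided_derivation v ->
  braided_derivation (fun a => u a + v a).
Proof.
case=> lu du [lv dv]; split=> [|a b]; first exact: klin_add.
rewrite du dv mulrDl addrACA; congr (_ + _); rewrite -ksum_split.
by apply: eq_ksum => r1 r2; rewrite hend_add mulrDr.
Qed.

Lemma bder_opp u : braided_derivation u -> braided_derivation (fun a => - u a).
Proof.
case=> lu du; split=> [c x y|a b].
  by rewrite lu opprD scalerN.
rewrite du opprD mulNr; congr (_ + _).
rewrite /ksum /tsum -sumrN; apply: eq_bigr => r _.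
rewrite -mulrN /hend /ksum /tsum -sumrN; congr (_ * _).
by apply: eq_bigr => p _; rewrite raddfN.
Qed.

Lemma bder_comp u v a b : braided_derivation u -> braided_derivation v ->
  u (v (a * b)) = u (v a) * b
    + ksum (fun r1 r2 => (r1 |> v a) * hend r2 u b) R
    + ksum (fun r1 r2 => u (r1 |> a) * hend r2 v b) R
    + ksum (fun r1 r2 => (r1 |> a) * hend r2 (fun c => u (v c)) b) R.
Proof.
case=> lu du [lv dv]; rewrite dv (klinD lu) du -!addrA; congr (_ + (_ + _)).
rewrite (map_ksum _ _ (klinD lu)) -ksum_split.
transitivity (ksum (fun r1 r2 => u (r1 |> a) * hend r2 v b +
  ksum (fun s1 s2 => ((s1 * r1) |> a) * hend s2 u (hend r2 v b)) R) R).
  apply: eq_ksum => r1 r2; rewrite du; congr (_ + _).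
  by apply: eq_ksum => s1 s2; rewrite actM.
rewrite !ksum_split; congr (_ + _).
rewrite ksum_exchange -(sw_RD2 T (f := fun r x y =>
  (r |> a) * hend x u (hend y v b))); last 3 first.
- by klin.
- by move=> p q; apply: klin_mulr; exact: hend_linh.
- move=> p q; apply: klin_mulr; apply: hend_lin2 => //; exact: hend_linh.
apply: eq_ksum => r1 r2; rewrite hend_comp // (map_ksum _ _ (mulrDr _)).
by [].
Qed.

Lemma sub_cross (V : zmodType) (p q w1 w2 t1 t2 : V) :
  p + w1 + w2 + t1 - (q + w2 + w1 + t2) = p - q + (t1 - t2).
Proof.
rewrite [p + _ + _ + _](ACl (1*4*(3*2)))%AC [q + _ + _ + _](ACl (1*4*(2*3)))%AC.
by rewrite opprD addrACA subrr addr0 opprD addrACA.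
Qed.

Definition bracket_fun u v a : A :=
  u (v a) - ksum (fun r1 r2 => hend r1 v (hend r2 u a)) R.

Lemma bder_bracket u v : braided_derivation u -> braided_derivation v ->
  braided_derivation (bracket_fun u v).
Proof.
move=> du dv; case: (du) (dv) => lu _ [lv _].
have lc r1 r2 : klinear (fun a => hend r1 v (hend r2 u a)).
  by apply: hend_lin2 => //; exact: hend_lin.
split=> [|a b]; first by apply: klin_sub; klin.
have cross1 : ksum (fun r1 r2 => (r1 |> v a) * hend r2 u b) R =
    ksum (fun r1 r2 => ksum (fun s1 s2 =>
      hend r1 v (s1 |> a) * hend s2 (hend r2 u) b) R) R.
  transitivity (ksum (fun r1 r2 => ksum (fun x y =>
      hend x v (y |> a) * hend r2 u b) (D r1)) R).
    apply: eq_ksum => r1 r2; rewrite (act_app _ _ lv).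
    by rewrite (map_ksum (h := fun c => c * _) _ _ (fun c d => mulrDl c d _)).
  rewrite (sw_RD1 T (f := fun x y z => hend x v (y |> a) * hend z u b));
    last 3 first.
  - by move=> p q; apply: klin_mull; exact: hend_linh.
  - by move=> p q; apply: klin_mull; apply: hend_lin2 => //; klin.
  - by move=> p q; apply: klin_mulr; exact: hend_linh.
  rewrite ksum_exchange; apply: eq_ksum => s1 s2; apply: eq_ksum => r1 r2.
  by rewrite hendM.
have cross2 : ksum (fun r1 r2 => u (r1 |> a) * hend r2 v b) R =
    ksum (fun r1 r2 => ksum (fun s1 s2 =>
      (s1 |> hend r2 u a) * hend s2 (hend r1 v) b) R) R.
  symmetry; transitivity (ksum (fun r1 r2 => ksum (fun t1 t2 =>
      ksum (fun s1 s2 => hend (s1 * r2) u (t1 |> a) *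
         hend (t2 * (s2 * r1)) v b) R) R) R).
    apply: eq_ksum => r1 r2.
    transitivity (ksum (fun t1 t2 => ksum (fun s1 s2 =>
       hend (s1 * r2) u (t1 |> a) * hend (t2 * s2 * r1) v b) R) R); last first.
      by apply: eq_ksum => t1 t2; apply: eq_ksum => s1 s2; rewrite mulrA.
    rewrite -(sw_RD1 T (f := fun x y z => hend (x * r2) u (y |> a) *
       hend (z * r1) v b)); last 3 first.
    - by move=> p q; apply: klin_mull; apply: hend_linh2 => //; klin.
    - by move=> p q; apply: klin_mull; apply: hend_lin2 => //; klin.
    - by move=> p q; apply: klin_mulr; apply: hend_linh2 => //; klin.
    apply: eq_ksum => s1 s2; rewrite (act_app _ _ (hend_lin _ lu)).
    rewrite (map_ksum (h := fun c => c * _) _ _ (fun c d => mulrDl c d _)).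
    by apply: eq_ksum => x y; rewrite -!hendM.
  rewrite ksum_exchange; apply: eq_ksum => t1 t2; rewrite ksum_exchange.
  rewrite (sw_Rbar21 T (f := fun p q =>
    hend p u (t1 |> a) * hend (t2 * q) v b)); last 2 first.
  - by move=> p; apply: klin_mull; exact: hend_linh.
  - by move=> p; apply: klin_mulr; apply: hend_linh2 => //; klin.
  by rewrite hend1 // mulr1.
rewrite /bracket_fun bder_comp // mulrBl.
transitivity (u (v a) * b
    + ksum (fun r1 r2 => (r1 |> v a) * hend r2 u b) R
    + ksum (fun r1 r2 => u (r1 |> a) * hend r2 v b) R
    + ksum (fun r1 r2 => (r1 |> a) * hend r2 (fun c => u (v c)) b) R
  - (ksum (fun r1 r2 => hend r1 v (hend r2 u a)) R * b
    + ksum (fun r1 r2 => u (r1 |> a) * hend r2 v b) R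
    + ksum (fun r1 r2 => (r1 |> v a) * hend r2 u b) R
    + ksum (fun r1 r2 => (r1 |> a) *
        hend r2 (fun c => ksum (fun s1 s2 => hend s1 v (hend s2 u c)) R) b) R)).
  congr (_ - _).
  rewrite cross1 cross2 (map_ksum (h := fun c => c * _) _ _ (fun c d => mulrDl c d _)).
  have -> : ksum (fun r1 r2 => (r1 |> a) *
       hend r2 (fun c => ksum (fun s1 s2 => hend s1 v (hend s2 u c)) R) b) R =
     ksum (fun s1 s2 => ksum (fun r1 r2 => (r1 |> a) *
       hend r2 (fun c => hend s1 v (hend s2 u c)) b) R) R.
    rewrite ksum_exchange; apply: eq_ksum => r1 r2.
    by rewrite hend_ksum (map_ksum _ _ (mulrDr _)).
  rewrite -!ksum_split; apply: eq_ksum => r1 r2.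
  by rewrite (bder_comp _ _ (bder_hend r1 dv) (bder_hend r2 du)).
have -> : ksum (fun r1 r2 => (r1 |> a) * hend r2 (bracket_fun u v) b) R =
    ksum (fun r1 r2 => (r1 |> a) * hend r2 (fun c => u (v c)) b) R -
    ksum (fun r1 r2 => (r1 |> a) *
        hend r2 (fun c => ksum (fun s1 s2 => hend s1 v (hend s2 u c)) R) b) R.
  rewrite /ksum /tsum -sumrN -big_split; apply: eq_bigr => r _ /=.
  by rewrite /bracket_fun hend_sub mulrBr.
exact: sub_cross.
Qed.

End Hend.
End VectorFields.

Section VectorFieldModule.
Variables (k : comUnitRingType) (H : algType k) (T : triangularHopf H).
Variables (A : algType k) (X : bcModuleAlgebra T A).
Local Notation D := (Delta T).
Local Notation S := (antip T).
Local Notation SV := (antipV T).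
Local Notation eps := (counit T).
Local Notation R := (Rbar T).
Local Notation "h |> a" := (hopf_act X h a) (at level 38, right associativity).

Record vfield := VField {
  vfun :> A -> A;
  vfieldP : braided_derivation X vfun
}.
HB.instance Definition _ := gen_eqMixin vfield.
HB.instance Definition _ := gen_choiceMixin vfield.

Implicit Types (u v z : vfield) (a b : A) (h : H).

Lemma vfield_eq u v : u =1 v -> u = v.
Proof.
case: u v => u pu [v pv] /= /funext e; case: _ / e pv => pv.
by congr VField; exact: Prop_irrelevance.
Qed.

Lemma vlin u : klinear u. Proof. by case: (vfieldP u). Qed.

Definition vzero := VField (bder_zero X).
Definition vadd u v := VField (bder_add (vfieldP u) (vfieldP v)).
Definition vopp u := VField (bder_opp (vfieldP u)).
Definition vscale a u := VField (bder_mull a (vfieldP u)).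

Fact vaddA : associative vadd.
Proof. by move=> u v w; apply: vfield_eq => a /=; rewrite addrA. Qed.
Fact vaddC : commutative vadd.
Proof. by move=> u v; apply: vfield_eq => a /=; rewrite addrC. Qed.
Fact vadd0 : left_id vzero vadd.
Proof. by move=> u; apply: vfield_eq => a /=; rewrite add0r. Qed.
Fact vaddN : left_inverse vzero vopp vadd.
Proof. by move=> u; apply: vfield_eq => a /=; rewrite addNr. Qed.
HB.instance Definition _ :=
  GRing.isZmodule.Build vfield vaddA vaddC vadd0 vaddN.

Fact vscaleA a b u : vscale a (vscale b u) = vscale (a * b) u.
Proof. by apply: vfield_eq => c /=; rewrite mulrA. Qed.
Fact vscale1 : left_id 1 vscale.
Proof. by move=> u; apply: vfield_eq => c /=; rewrite mul1r. Qed.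
Fact vscaleDr : right_distributive vscale +%R.
Proof. by move=> a u v; apply: vfield_eq => c /=; rewrite mulrDr. Qed.
Fact vscaleDl u : {morph vscale^~ u : a b / a + b}.
Proof. by move=> a b; apply: vfield_eq => c /=; rewrite mulrDl. Qed.
HB.instance Definition _ := GRing.Zmodule_isLmodule.Build A vfield
  vscaleA vscale1 vscaleDr vscaleDl.

Lemma vfunD u v c : (u + v) c = u c + v c. Proof. by []. Qed.
Lemma vfunZ a u c : (a *: u) c = a * u c. Proof. by []. Qed.

Lemma vfun_ksum (M N : lmodType k) (f : M -> N -> vfield) (t : ktensor M N) c :
  ksum f t c = ksum (fun m n => f m n c) t.
Proof. by rewrite (map_ksum (h := fun u : vfield => u c)). Qed.

Definition vact h u := VField (bder_hend h (vfieldP u)).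

Lemma vact_linp (M : lmodType k) (p : M -> H) u c m m' : klinear p ->
  vact (p (c *: m + m')) u = c%:A *: vact (p m) u + vact (p m') u.
Proof.
move=> lp; apply: vfield_eq => a.
rewrite vfunD vfunZ /= (@hend_linh2 _ _ _ _ X _ p u a (vlin u) lp).
by rewrite -scalerAl mul1r.
Qed.

(* The right action u a = (Rbar^a |> a)(Rbar_a |> u). *)
Definition vactr u a : vfield := ksum (fun r1 r2 => (r1 |> a) *: vact r2 u) R.

Lemma vactr_lin b u v a : vactr (b *: u + v) a = b *: vactr u a + vactr v a.
Proof.
apply: vfield_eq => c; rewrite vfunD vfunZ !vfun_ksum.
transitivity (ksum (fun r1 r2 => (r1 |> a) * hend X r2 (fun d => b * u d) c) R +
  ksum (fun r1 r2 => (r1 |> a) * hend X r2 v c) R).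
  rewrite -ksum_split; apply: eq_ksum => r1 r2.
  by rewrite -mulrDr -hend_add.
congr (_ + _); transitivity (ksum (fun r1 r2 => ksum (fun x y =>
    ((r1 |> a) * (x |> b)) * hend X y u c) (D r2)) R).
  apply: eq_ksum => r1 r2; rewrite hend_mull_comp; last exact: vlin.
  rewrite (map_ksum _ _ (mulrDr _)).
  by apply: eq_ksum => x y; rewrite mulrA.
rewrite (@bcomm_R _ _ _ _ X b a _ (fun h d => d * hend X h u c)); last 2 first.
- by move=> d; apply: klin_mulr; apply: hend_linh; exact: vlin.
- by klin.
rewrite (map_ksum _ _ (mulrDr b)); apply: eq_ksum => r1 r2.
by rewrite mulrA.
Qed.

Definition bracket u v : vfield := VField (bder_bracket (vfieldP u) (vfieldP v)).

Record oneform := OneForm {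
  ffun :> vfield -> A;
  formP : forall a u v, ffun (a *: u + v) = a * ffun u + ffun v
}.
HB.instance Definition _ := gen_eqMixin oneform.
HB.instance Definition _ := gen_choiceMixin oneform.

Implicit Types (w th : oneform).

Lemma form_eq w th : w =1 th -> w = th.
Proof.
case: w th => w pw [th pth] /= /funext e; case: _ / e pth => pth.
by congr OneForm; exact: Prop_irrelevance.
Qed.

Lemma formD w u v : w (u + v) = w u + w v.
Proof. by have := formP w 1 u v; rewrite !scale1r mul1r. Qed.
Lemma form0 w : w 0 = 0.
Proof. by apply: (addrI (w 0)); rewrite -formD !addr0. Qed.
Lemma formZ w a u : w (a *: u) = a * w u.
Proof. by have := formP w a u 0; rewrite form0 !addr0. Qed.

Fact fzeroP a u v : (fun=> 0 : A) (a *: u + v) = a * (fun=> 0) u + (fun=> 0) v.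
Proof. by rewrite mulr0 addr0. Qed.
Fact faddP w th a u v :
  w (a *: u + v) + th (a *: u + v) = a * (w u + th u) + (w v + th v).
Proof. by rewrite !formP mulrDr addrACA. Qed.
Fact foppP w a u v : - w (a *: u + v) = a * (- w u) + - w v.
Proof. by rewrite formP opprD mulrN. Qed.

Definition fzero : oneform := OneForm fzeroP.
Definition fadd w th : oneform := OneForm (faddP w th).
Definition fopp w : oneform := OneForm (foppP w).

Fact faddA : associative fadd.
Proof. by move=> w t s; apply: form_eq => a /=; rewrite addrA. Qed.
Fact faddC : commutative fadd.
Proof. by move=> w t; apply: form_eq => a /=; rewrite addrC. Qed.
Fact fadd0 : left_id fzero fadd.
Proof. by move=> w; apply: form_eq => a /=; rewrite add0r. Qed.
Fact faddN : left_inverse fzero fopp fadd.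
Proof. by move=> w; apply: form_eq => a /=; rewrite addNr. Qed.
HB.instance Definition _ :=
  GRing.isZmodule.Build oneform faddA faddC fadd0 faddN.

Fact fractP w a b u v : w (b *: u + v) * a = b * (w u * a) + w v * a.
Proof. by rewrite formP mulrDl mulrA. Qed.
Definition fractr w a : oneform := OneForm (fractP w a).

Fact factlP w a b u v :
  w (vactr (b *: u + v) a) = b * w (vactr u a) + w (vactr v a).
Proof. by rewrite vactr_lin formP. Qed.
Definition factl a w : oneform := OneForm (factlP w a).

Lemma antipV_lin : klinear SV.
Proof.
move=> c x y; apply: (can_inj (antipK T)).
by rewrite linearP !(antipVK T).
Qed.

Lemma antipV_mul1 h :
  ksum (fun x y => y * SV x) (D h) = (eps h : k)%:A.
Proof.
apply: (can_inj (antipK T)); rewrite (map_ksum _ _ (raddfD S)).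
rewrite linearZ /= antip1 -antipR; apply: eq_ksum => x y.
by rewrite antipM (antipVK T).
Qed.

Lemma antipV_mul2 h :
  ksum (fun x y => SV y * x) (D h) = (eps h : k)%:A.
Proof.
apply: (can_inj (antipK T)); rewrite (map_ksum _ _ (raddfD S)).
rewrite linearZ /= antip1 -antipL; apply: eq_ksum => x y.
by rewrite antipM (antipVK T).
Qed.

Lemma sw_antipV1 (V : lmodType k) (f : H -> V) h : klinear f ->
  ksum (fun x y => f (y * SV x)) (D h) = (eps h : k) *: f 1.
Proof.
by move=> lf; rewrite -(klinZ _ _ lf) -antipV_mul1 (map_ksum _ _ (klinD lf)).
Qed.

Lemma sw_antipV2 (V : lmodType k) (f : H -> V) h : klinear f ->
  ksum (fun x y => f (SV y * x)) (D h) = (eps h : k) *: f 1.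
Proof.
by move=> lf; rewrite -(klinZ _ _ lf) -antipV_mul2 (map_ksum _ _ (klinD lf)).
Qed.

Lemma hend_antipV h b u c :
  hend X (SV h) (fun d => b * u d) c =
  ksum (fun x y => (SV y |> b) * hend X (SV x) u c) (D h).
Proof.
have lSV := antipV_lin; have lu := vlin u.
pose Q h d := ksum (fun x y => (SV y |> b) * hend X (SV x) u d) (D h).
have lQ1 d : klinear (fun h => Q h d).
  apply: klin_ksumf; last exact: klin_morph.
    by move=> y; apply: klin_mulr; apply: hend_linh2.
  by move=> y; klin.
have lQ2 g : klinear (Q g).
  by apply: klin_sum => x y; apply: klin_mulr; exact: hend_lin.
have QE g d : ksum (fun p q => hend X q (Q p) d) (D g) = (eps g : k) *: (b * u d).
  transitivity (ksum (fun p q => ksum (fun x y => ksum (fun q1 q2 =>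
     ((q1 * SV y) |> b) * hend X (q2 * SV x) u d) (D q)) (D p)) (D g)).
    apply: eq_ksum => p q; rewrite hend_ksum; apply: eq_ksum => x y.
    rewrite hend_mull_comp; last exact: hend_lin.
    by apply: eq_ksum => q1 q2; rewrite hendM // actM.
  rewrite (sw_coassoc T (f := fun x y q => ksum (fun q1 q2 =>
     ((q1 * SV y) |> b) * hend X (q2 * SV x) u d) (D q))); last 3 first.
  - move=> p q; apply: klin_sum => q1 q2; apply: klin_mulr.
    by apply: hend_linh2 => //; klin.
  - by move=> p q; apply: klin_sum => q1 q2; klin.
  - move=> p q; apply: klin_ksumf; last exact: klin_morph.
      by move=> q2; klin.
    by move=> q1; apply: klin_mulr; apply: hend_linh2 => //; klin.
  transitivity (ksum (fun x r => (b * hend X (r * SV x) u d)) (D g)).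
    apply: eq_ksum => x r.
    rewrite -(sw_coassoc T (f := fun y q1 q2 =>
       ((q1 * SV y) |> b) * hend X (q2 * SV x) u d)); last 3 first.
    - by klin.
    - by klin.
    - by move=> p q; apply: klin_mulr; apply: hend_linh2 => //; klin.
    transitivity (ksum (fun s q2 =>
        (eps s : k) *: (b * hend X (q2 * SV x) u d)) (D r)).
      apply: eq_ksum => s q2.
      rewrite (sw_antipV1 (f := fun g => (g |> b) * hend X (q2 * SV x) u d)).
        by rewrite act1.
      by klin.
    rewrite (sw_counitL T (f := fun g => b * hend X (g * SV x) u d)) //.
    by apply: klin_mulr; apply: hend_linh2 => //; klin.
  rewrite (sw_antipV1 (f := fun g => b * hend X g u d)).
    by rewrite hend1.
  by apply: klin_mulr; exact: hend_linh.
rewrite -[RHS]/(Q h c).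
transitivity (ksum (fun g r => ksum (fun p q =>
    hend X (SV r * q) (Q p) c) (D g)) (D h)).
  transitivity (ksum (fun g r => (eps g : k) *:
      hend X (SV r) (fun d => b * u d) c) (D h)).
    rewrite (sw_counitL T (f := fun g => hend X (SV g) (fun d => b * u d) c)) //.
    by apply: hend_linh2 => //; klin.
  apply: eq_ksum => g r.
  transitivity (hend X (SV r)
     (fun d => ksum (fun p q => hend X q (Q p) d) (D g)) c).
    rewrite (eq_hend _ _ _ (QE g)) /hend /ksum /tsum scaler_sumr.
    by apply: eq_bigr => p _; rewrite linearZ.
  by rewrite hend_ksum; apply: eq_ksum => p q; rewrite hendM.
rewrite (sw_coassoc T (f := fun p q r => hend X (SV r * q) (Q p) c));
  last 3 first.
- move=> y r; exact: hend_linf.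
- by move=> y r; apply: hend_linh2 => //; klin.
- by move=> y r; apply: hend_linh2 => //; klin.
transitivity (ksum (fun p r => (eps r : k) *: Q p c) (D h)).
  apply: eq_ksum => p r.
  rewrite (sw_antipV2 (f := fun g => hend X g (Q p) c)); last exact: hend_linh.
  by rewrite hend1.
by rewrite (sw_counitR T (f := fun g => Q g c)).
Qed.

Lemma vact_antipV h b u :
  vact (SV h) (b *: u) = ksum (fun x y => (SV y |> b) *: vact (SV x) u) (D h).
Proof.
apply: vfield_eq => c; rewrite vfun_ksum /=.
by rewrite -hend_antipV; apply: eq_hend.
Qed.

Lemma vactD h u v : vact h (u + v) = vact h u + vact h v.
Proof. by apply: vfield_eq => c; exact: hend_add. Qed.

Lemma klin_form (M : lmodType k) (p : M -> H) w u :
  klinear p -> klinear (fun m => w (vact (p m) u)).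
Proof.
by move=> lp c m m'; rewrite vact_linp // formP -scalerAl mul1r.
Qed.

(* (h |> w)(u) = h_(2) |> w (S^{-1}(h_(1)) |> u) *)
Definition factH_fun h w u : A :=
  ksum (fun x y => y |> w (vact (SV x) u)) (D h).

Fact factHP h w b u v :
  factH_fun h w (b *: u + v) = b * factH_fun h w u + factH_fun h w v.
Proof.
have lSV := antipV_lin.
transitivity (factH_fun h w (b *: u) + factH_fun h w v).
  rewrite -ksum_split; apply: eq_ksum => x y.
  by rewrite vactD formD linearD.
congr (_ + _).
transitivity (ksum (fun x y => ksum (fun x1 x2 => ksum (fun y1 y2 =>
   ((y1 * SV x2) |> b) * (y2 |> w (vact (SV x1) u))) (D y)) (D x)) (D h)).
  apply: eq_ksum => x y; rewrite vact_antipV.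
  rewrite (map_ksum _ _ (formD w)) (map_ksum (h := hopf_act X y) _ _ (linearD _)).
  apply: eq_ksum => x1 x2; rewrite formZ act_mul.
  by apply: eq_ksum => y1 y2; rewrite actM.
rewrite (sw_coassoc T (f := fun x1 x2 y => ksum (fun y1 y2 =>
   ((y1 * SV x2) |> b) * (y2 |> w (vact (SV x1) u))) (D y))); last 3 first.
- move=> p q; apply: klin_sum => y1 y2; apply: klin_mulr; apply: klin_morph.
  exact: klin_form.
- by klin.
- by klin.
rewrite /factH_fun (map_ksum _ _ (mulrDr b)); apply: eq_ksum => x r.
rewrite -(sw_coassoc T (f := fun x2 y1 y2 =>
   ((y1 * SV x2) |> b) * (y2 |> w (vact (SV x) u)))); try by klin.
transitivity (ksum (fun s y2 =>
    (eps s : k) *: (b * (y2 |> w (vact (SV x) u)))) (D r)).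
  apply: eq_ksum => s y2.
  rewrite (sw_antipV1 (f := fun g => (g |> b) * (y2 |> w (vact (SV x) u)))).
    by rewrite act1.
  by klin.
by rewrite (sw_counitL T (f := fun g => b * (g |> w (vact (SV x) u)))) //; klin.
Qed.

Definition factH h w : oneform := OneForm (factHP h w).

Fact diffP a b u v : (b *: u + v) a = b * u a + v a.
Proof. by []. Qed.

Definition extd a : oneform := OneForm (diffP a).

End VectorFieldModule.

(* The operations of an H-equivariant A-bimodule. The bimodule and           *)
(* equivariance axioms are not bundled: on vector fields, one-forms and      *)
(* their tensor products they follow from the definitions. They make the     *)
(* expressions tsum f t below independent of the representative of t         *)
(* (lift_connection needs in addition that dnabla is a right connection,     *)
(* which holds when it is dual to a left connection).                        *)
Record hbimod (H A : Type) := HBimod {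
  hb_car :> zmodType;
  lact : A -> hb_car -> hb_car;
  ract : hb_car -> A -> hb_car;
  hact : H -> hb_car -> hb_car
}.
Arguments HBimod {H A} hb_car lact ract hact.

Section Geometry.
Variables (k : comUnitRingType) (H : algType k) (T : triangularHopf H).
Variables (A : algType k) (X : bcModuleAlgebra T A).
Local Notation D := (Delta T).
Local Notation S := (antip T).
Local Notation R := (Rbar T).
Local Notation bimod := (hbimod H A).

Definition Xfields : bimod :=
  HBimod (vfield X) (fun a u => a *: u) (@vactr _ _ _ _ X) (@vact _ _ _ _ X).

Definition Omega : bimod :=
  HBimod (oneform X) (@factl _ _ _ _ X) (@fractr _ _ _ _ X) (@factH _ _ _ _ X).

Section TensorOverA.
Variables M N : bimod.

Definition atensor_car : zmodType := tensor (@ract H A M) (@lact H A N).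

Definition atens (m : M) (n : N) : atensor_car := tens m n.

Definition atensor : bimod := HBimod atensor_car
  (fun a t => tsum (fun m n => atens (lact a m) n) t)
  (fun t a => tsum (fun m n => atens m (ract n a)) t)
  (fun h t => tsum (fun m n =>
     ksum (fun x y => atens (hact x m) (hact y n)) (D h)) t).

End TensorOverA.

Local Notation "M (x) N" := (atensor M N) (at level 40, left associativity).

Definition braid (M N : bimod) (t : M (x) N) : N (x) M :=
  tsum (fun v w => ksum (fun r1 r2 => atens (hact r1 w) (hact r2 v)) R) t.

Definition assocl (M N P : bimod) (t : M (x) (N (x) P)) : M (x) N (x) P :=
  tsum (fun m s => tsum (fun n p => atens (atens m n : M (x) N) p) s) t.

Definition assocr (M N P : bimod) (t : M (x) N (x) P) : M (x) (N (x) P) :=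
  tsum (fun s p => tsum (fun m n => atens m (atens n p : N (x) P)) s) t.

Definition braid23 (M N P : bimod) (t : M (x) N (x) P) : M (x) P (x) N :=
  assocl (tsum (fun m s => atens m (braid s)) (assocr t)).

Implicit Types (u v z : Xfields) (th : Omega).

(* <th, u>' *)
Definition pairing' th u : A :=
  ksum (fun r1 r2 => (factH r2 th : oneform X) (vact r1 u)) R.

Definition flat (g : Omega (x) Omega) (u : Xfields) : Omega :=
  tsum (fun (w1 w2 : Omega) => lact ((w1 : oneform X) u) w2) g.

(* <u (x) v, g> = <u, <v, g^a> g_a> *)
Definition pairing2 u v (g : Omega (x) Omega) : A := (flat g v : oneform X) u.

Definition is_metric (g : Omega (x) Omega) : Prop :=
  braid g = g /\ bijective (flat g).

(* th |-> <th, gb^b>' gb_b *)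
Definition sharp (gb : Xfields (x) Xfields) (th : Omega) : vfield X :=
  tsum (fun (u1 u2 : Xfields) => pairing' th u1 *: (u2 : vfield X)) gb.

Definition is_inverse_metric (g : Omega (x) Omega)
    (gb : Xfields (x) Xfields) : Prop :=
  cancel (flat g) (sharp gb) /\ cancel (sharp gb) (flat g).

Definition inverse_metric (g : Omega (x) Omega) : Xfields (x) Xfields :=
  xget 0 [set gb | is_inverse_metric g gb]%classic.

Definition is_left_connection (nabla : Xfields -> Omega (x) Xfields) : Prop :=
  [/\ {morph nabla : u v / u + v},
      forall (c : k) (v : vfield X),
        nabla (c%:A *: v) = lact c%:A (nabla v)
    & forall (a : A) (v : vfield X),
        nabla (a *: v) = atens (extd X a : Omega) (v : Xfields)
                         + lact a (nabla v)].

(* nabla_u v *)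
Definition covder (nabla : Xfields -> Omega (x) Xfields) (u v : vfield X) :
    vfield X :=
  tsum (fun (th : Omega) (w : Xfields) => (th : oneform X) u *: (w : vfield X))
       (nabla v).

Definition torsion_free (nabla : Xfields -> Omega (x) Xfields) : Prop :=
  forall u v : vfield X,
    covder nabla u v - ksum (fun r1 r2 => covder nabla (vact r1 v) (vact r2 u)) R
      - bracket u v = 0.

Definition is_dual_connection (nabla : Xfields -> Omega (x) Xfields)
    (dnabla : Omega -> Omega (x) Omega) : Prop :=
  forall (v : Xfields) (th : Omega),
    (extd X ((th : oneform X) v) : Omega) =
      tsum (fun (eta : Omega) (w : Xfields) => ract eta ((th : oneform X) w))
           (nabla v)
      + tsum (fun eta1 eta2 : Omega => lact ((eta1 : oneform X) v) eta2)
             (dnabla th).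

(* The adjoint action on maps M -> N. *)
Definition hact_map (M N : bimod) (h : H) (f : M -> N) (m : M) : N :=
  ksum (fun x y => hact x (f (hact (S y) m))) (D h).

Definition lift_connection (dnabla : Omega -> Omega (x) Omega)
    (g : Omega (x) Omega) : Omega (x) Omega (x) Omega :=
  tsum (fun th eta : Omega =>
    braid23 (atens (dnabla th) eta)
    + ksum (fun r1 r2 =>
        assocl (atens (hact r1 th) (hact_map r2 dnabla eta))) R) g.

(* The dual connection is determined by nabla when the vector fields are     *)
(* finitely generated and projective.                                        *)
Definition metric_compatible (g : Omega (x) Omega)
    (nabla : Xfields -> Omega (x) Xfields) : Prop :=
  exists2 dnabla, is_dual_connection nabla dnabla & lift_connection dnabla g = 0.

Definition levi_civita (g : Omega (x) Omega)
    (nabla : Xfields -> Omega (x) Xfields) : Prop :=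
  [/\ is_left_connection nabla, torsion_free nabla & metric_compatible g nabla].

Definition dual_basis (n : nat) (e : 'I_n -> vfield X) (w : 'I_n -> oneform X) :
    Prop :=
  forall u : vfield X, u = \sum_i w i u *: e i.

Definition koszul (g : Omega (x) Omega) (u v z : vfield X) : A :=
  u (pairing2 v z g)
  - ksum (fun r1 r2 => vact r1 v (pairing2 (vact r2 u) z g)) R
  + ksum (fun r1 r2 => ksum (fun s1 s2 =>
      vact (r1 * s1) z (pairing2 (vact r2 u) (vact s2 v) g)) R) R
  - pairing2 (bracket u v) z g
  + pairing2 u (bracket v z) g
  + ksum (fun r1 r2 => pairing2 (bracket u (vact r1 z)) (vact r2 v) g) R.

End Geometry.

Definition finitely_generated (B : pzRingType) (P : lmodType B) : Prop :=
  exists (n : nat) (e : 'I_n -> P),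
    forall p, exists c : 'I_n -> B, p = \sum_i c i *: e i.

Definition projective (B : pzRingType) (P : lmodType B) : Prop :=
  forall (M N : lmodType B) (q : {linear M -> N}) (f : {linear P -> N}),
    (forall y, exists x, q x = y) ->
    exists f' : {linear P -> M}, forall p, q (f' p) = f p.

Definition char0_field (k : comUnitRingType) : Prop :=
  exists (F : fieldType) (phi : {rmorphism F -> k}),
    [pchar F] =i pred0 /\ bijective phi.

(* phi identifies k with F[[h]], a series being its sequence of coefficients *)
Definition char0_power_series (k : comUnitRingType) : Prop :=
  exists (F : fieldType) (phi : k -> (nat -> F)),
    [/\ [pchar F] =i pred0, bijective phi,
        forall n, phi 1 n = (n == 0)%:R,
        forall x y n, phi (x + y) n = phi x n + phi y n
      & forall x y n, phi (x * y) n = \sum_(i < n.+1) phi x i * phi y (n - i)%N].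

(* Main.v *)
From HB Require Import structures.
From mathcomp Require Import all_boot all_algebra.
From mathcomp Require Import boolp classical_sets.
Require Import Defs.

(** Write R for the inverse of the universal R-matrix, R^a (x) R_a with
summation understood, and fix the metric g.  In every formula g and the
connection stand to the right of the vector fields on which they are
evaluated, so a condition on the connection is an identity between
k-trilinear functions of three vector fields in which only the vector fields
change places, through R.  By the two hexagon identities and R R_21 = 1, the
operations
[[
  (F s1)(u,v,z) = F(R^a v, R_a u, z),
  (F s2)(u,v,z) = F(u, R^a z, R_a v)
]]
define an action of the symmetric group S_3 on trilinear functions (swap12K,
swap23K, swap_braid), although neither g nor the connection is H-invariant.

Let C(u,v,z) = <u (x) nabla_v z, g>, G(u,v,z) = u<v (x) z, g> and
B(u,v,z) = <u (x) [v,z], g>.  Then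

- nabla is torsion free iff C - C s2 = B (torsion_freeP);
- nabla is metric compatible iff G = C s1 + C s1 s2 (metric_compatibleP).

In the group ring of S_3 these two equations give 2 C = K s1, where
K = G - G s1 + G s1 s2 - B s1 s2 + B + B s1 is the Koszul expression (koszulE,
koszul_comb_solve).  As 2 is invertible and g is nondegenerate, this proves
uniqueness and the explicit formula.

Conversely C = K s1 / 2 solves the two equations as soon as G s2 = G and
B s2 = - B (koszul_comb_metric, koszul_comb_torsion).  It has to be the
function C of a connection.  To see this, start from the Grassmann connection
of a dual basis, with function C0, and solve for the difference C - C0.  The
equations keep their form, but G and B are replaced by the nonmetricity and by
minus the torsion of C0, which are A-multilinear in the braided sense
(tensorial_metricity, tensorial_torsion).  Braided A-multilinearity is
preserved by S_3, so C - C0 is A-multilinear, and through the inverse of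
g^flat it becomes an A-linear correction of the Grassmann connection
(koszul_covariant).

Metric compatibility is phrased with the dual connection, lifted to
Omega (x)_A Omega by means of the H-action on maps.  Its translation into an
equation for C is the main computation (pairing3_lift).  Evaluated on three
vector fields, the lift of the dual connection is
[[
  u<v (x) z, g> - <R^a v (x) nabla_{R_a u} z, g>
    - <R^a R^b z (x) nabla_{R_a u} (R_b v), g>,
]]
and evaluation on vector fields is faithful because a dual basis exists
(contr_inj, flat_expand, pairing3_inj).  The inverse metric comes from the
expansion form_expand' of a one-form along the braided dual basis
R^a e_i, R_a w^i. *)

Set Implicit Arguments.
Unset Strict Implicit.
Unset Printing Implicit Defensive.

Import GRing.Theory.
Local Open Scope ring_scope.

(** * Counit and Yang-Baxter identities for the R-matrix *)
Section RMatrix.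
Variables (k : comUnitRingType) (H : algType k) (T : triangularHopf H).
Local Notation D := (Delta T).
Local Notation S := (antip T).
Local Notation eps := (counit T).
Local Notation R := (Rbar T).
Variable V : lmodType k.

Lemma ksumZr (M N : lmodType k) (c : k) (f : M -> N -> V) (t : ktensor M N) :
  c *: ksum f t = ksum (fun m n => c *: f m n) t.
Proof. exact: scaler_sumr. Qed.

(** Applying the counit to the first leg of the hexagon identity shows that
R = R (1 (x) p) with p = eps(R^a) R_a; multiplying by R_21 on the left gives
p = 1. *)
Lemma Rbar_counitL (f : H -> V) : klinear f ->
  ksum (fun r1 r2 => (eps r1 : k) *: f r2) R = f 1.
Proof.
move=> lf; pose F a b := ksum (fun t1 t2 => (eps (t2 * a) : k) *: f (t1 * b)) R.
have e : ksum F R = ksum (fun r1 r2 =>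
    ksum (fun s1 s2 => (eps s1 : k) *: F r1 (r2 * s2)) R) R.
  rewrite -(sw_RD1 T (f := fun x y z => (eps x : k) *: F y z)); last 3 first.
  - by klin.
  - by rewrite /F; klin.
  - by rewrite /F; klin.
  by apply: eq_ksum => r1 r2; rewrite (sw_counitL T (f := F^~ r2)) // /F; klin.
have E (q : H -> V) : klinear q ->
    ksum (fun r1 r2 => ksum (fun t1 t2 =>
      (eps (t2 * r1) : k) *: q (t1 * r2)) R) R = q 1.
  move=> lq; rewrite ksum_exchange.
  rewrite (sw_Rbar21 T (f := fun a b => (eps b : k) *: q a)); try by klin.
  by rewrite counit1 scale1r.
rewrite -[RHS](E f) // [RHS]e.
transitivity (ksum (fun s1 s2 => (eps s1 : k) *: ksum (fun r1 r2 => F r1 (r2 * s2)) R) R).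
  apply: eq_ksum => s1 s2; congr (_ *: _).
  transitivity (f (1 * s2)); first by rewrite mul1r.
  rewrite -(E (fun h => f (h * s2))); last by klin.
  by apply: eq_ksum => r1 r2; apply: eq_ksum => t1 t2; rewrite mulrA.
rewrite ksum_exchange; apply: eq_ksum => s1 s2.
by rewrite ksumZr.
Qed.

Lemma Rbar_counitR (f : H -> V) : klinear f ->
  ksum (fun r1 r2 => (eps r2 : k) *: f r1) R = f 1.
Proof.
move=> lf; pose F a b := ksum (fun t1 t2 => (eps (b * t1) : k) *: f (a * t2)) R.
have e : ksum F R = ksum (fun r1 r2 =>
    ksum (fun s1 s2 => (eps r2 : k) *: F (r1 * s1) s2) R) R.
  rewrite -(sw_RD2 T (f := fun x y z => (eps y : k) *: F x z)); last 3 first.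
  - by rewrite /F; klin.
  - by klin.
  - by rewrite /F; klin.
  by apply: eq_ksum => r1 r2; rewrite (sw_counitL T (f := F r1)) // /F; klin.
have E (q : H -> V) : klinear q ->
    ksum (fun r1 r2 => ksum (fun t1 t2 =>
      (eps (r2 * t1) : k) *: q (r1 * t2)) R) R = q 1.
  move=> lq.
  rewrite (sw_Rbar21 T (f := fun a b => (eps b : k) *: q a)); try by klin.
  by rewrite counit1 scale1r.
rewrite -[RHS](E f) // [RHS]e; apply: eq_ksum => s1 s2.
rewrite -ksumZr; congr (_ *: _).
transitivity (f (s1 * 1)); first by rewrite mulr1.
rewrite -(E (fun h => f (s1 * h))); last by klin.
by apply: eq_ksum => r1 r2; apply: eq_ksum => t1 t2; rewrite mulrA.
Qed.

(** R intertwines Delta with its opposite, and (id (x) Delta) R = R_12 R_13;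
moving R_23 across Delta of the second leg exchanges the two sides. *)
Lemma Rbar_YB (f : H -> H -> H -> V) :
  (forall y z, klinear (fun x => f x y z)) ->
  (forall x z, klinear (fun y => f x y z)) ->
  (forall x y, klinear (f x y)) ->
  ksum (fun a1 a2 => ksum (fun b1 b2 => ksum (fun c1 c2 =>
    f (c1 * b1) (c2 * a1) (b2 * a2)) R) R) R =
  ksum (fun a1 a2 => ksum (fun b1 b2 => ksum (fun c1 c2 =>
    f (b1 * a1) (c1 * a2) (c2 * b2)) R) R) R.
Proof.
move=> l1 l2 l3.
transitivity (ksum (fun r1 r2 => ksum (fun x y => ksum (fun a1 a2 =>
    f r1 (x * a1) (y * a2)) R) (D r2)) R).
  rewrite (sw_RD2 T (f := fun r x y => ksum (fun a1 a2 =>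
    f r (x * a1) (y * a2)) R)); try by klin.
  rewrite ksum_exchange [RHS]ksum_exchange; apply: eq_ksum => b1 b2.
  by rewrite ksum_exchange.
transitivity (ksum (fun r1 r2 => ksum (fun x y => ksum (fun a1 a2 =>
    f r1 (a1 * y) (a2 * x)) R) (D r2)) R).
  apply: eq_ksum => r1 r2.
  by rewrite (sw_Rcop T (f := f r1)) //; rewrite ksum_exchange.
rewrite (sw_RD2 T (f := fun r x y => ksum (fun a1 a2 =>
    f r (a1 * y) (a2 * x)) R)); try by klin.
by rewrite ksum_exchange.
Qed.

End RMatrix.

(** * Actions on vector fields and one-forms *)
Section Actions.
Variables (k : comUnitRingType) (H : algType k) (T : triangularHopf H).
Variables (A : algType k) (X : bcModuleAlgebra T A).
Local Notation D := (Delta T).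
Local Notation S := (antip T).
Local Notation SV := (antipV T).
Local Notation eps := (counit T).
Local Notation R := (Rbar T).
Local Notation "h |> a" := (hopf_act X h a) (at level 38, right associativity).
Implicit Types (u v : vfield X) (a b c : A) (g h : H) (w th : oneform X).

Lemma ksumN (M N : lmodType k) (V : zmodType) (f : M -> N -> V) (t : ktensor M N) :
  ksum (fun m n => - f m n) t = - ksum f t.
Proof. exact: sumrN. Qed.

Lemma ksum_mull (M N : lmodType k) (f : M -> N -> A) (t : ktensor M N) a :
  ksum f t * a = ksum (fun m n => f m n * a) t.
Proof. exact: mulr_suml. Qed.

Lemma ksum_mulr (M N : lmodType k) (f : M -> N -> A) (t : ktensor M N) a :
  a * ksum f t = ksum (fun m n => a * f m n) t.
Proof. exact: mulr_sumr. Qed.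

Lemma ksum_act (M N : lmodType k) (f : M -> N -> A) (t : ktensor M N) h :
  h |> ksum f t = ksum (fun m n => h |> f m n) t.
Proof. exact: raddf_sum. Qed.

Lemma ksum_form (M N : lmodType k) (f : M -> N -> vfield X) (t : ktensor M N) w :
  w (ksum f t) = ksum (fun m n => w (f m n)) t.
Proof. exact: (map_ksum _ _ (formD w)). Qed.

Lemma ksum_vfun (M N : lmodType k) (f : M -> N -> A) (t : ktensor M N) u :
  u (ksum f t) = ksum (fun m n => u (f m n)) t.
Proof. exact: (map_ksum _ _ (klinD (vlin u))). Qed.

Lemma ksum_vact (M N : lmodType k) (f : M -> N -> vfield X) (t : ktensor M N) h :
  vact h (ksum f t) = ksum (fun m n => vact h (f m n)) t.
Proof. exact: (map_ksum _ _ (vactD h)). Qed.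

(** Vector fields carry a canonical A-module structure; scalars of k act
through their image in A. *)
Definition vlinear (V : lmodType k) (f : vfield X -> V) : Prop :=
  forall (c : k) u v, f (c%:A *: u + v) = c *: f u + f v.

Lemma vlinD (V : lmodType k) (f : vfield X -> V) :
  vlinear f -> {morph f : u v / u + v}.
Proof. by move=> lf u v; have := lf 1 u v; rewrite !scale1r. Qed.

Lemma vlin0 (V : lmodType k) (f : vfield X -> V) : vlinear f -> f 0 = 0.
Proof. by move=> /vlinD fD; apply: (addrI (f 0)); rewrite -fD !addr0. Qed.

Lemma vlinZ (V : lmodType k) (f : vfield X -> V) (c : k) u :
  vlinear f -> f (c%:A *: u) = c *: f u.
Proof. by move=> lf; have := lf c u 0; rewrite vlin0 // !addr0. Qed.

Lemma vlin_form w : vlinear w.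
Proof. by move=> c u v; rewrite formP -scalerAl mul1r. Qed.

Section Linearity.
Variables (M V : lmodType k).

Lemma klin_vlin (f : vfield X -> V) (p : M -> H) u :
  vlinear f -> klinear p -> klinear (fun m => f (vact (p m) u)).
Proof. by move=> lf lp c m m'; rewrite (vact_linp u c m m' lp) lf. Qed.

Lemma klin_vact (p : M -> H) u a : klinear p -> klinear (fun m => vact (p m) u a).
Proof. by move=> lp; apply: hend_linh2 => //; exact: vlin. Qed.

Lemma klin_vfun (p : M -> A) u : klinear p -> klinear (fun m => u (p m)).
Proof. by move=> lp; exact: (klin_comp (vlin u) lp). Qed.

Lemma klin_actl (p : M -> H) a : klinear p -> klinear (fun m => p m |> a).
Proof. exact: klin_comp (act_linear X a). Qed.

Lemma klin_actr (p : M -> A) h : klinear p -> klinear (fun m => h |> p m).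
Proof. exact: klin_morph. Qed.

Lemma klin_factH (p : M -> H) w u :
  klinear p -> klinear (fun m => factH (p m) w u).
Proof.
move=> lp; rewrite /= /factH_fun; apply: klin_ksumf; last exact: klin_morph.
- by move=> y; apply: klin_morph; apply: klin_form; exact: antipV_lin.
- by move=> x; exact: act_linear.
Qed.

End Linearity.
End Actions.

(** hlin proves k-linearity, in one element of H, of expressions built from the
actions of H; hextra is extended below whenever a new multilinear operation
becomes available. *)
Ltac hextra := fail.
Ltac hstep := first
  [ exact: klin_id
  | assumption
  | apply: klin_actl | apply: klin_actr
  | apply: klin_vact
  | apply: klin_factH
  | apply: klin_form
  | apply: klin_vfun
  | apply: klin_mull | apply: klin_mulr
  | apply: klin_scale | apply: klin_scaler
  | apply: klin_ksumf | apply: klin_sum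
  | apply: antipV_lin
  | match goal with l : forall _, klinear _ |- _ => exact: l end
  | match goal with l : forall _ _, klinear _ |- _ => exact: l end
  | match goal with l : klinear _ |- _ => apply: (klin_comp l) end
  | match goal with l : forall _, klinear _ |- _ => apply: (klin_comp (l _)) end
  | match goal with l : forall _ _, klinear _ |- _ =>
      apply: (klin_comp (l _ _)) end
  | apply: klin_morph
  | hextra ].
Ltac hlin := repeat (repeat match goal with |- forall _, _ => intro end;
  cbv beta; hstep).

Section ActionIdentities.
Variables (k : comUnitRingType) (H : algType k) (T : triangularHopf H).
Variables (A : algType k) (X : bcModuleAlgebra T A).
Local Notation D := (Delta T).
Local Notation S := (antip T).
Local Notation SV := (antipV T).
Local Notation eps := (counit T).
Local Notation R := (Rbar T).
Local Notation "h |> a" := (hopf_act X h a) (at level 38, right associativity).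
Implicit Types (u v : vfield X) (a b c : A) (g h : H) (w th : oneform X).

Lemma vactM g h u : vact (g * h) u = vact g (vact h u).
Proof. by apply: vfield_eq => a; apply: hendM; exact: vlin. Qed.

Lemma vact1 u : vact 1 u = u.
Proof. by apply: vfield_eq => a; apply: hend1; exact: vlin. Qed.

Lemma vactZ h b u :
  vact h (b *: u) = ksum (fun x y => (x |> b) *: vact y u) (D h).
Proof.
apply: vfield_eq => a; rewrite vfun_ksum; apply: hend_mull_comp; exact: vlin.
Qed.

Lemma vact_app h u a : h |> u a = ksum (fun x y => vact x u (y |> a)) (D h).
Proof. by apply: act_app; exact: vlin. Qed.

Lemma scalek (c : k) u a : (c%:A *: u) a = c *: u a.
Proof. by rewrite vfunZ -scalerAl mul1r. Qed.

Lemma vactZk h (c : k) u : vact h (c%:A *: u) = c%:A *: vact h u.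
Proof.
apply: vfield_eq => a; rewrite scalek /= /hend ksumZr.
by apply: eq_ksum => x y; rewrite -linearZ /= -scalerAl mul1r.
Qed.

Lemma vlin_vact h a : vlinear (fun u => vact h u a).
Proof. by move=> c u v; rewrite vactD vactZk vfunD scalek. Qed.

Lemma bracketE u v a :
  bracket u v a = u (v a) - ksum (fun r1 r2 => vact r1 v (vact r2 u a)) R.
Proof. by []. Qed.

Lemma vlin_bracketl v a : vlinear (fun u => bracket u v a).
Proof.
move=> c u u'; rewrite !bracketE vfunD scalek scalerBr addrACA; congr (_ + _).
rewrite ksumZr -opprD -ksum_split; congr (- _); apply: eq_ksum => r1 r2.
by rewrite vlin_vact vlin.
Qed.

Lemma vlin_bracketr u a : vlinear (fun v => bracket u v a).
Proof.
move=> c v v'; rewrite !bracketE vfunD scalek vlin scalerBr addrACA; congr (_ + _).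
rewrite ksumZr -opprD -ksum_split; congr (- _); apply: eq_ksum => r1 r2.
by rewrite vlin_vact.
Qed.

(** The braiding squares to the identity, so braiding the arguments exchanges
the two terms of the bracket. *)
Lemma bracket_anti u v :
  ksum (fun r1 r2 => bracket (vact r1 v) (vact r2 u)) R = - bracket u v.
Proof.
apply: vfield_eq => c; rewrite vfun_ksum -[RHS]/(- (bracket u v c)).
under eq_ksum => r1 r2 do rewrite bracketE.
rewrite ksum_split ksumN bracketE opprB; congr (_ - _).
rewrite ksum_exchange.
transitivity (ksum (fun s1 s2 => ksum (fun r1 r2 =>
   vact (s1 * r2) u (vact (s2 * r1) v c)) R) R).
  by apply: eq_ksum => s1 s2; apply: eq_ksum => r1 r2; rewrite !vactM.
rewrite (sw_Rbar21 T (f := fun p q => vact p u (vact q v c))); try by hlin.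
by rewrite !vact1.
Qed.

(** In the second term of the bracket, R^a acts on b v through Delta; the
identity (Delta (x) id) R = R_23 R_13 detaches the action on b. *)
Lemma bracketZ u b v : bracket u (b *: v) =
  u b *: v + ksum (fun r1 r2 => (r1 |> b) *: bracket (vact r2 u) v) R.
Proof.
apply: vfield_eq => c; rewrite vfunD vfunZ vfun_ksum bracketE vfunZ.
rewrite (vfieldP u).2 -addrA; congr (_ + _).
under [in RHS]eq_ksum => r1 r2 do rewrite vfunZ bracketE mulrBr.
rewrite ksum_split ksumN; congr (_ - _).
transitivity (ksum (fun r1 r2 => ksum (fun x y =>
   (x |> b) * vact y v (vact r2 u c)) (D r1)) R).
  by apply: eq_ksum => r1 r2; rewrite vactZ vfun_ksum.
rewrite (sw_RD1 T (f := fun x y z => (x |> b) * vact y v (vact z u c)));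
  try by hlin.
rewrite ksum_exchange; apply: eq_ksum => s1 s2; rewrite ksum_mulr.
by apply: eq_ksum => r1 r2; rewrite vactM.
Qed.

(** Delta(h) R = R Delta^op(h) carries h through the braided term. *)
Lemma vact_bracket h u v :
  vact h (bracket u v) = ksum (fun x y => bracket (vact x u) (vact y v)) (D h).
Proof.
apply: vfield_eq => c; rewrite vfun_ksum.
under [in RHS]eq_ksum => x y do rewrite bracketE.
rewrite ksum_split ksumN -[LHS]/(hend X h (bracket_fun X u v) c).
rewrite hend_sub hend_comp; try exact: vlin.
congr (_ - _); rewrite hend_ksum.
transitivity (ksum (fun x y => ksum (fun r1 r2 =>
    vact (x * r1) v (vact (y * r2) u c)) R) (D h)).
  rewrite [RHS]ksum_exchange; apply: eq_ksum => r1 r2.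
  rewrite (hend_comp X h _ (vlin (vact r1 v)) (vlin (vact r2 u))).
  by apply: eq_ksum => x y; rewrite !vactM.
rewrite (sw_Rcop T (f := fun x y => vact x v (vact y u c))); try by hlin.
rewrite [RHS]ksum_exchange; by apply: eq_ksum => r1 r2; apply: eq_ksum => x y; rewrite !vactM.
Qed.

Lemma vactrD u a b : vactr u (a + b) = vactr u a + vactr u b.
Proof. by rewrite -ksum_split; apply: eq_ksum => r1 r2; rewrite linearD scalerDl. Qed.

Lemma vactr0 u : vactr u 0 = 0.
Proof. by apply: (addrI (vactr u 0)); rewrite -vactrD !addr0. Qed.

Lemma vactrk u (c : k) : vactr u c%:A = c%:A *: u.
Proof.
apply: vfield_eq => a; rewrite vfun_ksum scalek.
rewrite -[in RHS](vact1 u) -(Rbar_counitL T (f := fun h => vact h u a)); last by hlin.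
rewrite ksumZr; apply: eq_ksum => r1 r2.
by rewrite vfunZ linearZ /= act_one -!scalerAl mul1r.
Qed.

Lemma vactr1 u : vactr u 1 = u.
Proof. by rewrite -(scale1r 1) vactrk !scale1r. Qed.

Lemma vfieldM u a b : u (a * b) = u a * b + vactr u a b.
Proof. by rewrite (vfieldP u).2 vfun_ksum. Qed.

Lemma form_vactr w u a : w (vactr u a) = ksum (fun r1 r2 => (r1 |> a) * w (vact r2 u)) R.
Proof. by rewrite ksum_form; apply: eq_ksum => r1 r2; rewrite formZ. Qed.

(** Braided commutativity of A is what makes the braided right action
associative. *)
Lemma vactrM u a b : vactr u (a * b) = vactr (vactr u a) b.
Proof.
apply: vfield_eq => c; rewrite !vfun_ksum.
transitivity (ksum (fun r1 r2 => ksum (fun x y =>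
   ((x |> a) * (y |> b)) * vact r2 u c) (D r1)) R).
  by apply: eq_ksum => r1 r2; rewrite vfunZ act_mul ksum_mull.
rewrite (sw_RD1 T (f := fun x y z => ((x |> a) * (y |> b)) * vact z u c));
  try by hlin.
symmetry; transitivity (ksum (fun s1 s2 => ksum (fun r1 r2 => ksum (fun x y =>
   (r1 |> b) * ((x |> s1 |> a) * vact y (vact s2 u) c)) (D r2)) R) R).
  rewrite ksum_exchange; apply: eq_ksum => r1 r2.
  rewrite vfunZ ksum_vact vfun_ksum ksum_mulr; apply: eq_ksum => s1 s2.
  by rewrite vactZ vfun_ksum ksum_mulr; apply: eq_ksum => x y.
rewrite ksum_exchange [RHS]ksum_exchange.
rewrite ksum_exchange; apply: eq_ksum => s1 s2.
rewrite (sw_RD2 T (f := fun r x y =>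
  (r |> b) * ((x |> s1 |> a) * vact y (vact s2 u) c))); try by hlin.
rewrite ksum_exchange; apply: eq_ksum => t1 t2.
rewrite (bcomm X (s1 |> a) (t1 |> b)) ksum_mull.
by apply: eq_ksum => r1 r2; rewrite actM mulrA vactM.
Qed.

Lemma antipVM g h : SV (g * h) = SV h * SV g.
Proof. by apply: (can_inj (antipK T)); rewrite antipM !(antipVK T). Qed.

Lemma antipV1 : SV 1 = 1.
Proof. by rewrite -{1}(antip1 T) (antipK T). Qed.

Lemma factHM g h w : factH (g * h) w = factH g (factH h w).
Proof.
apply: form_eq => u; rewrite /= /factH_fun.
rewrite (sw_DM T (f := fun x y => y |> w (vact (SV x) u))); last 2 first.
- by hlin.
- by hlin.
apply: eq_ksum => x y; rewrite ksum_act; apply: eq_ksum => x' y'.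
by rewrite actM antipVM vactM.
Qed.

Lemma factH1 w : factH 1 w = w.
Proof.
apply: form_eq => u; rewrite /= /factH_fun.
rewrite (sw_D1 T (f := fun x y => y |> w (vact (SV x) u))); last 2 first.
- by hlin.
- by hlin.
by rewrite act1 antipV1 vact1.
Qed.

(** The use of the inverse antipode in the action on one-forms is exactly what
makes evaluation H-equivariant. *)
Lemma form_act h w u :
  h |> w u = ksum (fun x y => factH y w (vact x u)) (D h).
Proof.
symmetry; transitivity (ksum (fun x y => ksum (fun y1 y2 =>
    y2 |> w (vact (SV y1 * x) u)) (D y)) (D h)).
  apply: eq_ksum => x y; apply: eq_ksum => y1 y2.
  by rewrite vactM.
rewrite -(sw_coassoc T (f := fun x y1 y2 => y2 |> w (vact (SV y1 * x) u)));
  try by hlin.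
transitivity (ksum (fun x y => (eps x : k) *: (y |> w u)) (D h)).
  apply: eq_ksum => x y.
  rewrite (sw_antipV2 T (f := fun g => y |> w (vact g u)) x).
    by rewrite vact1.
  by hlin.
by rewrite (sw_counitL T (f := fun g => g |> w u)) //; hlin.
Qed.

End ActionIdentities.

(** * Exactness of the pairings over A *)
Section TensorOverA.
Variables (k : comUnitRingType) (H : algType k) (T : triangularHopf H).
Variables (A : algType k) (X : bcModuleAlgebra T A).
Local Notation D := (Delta T).
Local Notation R := (Rbar T).
Local Notation "h |> a" := (hopf_act X h a) (at level 38, right associativity).
Local Notation VX := (Xfields X).
Local Notation OX := (Omega X).
Implicit Types (u v : vfield X) (a b c : A) (g h : H) (w th : oneform X).

Lemma atens_balanced (M N : hbimod H A) :
  balanced (@ract H A M) (@lact H A N) (@atens k H A M N).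
Proof. exact: tens_balanced. Qed.

Lemma atensDl (M N : hbimod H A) (m m' : M) (n : N) :
  atens (m + m') n = atens m n + atens m' n.
Proof. exact: (balDl (atens_balanced M N)). Qed.

Lemma atensDr (M N : hbimod H A) (m : M) (n n' : N) :
  atens m (n + n') = atens m n + atens m n'.
Proof. exact: (balDr (atens_balanced M N)). Qed.

Lemma atens0r (M N : hbimod H A) (m : M) : atens m (0 : N) = 0.
Proof. by apply: (addrI (atens m (0 : N))); rewrite -atensDr !addr0. Qed.

Lemma atens_suml (M N : hbimod H A) (I : finType) (m : I -> M) (n : N) :
  atens (\sum_i m i) n = \sum_i atens (m i) n.
Proof.
apply: (big_morph (fun m => atens m n)) => [x y|]; first exact: atensDl.
by apply: (addrI (atens 0 n)); rewrite -atensDl !addr0.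
Qed.

Lemma atens_sumr (M N : hbimod H A) (I : finType) (m : M) (n : I -> N) :
  atens m (\sum_i n i) = \sum_i atens m (n i).
Proof.
apply: (big_morph (atens m)) => [x y|]; first exact: atensDr.
exact: atens0r.
Qed.

Lemma factlA a b w : factl (a * b) w = factl a (factl b w).
Proof. by apply: form_eq => u /=; rewrite vactrM. Qed.

Lemma factlDl a b w : factl (a + b) w = factl a w + factl b w.
Proof. by apply: form_eq => u /=; rewrite vactrD formD. Qed.

Lemma factlDr a w th : factl a (w + th) = factl a w + factl a th.
Proof. exact: form_eq. Qed.

Lemma form_sumE (I : Type) (s : seq I) (F : I -> oneform X) u :
  (\sum_(i <- s) F i) u = \sum_(i <- s) F i u.
Proof. exact: (big_morph (fun w : oneform X => w u)). Qed.

Lemma form_sum (I : Type) (s : seq I) (F : I -> vfield X) w :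
  w (\sum_(i <- s) F i) = \sum_(i <- s) w (F i).
Proof. by apply: big_morph; [exact: formD|exact: form0]. Qed.

Definition contr u (t : atensor T OX VX) : vfield X :=
  tsum (fun (th : OX) (v : VX) => (th : oneform X) u *: (v : vfield X)) t.

Lemma contr_balanced u : balanced (@ract H A OX) (@lact H A VX)
  (fun (th : OX) (v : VX) => (th : oneform X) u *: (v : vfield X)).
Proof.
split=> [th th' v|th v v'|th a v]; [exact: scalerDl|exact: scalerDr|].
by rewrite /= scalerA.
Qed.

Lemma contr_tens u th v : contr u (atens (th : OX) (v : VX)) = th u *: v.
Proof. exact: (tsum_tens (contr_balanced u)). Qed.

Lemma contrD u t t' : contr u (t + t') = contr u t + contr u t'.
Proof. exact: (tsumD (contr_balanced u)). Qed.

Lemma contr0 u : contr u 0 = 0.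
Proof. exact: (tsum0 (contr_balanced u)). Qed.

Lemma contr_sum (I : finType) u (t : I -> atensor T OX VX) :
  contr u (\sum_i t i) = \sum_i contr u (t i).
Proof.
apply: (big_morph (contr u)) => [x y|]; first exact: contrD.
exact: contr0.
Qed.

Lemma contr_lin a u v t : contr (a *: u + v) t = a *: contr u t + contr v t.
Proof.
rewrite /contr /tsum scaler_sumr -big_split; apply: eq_bigr => p _ /=.
by rewrite formP scalerDl scalerA.
Qed.

Lemma flat_balanced v : balanced (@ract H A OX) (@lact H A OX)
  (fun w1 w2 : OX => lact ((w1 : oneform X) v) w2).
Proof.
split=> [w1 w1' w2|w1 w2 w2'|w1 a w2] /=; [exact: factlDl|exact: factlDr|].
exact: factlA.
Qed.

Lemma flat_tens v (w1 w2 : oneform X) :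
  flat (atens (w1 : OX) (w2 : OX)) v = factl (w1 v) w2.
Proof. exact: (tsum_tens (flat_balanced v)). Qed.

Lemma flatD v t t' : flat (t + t') v = flat t v + flat t' v.
Proof. exact: (tsumD (flat_balanced v)). Qed.

Lemma flat0 v : @flat k H T A X 0 v = 0.
Proof. exact: (tsum0 (flat_balanced v)). Qed.

Lemma flat_lin t a u v :
  flat t (a *: u + v : vfield X) = factl a (flat t u) + flat t v.
Proof.
elim/tensor_ind: t => [|w1 w2|t t' IH IH'].
- by rewrite !flat0 addr0; apply: form_eq => x /=.
- by rewrite [tens _ _]/(atens _ _) !flat_tens formP factlDl factlA.
- by rewrite !flatD IH IH' factlDr addrACA.
Qed.

Lemma pairing2_tens u v (w1 w2 : oneform X) :
  pairing2 u v (atens (w1 : OX) (w2 : OX)) = w2 (vactr u (w1 v)).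
Proof. by rewrite /pairing2 flat_tens. Qed.

Lemma pairing2_tensR u v (w1 w2 : oneform X) :
  pairing2 u v (atens (w1 : OX) (w2 : OX)) =
  ksum (fun r1 r2 => (r1 |> w1 v) * w2 (vact r2 u)) R.
Proof. by rewrite pairing2_tens form_vactr. Qed.

Lemma pairing2D u v (t t' : atensor T OX OX) :
  pairing2 u v (t + t') = pairing2 u v t + pairing2 u v t'.
Proof. by rewrite /pairing2 flatD. Qed.

Lemma pairing20 u v : pairing2 u v (0 : atensor T OX OX) = 0.
Proof. by rewrite /pairing2 flat0. Qed.

Lemma pairing2Zl u v t a : pairing2 (a *: u : vfield X) v t = a * pairing2 u v t.
Proof. exact: formZ. Qed.

Lemma flatZ t a v : flat t (a *: v : vfield X) = factl a (flat t v).
Proof.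
rewrite -[a *: v]addr0 flat_lin (_ : flat t 0 = 0) ?addr0 //.
have := flat_lin t 1 0 0; rewrite scale1r addr0 => e.
apply: (addrI (flat t 0)); rewrite {1}[X in X + _](_ : _ = factl 1 (flat t 0)).
  by rewrite -e addr0.
by apply: form_eq => u /=; rewrite vactr1.
Qed.

Lemma pairing2Zr u v t a :
  pairing2 u (a *: v : vfield X) t = pairing2 (vactr u a) v t.
Proof. by rewrite /pairing2 flatZ. Qed.

Lemma pairing2ZrR u v t a : pairing2 u (a *: v : vfield X) t =
  ksum (fun r1 r2 => (r1 |> a) * pairing2 (vact r2 u) v t) R.
Proof. by rewrite pairing2Zr /pairing2 form_vactr. Qed.

Lemma pairing2Dl u u' v t : pairing2 (u + u') v t = pairing2 u v t + pairing2 u' v t.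
Proof. exact: formD. Qed.

Lemma pairing2Dr u v v' t : pairing2 u (v + v') t = pairing2 u v t + pairing2 u v' t.
Proof.
rewrite -{1}[v]scale1r /pairing2 flat_lin; congr (_ + _).
by rewrite /= vactr1.
Qed.

Lemma vlin_pairing2l v t : vlinear (fun u => pairing2 u v t).
Proof. exact: vlin_form. Qed.

Lemma vlin_pairing2r u t : vlinear (fun v => pairing2 u v t).
Proof.
move=> c v v'; rewrite pairing2Dr pairing2Zr vactrk pairing2Zl.
by rewrite -scalerAl mul1r.
Qed.

Lemma pairing2_sum (I : Type) (s : seq I) u v (t : I -> atensor T OX OX) :
  pairing2 u v (\sum_(i <- s) t i) = \sum_(i <- s) pairing2 u v (t i).
Proof.
by apply: (big_morph (pairing2 u v)) => [x y|]; [exact: pairing2D|exact: pairing20].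
Qed.

(** <u (x) v (x) z, t>, where the leg of t closest to the vector fields is
evaluated on z first. *)
Definition pairing3 u v z (t : atensor T (atensor T OX OX) OX) : A :=
  tsum (fun (s : atensor T OX OX) (w : OX) =>
    (w : oneform X) (vactr u (pairing2 v z s))) t.

Lemma atens_ract_balanced a : balanced (@ract H A OX) (@lact H A OX)
  (fun m n : OX => atens m (ract n a)).
Proof.
split=> [m m' n|m n n'|m b n].
- exact: atensDl.
- by rewrite -atensDr; congr atens; apply: form_eq => x; exact: mulrDl.
- rewrite (balS (atens_balanced OX OX)); congr atens.
  exact: form_eq.
Qed.

Lemma ract_tens (w1 w2 : oneform X) a :
  ract (atens (w1 : OX) (w2 : OX) : atensor T OX OX) a =
  atens (w1 : OX) (fractr w2 a : OX).
Proof. exact: (tsum_tens (atens_ract_balanced a)). Qed.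

Lemma pairing2_ract u v (t : atensor T OX OX) a :
  pairing2 u v (ract t a) = pairing2 u v t * a.
Proof.
elim/tensor_ind: t => [|w1 w2|t t' IH IH'].
- by rewrite [ract _ _](tsum0 (atens_ract_balanced a)) pairing20 mul0r.
- by rewrite -[tens w1 w2]/(atens w1 w2) ract_tens !pairing2_tens.
- by rewrite [ract _ _](tsumD (atens_ract_balanced a)) !pairing2D IH IH' mulrDl.
Qed.

Lemma pairing3_balanced u v z :
  balanced (@ract H A (atensor T OX OX)) (@lact H A OX)
  (fun (s : atensor T OX OX) (w : OX) =>
    (w : oneform X) (vactr u (pairing2 v z s))).
Proof.
split=> [s s' w|s w w'|s a w] //.
- by rewrite pairing2D vactrD formD.
- by rewrite pairing2_ract /= vactrM.
Qed.

Lemma pairing3_tens u v z (s : atensor T OX OX) (w : oneform X) :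
  pairing3 u v z (atens s (w : OX)) = w (vactr u (pairing2 v z s)).
Proof. exact: (tsum_tens (pairing3_balanced u v z)). Qed.

Lemma pairing3D u v z t t' :
  pairing3 u v z (t + t') = pairing3 u v z t + pairing3 u v z t'.
Proof. exact: (tsumD (pairing3_balanced u v z)). Qed.

Lemma pairing30 u v z : pairing3 u v z 0 = 0.
Proof. exact: (tsum0 (pairing3_balanced u v z)). Qed.

Section DualBasis.
Variables (n : nat) (e : 'I_n -> vfield X) (w : 'I_n -> oneform X).
Hypothesis ew : dual_basis e w.

(** A dual basis is a left basis for vector fields and, for the right module
structure, a basis of one-forms; the tensor expansions below follow by moving
the coefficient across the tensor sign. *)
Lemma form_expand th : th = \sum_i fractr (w i) (th (e i)).
Proof.
apply: form_eq => u; rewrite form_sumE {1}[u]ew form_sum.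
by apply: eq_bigr => i _; rewrite formZ.
Qed.

Lemma contr_expand (t : atensor T OX VX) :
  t = \sum_i atens (w i : OX) (contr (e i) t : VX).
Proof.
elim/tensor_ind: t => [|th v|t t' IH IH'].
- rewrite big1 // => i _; rewrite contr0.
  by rewrite atens0r.
- rewrite -[tens th v]/(atens th v) {1}[th]form_expand atens_suml.
  apply: eq_bigr => i _; rewrite contr_tens.
  exact: (balS (atens_balanced OX VX)).
- rewrite {1}IH {1}IH' -big_split; apply: eq_bigr => i _ /=.
  by rewrite contrD atensDr.
Qed.

Lemma contr_inj (t t' : atensor T OX VX) :
  (forall u, contr u t = contr u t') -> t = t'.
Proof.
move=> h; rewrite [t]contr_expand [t']contr_expand.
by apply: eq_bigr => i _; rewrite h.
Qed.

Lemma flat_expand (t : atensor T OX OX) :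
  t = \sum_i atens (w i : OX) (flat t (e i) : OX).
Proof.
elim/tensor_ind: t => [|th v|t t' IH IH'].
- rewrite big1 // => i _; rewrite flat0.
  by rewrite atens0r.
- rewrite -[tens th v]/(atens th v) {1}[th]form_expand atens_suml.
  apply: eq_bigr => i _; rewrite flat_tens.
  exact: (balS (atens_balanced OX OX)).
- rewrite {1}IH {1}IH' -big_split; apply: eq_bigr => i _ /=.
  by rewrite flatD atensDr.
Qed.

Lemma pairing2_expand (t : atensor T OX OX) :
  t = \sum_i \sum_j atens (w i : OX) (fractr (w j) (pairing2 (e j) (e i) t) : OX).
Proof.
rewrite {1}[t]flat_expand; apply: eq_bigr => i _.
by rewrite -atens_sumr -form_expand.
Qed.

Lemma form3P v z (t : atensor T (atensor T OX OX) OX) a u u' :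
  pairing3 (a *: u + u') v z t = a * pairing3 u v z t + pairing3 u' v z t.
Proof.
rewrite /pairing3 /tsum mulr_sumr -big_split; apply: eq_bigr => p _ /=.
by rewrite vactr_lin formP.
Qed.

Lemma pairing3_expand (t : atensor T (atensor T OX OX) OX) :
  t = \sum_i \sum_j atens (atens (w i : OX) (w j : OX) : atensor T OX OX)
                            (OneForm (form3P (e j) (e i) t) : OX).
Proof.
have f3D v z t1 t2 : OneForm (form3P v z (t1 + t2)) =
    OneForm (form3P v z t1) + OneForm (form3P v z t2).
  by apply: form_eq => u /=; rewrite pairing3D.
elim/tensor_ind: t => [|s th|t t' IH IH'].
- rewrite big1 // => i _; rewrite big1 // => j _.
  rewrite (_ : OneForm _ = 0); last by apply: form_eq => u /=; rewrite pairing30.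
  exact: atens0r.
- rewrite -[tens s th]/(atens s th) {1}[s]pairing2_expand atens_suml.
  apply: eq_bigr => i _; rewrite atens_suml; apply: eq_bigr => j _.
  rewrite (_ : OneForm _ = factl (pairing2 (e j) (e i) s) th); last first.
    by apply: form_eq => u /=; rewrite pairing3_tens.
  rewrite -(balS (atens_balanced _ OX)); congr (atens _ th).
  by rewrite ract_tens.
- rewrite {1}IH {1}IH' -big_split; apply: eq_bigr => i _ /=.
  rewrite -big_split; apply: eq_bigr => j _ /=.
  by rewrite f3D atensDr.
Qed.

Lemma pairing3_inj (t t' : atensor T (atensor T OX OX) OX) :
  (forall u v z, pairing3 u v z t = pairing3 u v z t') -> t = t'.
Proof.
move=> h; rewrite [t]pairing3_expand [t']pairing3_expand.
apply: eq_bigr => i _; apply: eq_bigr => j _.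
by congr atens; apply: form_eq => u; exact: h.
Qed.

End DualBasis.
End TensorOverA.

(** * Equivariance and symmetry of the pairing *)
Section PairingLinear.
Variables (k : comUnitRingType) (H : algType k) (T : triangularHopf H).
Variables (A : algType k) (X : bcModuleAlgebra T A) (M : lmodType k).
Implicit Types (u v : vfield X).

Lemma klin_pairing2l (p : M -> H) u v t :
  klinear p -> klinear (fun m => pairing2 (vact (p m) u) v t).
Proof. exact: klin_vlin (vlin_pairing2l v t). Qed.

Lemma klin_pairing2r (p : M -> H) u v t :
  klinear p -> klinear (fun m => pairing2 u (vact (p m) v) t).
Proof. exact: klin_vlin (vlin_pairing2r u t). Qed.

End PairingLinear.

Ltac hextra ::= first
  [ apply: klin_pairing2l | apply: klin_pairing2r
  | match goal with l : forall _ _, vlinear _ |- _ =>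
      apply: (klin_vlin _ (l _ _)) end ].

Section Pairing.
Variables (k : comUnitRingType) (H : algType k) (T : triangularHopf H).
Variables (A : algType k) (X : bcModuleAlgebra T A).
Local Notation D := (Delta T).
Local Notation S := (antip T).
Local Notation SV := (antipV T).
Local Notation eps := (counit T).
Local Notation R := (Rbar T).
Local Notation "h |> a" := (hopf_act X h a) (at level 38, right associativity).
Local Notation VX := (Xfields X).
Local Notation OX := (Omega X).
Implicit Types (u v : vfield X) (g h : H) (w th eta : oneform X).

Lemma ksum_formE (M N : lmodType k) (f : M -> N -> oneform X) (t : ktensor M N) u :
  (ksum f t) u = ksum (fun m n => f m n u) t.
Proof. exact: form_sumE. Qed.

Lemma pairing2_ksum (M N : lmodType k) (f : M -> N -> atensor T OX OX)
    (t : ktensor M N) u v :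
  pairing2 u v (ksum f t) = ksum (fun m n => pairing2 u v (f m n)) t.
Proof. exact: pairing2_sum. Qed.

Lemma pairing2_tsum u v (t : atensor T OX OX) :
  pairing2 u v t =
  tsum (fun w1 w2 : OX => pairing2 u v (atens w1 w2 : atensor T OX OX)) t.
Proof.
rewrite /pairing2 /flat /tsum form_sumE; apply: eq_bigr => p _.
by rewrite -[RHS]/(pairing2 u v (atens p.1 p.2)) pairing2_tens.
Qed.

Lemma vact_vactr h u a :
  vact h (vactr u a) = ksum (fun x y => vactr (vact x u) (y |> a)) (D h).
Proof.
apply: vfield_eq => c; rewrite vfun_ksum ksum_vact vfun_ksum.
transitivity (ksum (fun x y => ksum (fun r1 r2 =>
   ((x * r1) |> a) * vact (y * r2) u c) R) (D h)).
  rewrite ksum_exchange; apply: eq_ksum => r1 r2; rewrite vactZ vfun_ksum.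
  by apply: eq_ksum => x y; rewrite vfunZ actM vactM.
rewrite (sw_Rcop T (f := fun x y => (x |> a) * vact y u c)); try by hlin.
rewrite ksum_exchange; apply: eq_ksum => x y; rewrite vfun_ksum.
by apply: eq_ksum => r1 r2; rewrite vfunZ actM vactM.
Qed.

(** Braiding the two one-forms is dual to braiding the two vector fields.  On a
decomposable tensor both sides are products of two elements of A; braided
commutativity puts the factors in the same order, and the hexagon identities
bring both sides to <R^q v, R^r R^s eta> <R_r R_q u, R_s theta>. *)
Lemma pairing2_braid u v (t : atensor T OX OX) :
  pairing2 u v (braid t) =
  ksum (fun r1 r2 => pairing2 (vact r1 v) (vact r2 u) t) R.
Proof.
under eq_ksum => r1 r2 do rewrite pairing2_tsum.
rewrite [RHS]exchange_big /braid [X in pairing2 _ _ X]/tsum pairing2_sum.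
apply: eq_bigr => -[th eta] _ /=; rewrite pairing2_ksum.
rewrite -[RHS]/(ksum (fun r1 r2 => pairing2 (vact r1 v) (vact r2 u)
  (atens (th : OX) (eta : OX) : atensor T OX OX)) R).
transitivity (ksum (fun s1 s2 => ksum (fun r1 r2 => ksum (fun q1 q2 =>
    factH (r1 * s1) eta (vact q1 v) * factH s2 th (vact (r2 * q2) u)) R) R) R).
  apply: eq_ksum => s1 s2; rewrite pairing2_tensR.
  transitivity (ksum (fun r1 r2 => ksum (fun x y =>
     factH (y * s1) eta (vact x v) * factH s2 th (vact r2 u)) (D r1)) R).
    apply: eq_ksum => r1 r2; rewrite form_act ksum_mull.
    by apply: eq_ksum => x y; rewrite factHM.
  by rewrite (sw_RD1 T (f := fun x y r =>
     factH (y * s1) eta (vact x v) * factH s2 th (vact r u))) //; hlin.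
symmetry; transitivity (ksum (fun r1 r2 => ksum (fun q1 q2 =>
   factH q1 eta (vact r1 v) * (q2 |> th (vact r2 u))) R) R).
  apply: eq_ksum => r1 r2; rewrite pairing2_tensR.
  transitivity (ksum (fun p1 p2 => ksum (fun q1 q2 => ksum (fun t1 t2 =>
     factH q1 eta (vact (t1 * p2) (vact r1 v)) *
        ((q2 * (t2 * p1)) |> th (vact r2 u))) R) R) R).
    apply: eq_ksum => p1 p2; rewrite (bcomm X).
    transitivity (ksum (fun q1 q2 => ksum (fun x y =>
       factH y eta (vact (x * p2) (vact r1 v)) *
          ((q2 * p1) |> th (vact r2 u))) (D q1)) R).
      apply: eq_ksum => q1 q2; rewrite form_act ksum_mull.
      by apply: eq_ksum => x y; rewrite actM vactM.
    rewrite (sw_RD1 T (f := fun x y r =>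
       factH y eta (vact (x * p2) (vact r1 v)) * ((r * p1) |> th (vact r2 u))));
      try by hlin.
    by apply: eq_ksum => q1 q2; apply: eq_ksum => t1 t2; rewrite mulrA.
  rewrite ksum_exchange; apply: eq_ksum => q1 q2; rewrite ksum_exchange.
  rewrite (sw_Rbar21 T (f := fun p q =>
     factH q1 eta (vact p (vact r1 v)) * ((q2 * q) |> th (vact r2 u))));
    try by hlin.
  by rewrite mulr1 vact1.
rewrite ksum_exchange [RHS]ksum_exchange.
transitivity (ksum (fun m n => ksum (fun q1 q2 => ksum (fun s1 s2 =>
    factH (m * s1) eta (vact q1 v) * factH s2 th (vact (n * q2) u)) R) R) R);
  last first.
  by apply: eq_ksum => r1 r2; rewrite ksum_exchange.
rewrite ksum_exchange [RHS]ksum_exchange; apply: eq_ksum => q1 q2.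
transitivity (ksum (fun r1 r2 => ksum (fun x y =>
    factH r1 eta (vact q1 v) * factH y th (vact (x * q2) u)) (D r2)) R).
  apply: eq_ksum => r1 r2; rewrite form_act ksum_mulr.
  by apply: eq_ksum => x y; rewrite vactM.
by rewrite (sw_RD2 T (f := fun r x y =>
  factH r eta (vact q1 v) * factH y th (vact (x * q2) u))) //; hlin.
Qed.

Lemma pairing2_hactE u v h (t : atensor T OX OX) :
  pairing2 u v (hact h t) =
  tsum (fun w1 w2 : OX => ksum (fun x y =>
    pairing2 u v (atens (factH x w1 : OX) (factH y w2 : OX) : atensor T OX OX))
    (D h)) t.
Proof.
rewrite [hact h t]/= [X in pairing2 _ _ X]/tsum pairing2_sum.
by apply: eq_bigr => p _; rewrite pairing2_ksum.
Qed.

Lemma klin_pairing2_tens1 (M : lmodType k) (p : M -> H) u v th eta : klinear p ->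
  klinear (fun m => pairing2 u v
    (atens (factH (p m) th : OX) (eta : OX) : atensor T OX OX)).
Proof.
move=> lp c x y; rewrite !pairing2_tensR ksumZr -ksum_split.
apply: eq_ksum => r1 r2; apply: (_ : klinear (fun m =>
  (r1 |> factH (p m) th v) * eta (vact r2 u))).
by hlin.
Qed.

Lemma klin_pairing2_tens2 (M : lmodType k) (p : M -> H) u v th eta : klinear p ->
  klinear (fun m => pairing2 u v
    (atens (th : OX) (factH (p m) eta : OX) : atensor T OX OX)).
Proof.
move=> lp c x y; rewrite !pairing2_tensR ksumZr -ksum_split.
apply: eq_ksum => r1 r2; apply: (_ : klinear (fun m =>
  (r1 |> th v) * factH (p m) eta (vact r2 u))).
by hlin.
Qed.

Lemma klin_pairing2_hact (M : lmodType k) (p : M -> H) u v (t : atensor T OX OX) :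
  klinear p -> klinear (fun m => pairing2 u v (hact (p m) t)).
Proof.
move=> lp; apply: (klin_comp (_ : klinear (fun h => pairing2 u v (hact h t))) lp).
move=> c x y; rewrite !pairing2_hactE /tsum scaler_sumr -big_split.
apply: eq_bigr => -[th eta] _ /=; apply: (_ : klinear (fun h => ksum (fun x y =>
    pairing2 u v (atens (factH x th : OX) (factH y eta : OX) : atensor T OX OX))
    (D h))).
apply: klin_ksumf; last exact: klin_morph.
- by move=> h; apply: (@klin_pairing2_tens1 _ (fun h => h)).
- by move=> h; apply: (@klin_pairing2_tens2 _ (fun h => h)).
Qed.

(** The value on a decomposable tensor contains an R-matrix, through the right
action on u; Delta(h) R = R Delta^op(h) moves h across it, and equivariance of
evaluation does the rest. *)
Lemma pairing2_act h u v (t : atensor T OX OX) :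
  h |> pairing2 u v t = ksum (fun x y => ksum (fun y1 y2 =>
    pairing2 (vact x u) (vact y1 v) (hact y2 t)) (D y)) (D h).
Proof.
have E x y : ksum (fun y1 y2 => pairing2 (vact x u) (vact y1 v) (hact y2 t)) (D y) =
  tsum (fun th eta : OX => ksum (fun y1 y2 => ksum (fun p q =>
    pairing2 (vact x u) (vact y1 v) (atens (factH p th : OX) (factH q eta : OX)
      : atensor T OX OX)) (D y2)) (D y)) t.
  by rewrite /ksum /tsum exchange_big; apply: eq_bigr => p _; rewrite pairing2_hactE.
transitivity (tsum (fun th eta : OX => ksum (fun x y => ksum (fun y1 y2 =>
  ksum (fun p q => pairing2 (vact x u) (vact y1 v)
    (atens (factH p th : OX) (factH q eta : OX) : atensor T OX OX)) (D y2)) (D y))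
    (D h)) t); last first.
  rewrite {1}/tsum exchange_big; apply: eq_bigr => p _.
  exact: esym (E _ _).
rewrite pairing2_tsum [LHS]raddf_sum; apply: eq_bigr => -[th eta] _ /=.
pose f (a b c d : H) := ksum (fun r1 r2 =>
  (r1 |> factH c th (vact b v)) * factH d eta (vact (r2 * a) u)) R.
have l1 b c d : klinear (fun a => f a b c d) by rewrite /f; hlin.
have l2 a c d : klinear (fun b => f a b c d) by rewrite /f; hlin.
have l3 a b d : klinear (fun c => f a b c d) by rewrite /f; hlin.
have l4 a b c : klinear (f a b c) by rewrite /f; hlin.
transitivity (ksum (fun x y => ksum (fun x1 x2 => ksum (fun b c => f x1 b c y)
    (D x2)) (D x)) (D h)); last first.
  rewrite (sw_coassoc T (f := fun x1 x2 y => ksum (fun b c => f x1 b c y) (D x2)));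
    last 3 first.
  - by move=> y g; apply: klin_sum.
  - move=> x g; apply: klin_ksumf; [by []|by []|exact: klin_morph].
  - by move=> x g; apply: klin_sum.
  apply: eq_ksum => x q; rewrite (sw_coassoc T (f := f x)) //.
  apply: eq_ksum => y1 y2; apply: eq_ksum => p s.
  by rewrite pairing2_tensR; apply: eq_ksum => r1 r2; rewrite vactM.
transitivity (ksum (fun x y => ksum (fun x1 x2 => ksum (fun r1 r2 =>
    ((x1 * r1) |> th v) * factH y eta (vact (x2 * r2) u)) R) (D x)) (D h)).
  rewrite pairing2_tensR ksum_act.
  rewrite (sw_coassoc T (f := fun x1 x2 y => ksum (fun r1 r2 =>
    ((x1 * r1) |> th v) * factH y eta (vact (x2 * r2) u)) R)); try by hlin.
  transitivity (ksum (fun x y => ksum (fun r1 r2 => ksum (fun y1 y2 =>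
      ((x * r1) |> th v) * factH y2 eta (vact (y1 * r2) u)) (D y)) R) (D h)).
    rewrite ksum_exchange; apply: eq_ksum => r1 r2; rewrite act_mul.
    apply: eq_ksum => x y; rewrite -actM (form_act y eta) ksum_mulr.
    by apply: eq_ksum => y1 y2; rewrite vactM.
  by apply: eq_ksum => x y; rewrite ksum_exchange.
apply: eq_ksum => x y.
rewrite (sw_Rcop T (f := fun a b => (a |> th v) * factH y eta (vact b u)));
  try by hlin.
rewrite ksum_exchange; apply: eq_ksum => x1 x2.
rewrite /f ksum_exchange; apply: eq_ksum => r1 r2.
by rewrite actM form_act ksum_act ksum_mull.
Qed.

(** Cancellation h_3 S^-1(h_2) = 1 followed by h_2 S^-1(h_1) = 1; it turns an
equivariance property into a formula for the action on the last variable. *)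
Lemma sw_antipV_unwind (V : lmodType k) (f : H -> H -> H -> V) h :
  (forall y z, klinear (fun x => f x y z)) ->
  (forall x z, klinear (fun y => f x y z)) ->
  (forall x y, klinear (f x y)) ->
  ksum (fun p q => ksum (fun r s => ksum (fun x y => ksum (fun y1 y2 =>
    f (x * SV r) (y1 * SV p) y2) (D y)) (D s)) (D q)) (D h) = f 1 1 h.
Proof.
move=> l1 l2 l3; have lSV := antipV_lin T.
have l2' a b c : klinear (fun x => f a (b * x) c) by apply: (klin_comp (l2 _ _)); klin.
have l2'' a b c : klinear (fun x => f a (x * b) c).
  by apply: (klin_comp (l2 _ _)); klin.
have lg a p : klinear (fun y => ksum (fun y1 y2 => f a (y1 * SV p) y2) (D y)).
  apply: klin_ksumf; last exact: klin_morph.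
  - by move=> y; exact: l2''.
  - by move=> y; exact: l3.
transitivity (ksum (fun p q => ksum (fun y1 y2 => f 1 (y1 * SV p) y2) (D q)) (D h)).
  apply: eq_ksum => p q.
  rewrite -(sw_coassoc T (f := fun r x y =>
    ksum (fun y1 y2 => f (x * SV r) (y1 * SV p) y2) (D y))); last 3 first.
  - move=> y g; apply: klin_sum => a b.
    by apply: (klin_comp (l1 _ _)); klin.
  - by move=> y g; apply: klin_sum => a b; apply: (klin_comp (l1 _ _)); klin.
  - by move=> y g; exact: lg.
  transitivity (ksum (fun s y => (eps s : k) *:
     ksum (fun y1 y2 => f 1 (y1 * SV p) y2) (D y)) (D q)).
    apply: eq_ksum => s y.
    rewrite (sw_antipV1 T (f := fun g => ksum (fun y1 y2 => f g (y1 * SV p) y2) (D y))) //.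
    by apply: klin_sum.
  by rewrite (sw_counitL T (f := fun y => ksum (fun y1 y2 => f 1 (y1 * SV p) y2) (D y))).
rewrite -(sw_coassoc T (f := fun p y1 y2 => f 1 (y1 * SV p) y2)) //; last first.
  by move=> y g; apply: (klin_comp (l2' _ _ _) lSV).
transitivity (ksum (fun s y => (eps s : k) *: f 1 1 y) (D h)).
  apply: eq_ksum => s y.
  by rewrite (sw_antipV1 T (f := fun g => f 1 g y)).
by rewrite (sw_counitL T (f := f 1 1)).
Qed.

(** The right-hand side involves t only through its values, so this also shows
that the action of H on Omega (x)_A Omega is determined by the pairing. *)
Lemma pairing2_hact u v h (t : atensor T OX OX) :
  pairing2 u v (hact h t) = ksum (fun x y => ksum (fun y1 y2 =>
    y2 |> pairing2 (vact (SV y1) u) (vact (SV x) v) t) (D y)) (D h).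
Proof.
pose f (a b c : H) := pairing2 (vact a u) (vact b v) (hact c t).
have := @sw_antipV_unwind _ f h; rewrite /f !vact1 => <-; last 3 first.
- by move=> y z; apply: klin_pairing2l.
- by move=> y z; apply: klin_pairing2r.
- by move=> x y; exact: (klin_pairing2_hact _ _ _ (@klin_id _ _)).
apply: eq_ksum => p q; apply: eq_ksum => r s; rewrite pairing2_act.
by apply: eq_ksum => x y; apply: eq_ksum => y1 y2; rewrite !vactM.
Qed.

End Pairing.

(** * Iterated coproducts and the R-matrix *)
Section IteratedCoproduct.
Variables (k : comUnitRingType) (H : algType k) (T : triangularHopf H).
Local Notation D := (Delta T).
Local Notation R := (Rbar T).

Lemma eq_klin (M V : lmodType k) (f g : M -> V) : f =1 g -> klinear f -> klinear g.
Proof. by move=> e l c x y; rewrite -!e l. Qed.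

Variable V : lmodType k.

Definition cop3 (f : H -> H -> H -> V) h : V :=
  ksum (fun x y => ksum (f x) (D y)) (D h).

Lemma eq_cop3 (f g : H -> H -> H -> V) h :
  (forall x y z, f x y z = g x y z) -> cop3 f h = cop3 g h.
Proof. by move=> e; apply: eq_ksum => x y; apply: eq_ksum => y1 y2. Qed.

Lemma cop3M (f : H -> H -> H -> V) g h :
  (forall y z, klinear (fun x => f x y z)) ->
  (forall x z, klinear (fun y => f x y z)) ->
  (forall x y, klinear (f x y)) ->
  cop3 f (g * h) =
  cop3 (fun x y z => cop3 (fun x' y' z' => f (x * x') (y * y') (z * z')) h) g.
Proof.
move=> l1 l2 l3; rewrite /cop3 sw_DM; last 2 first.
- by klin.
- move=> x; apply: klin_ksumf; last exact: klin_morph.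
    by move=> y; exact: l2.
  by move=> y; exact: l3.
apply: eq_ksum => x y.
transitivity (ksum (fun x' y' => ksum (fun y1 y2 => ksum (fun y1' y2' =>
  f (x * x') (y1 * y1') (y2 * y2')) (D y')) (D y)) (D h)).
  by apply: eq_ksum => x' y'; rewrite sw_DM.
by rewrite ksum_exchange.
Qed.

Lemma cop3_ksum (M N : lmodType k) (f : M -> N -> H -> H -> H -> V)
    (t : ktensor M N) h :
  ksum (fun m n => cop3 (f m n) h) t =
  cop3 (fun x y z => ksum (fun m n => f m n x y z) t) h.
Proof.
rewrite ksum_exchange; apply: eq_ksum => x y.
by rewrite ksum_exchange.
Qed.

Section Four.
Variable f : H -> H -> H -> H -> V.
Hypotheses (l1 : forall x y z, klinear (fun a => f a x y z))
  (l2 : forall a y z, klinear (fun x => f a x y z))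
  (l3 : forall a x z, klinear (fun y => f a x y z))
  (l4 : forall a x y, klinear (f a x y)).

(** (id (x) Delta^2) R as a product of three copies of R. *)
Lemma Rbar_cop3r :
  ksum (fun r1 r2 => cop3 (f r1) r2) R =
  ksum (fun p1 p2 => ksum (fun s1 s2 => ksum (fun r1 r2 =>
    f (p1 * (s1 * r1)) p2 s2 r2) R) R) R.
Proof.
have m1 p x y z : klinear (fun a => f (p * a) x y z).
  by apply: (klin_comp (l1 _ _ _)); klin.
rewrite /cop3 (sw_RD2 T (f := fun r x y => ksum (f r x) (D y))); last 3 first.
- by klin.
- by klin.
- move=> r x; apply: klin_ksumf; last exact: klin_morph.
    by move=> y; exact: l3.
  by move=> y; exact: l4.
apply: eq_ksum => p1 p2.
by rewrite (sw_RD2 T (f := fun r x y => f (p1 * r) p2 x y)).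
Qed.

(** (Delta^2 (x) id) R as a product of three copies of R. *)
Lemma Rbar_cop3l :
  ksum (fun r1 r2 => cop3 (f r2) r1) R =
  ksum (fun c1 c2 => ksum (fun a1 a2 => ksum (fun b1 b2 =>
    f (a2 * b2 * c2) c1 b1 a1) R) R) R.
Proof.
have m1 p x y z : klinear (fun a => f (a * p) x y z).
  by apply: (klin_comp (l1 _ _ _)); klin.
rewrite /cop3 (sw_RD1 T (f := fun x y r => ksum (f r x) (D y))); last 3 first.
- by klin.
- move=> r x; apply: klin_ksumf; last exact: klin_morph.
    by move=> y; exact: l3.
  by move=> y; exact: l4.
- by klin.
rewrite ksum_exchange; apply: eq_ksum => c1 c2.
by rewrite (sw_RD1 T (f := fun x y r => f (r * c2) c1 x y)).
Qed.


End Four.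

(** Moving a vector field past three objects at once and then back past the
first two amounts to moving it past the third one only. *)
Lemma cop3_absorb (f : H -> H -> H -> H -> V) :
  (forall x y z, klinear (fun a => f a x y z)) ->
  (forall a y z, klinear (fun x => f a x y z)) ->
  (forall a x z, klinear (fun y => f a x y z)) ->
  (forall a x y, klinear (f a x y)) ->
  ksum (fun a1 a2 => ksum (fun r1 r2 => ksum (fun q1 q2 =>
    cop3 (fun x y z => f (a2 * r1 * q1) (x * r2) (y * q2) z) a1) R) R) R =
  ksum (fun a1 a2 => f a2 1 1 a1) R.
Proof.
move=> l1 l2 l3 l4.
transitivity (ksum (fun q1 q2 => ksum (fun r1 r2 => ksum (fun c1 c2 =>
   ksum (fun a1 a2 => ksum (fun b1 b2 =>
     f (a2 * b2 * (c2 * r1) * q1) (c1 * r2) (b1 * q2) a1) R) R) R) R) R).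
  rewrite ksum_exchange [RHS]ksum_exchange; apply: eq_ksum => r1 r2.
  rewrite ksum_exchange; apply: eq_ksum => q1 q2.
  rewrite (Rbar_cop3l (f := fun a x y z => f (a * r1 * q1) (x * r2) (y * q2) z));
    last 4 first.
  - by move=> x y z; apply: (klin_comp (l1 _ _ _)); klin.
  - by move=> x y z; apply: (klin_comp (l2 _ _ _)); klin.
  - by move=> x y z; apply: (klin_comp (l3 _ _ _)); klin.
  - by [].
  apply: eq_ksum => c1 c2; apply: eq_ksum => a1 a2; apply: eq_ksum => b1 b2.
  by rewrite !mulrA.
transitivity (ksum (fun a1 a2 => ksum (fun q1 q2 => ksum (fun b1 b2 =>
    f (a2 * (b2 * q1)) 1 (b1 * q2) a1) R) R) R).
  rewrite [RHS]ksum_exchange; apply: eq_ksum => q1 q2; rewrite ksum_exchange.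
  rewrite (sw_Rbar21 T (f := fun x y => ksum (fun a1 a2 => ksum (fun b1 b2 =>
    f (a2 * b2 * y * q1) x (b1 * q2) a1) R) R)).
  - apply: eq_ksum => a1 a2; apply: eq_ksum => b1 b2.
    by rewrite mulr1 mulrA.
  - by move=> y; apply: klin_sum => a b; apply: klin_sum.
  - move=> x; apply: klin_sum => a b; apply: klin_sum => p q.
    by apply: (klin_comp (l1 _ _ _)); klin.
apply: eq_ksum => a1 a2; rewrite ksum_exchange.
rewrite (sw_Rbar21 T (f := fun x y => f (a2 * y) 1 x a1)); first by rewrite mulr1.
- by [].
- by move=> x; apply: (klin_comp (l1 _ _ _)); klin.
Qed.
End IteratedCoproduct.

Ltac hextra ::= first
  [ apply: klin_pairing2l | apply: klin_pairing2r
  | apply: klin_sub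
  | match goal with l : forall _ _, vlinear _ |- _ =>
      apply: (klin_vlin _ (l _ _)) end ].

(** * Triple tensors: rebracketing and braiding *)
Section Rebracketing.
Variables (k : comUnitRingType) (H : algType k) (T : triangularHopf H).
Variables (A : algType k) (X : bcModuleAlgebra T A).
Local Notation R := (Rbar T).
Local Notation VX := (Xfields X).
Local Notation OX := (Omega X).
Local Notation OO := (atensor T OX OX).
Local Notation "h |> a" := (hopf_act X h a) (at level 38, right associativity).
Implicit Types (u v z : vfield X) (th eta : oneform X).

Lemma atens_lact_balanced a : balanced (@ract H A OX) (@lact H A OX)
  (fun m n : OX => atens (lact a m) n).
Proof.
split=> [m m' n|m n n'|m b n].
- by rewrite -atensDl; congr atens; exact: factlDr.
- exact: atensDr.
- rewrite -(balS (atens_balanced OX OX)); congr atens.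
  exact: form_eq.
Qed.

Lemma pairing2_lact u v (s : OO) a :
  pairing2 u v (lact a s) = pairing2 u (vactr v a) s.
Proof.
elim/tensor_ind: s => [|w1 w2|t t' IH IH'].
- by rewrite [lact _ _](tsum0 (atens_lact_balanced a)) !pairing20.
- rewrite [lact _ _](tsum_tens (atens_lact_balanced a)) -[tens w1 w2]/(atens w1 w2).
  by rewrite !pairing2_tens.
- by rewrite [lact _ _](tsumD (atens_lact_balanced a)) !pairing2D IH IH'.
Qed.

(** Transposing a tensor needs both bracketings of the triple product: the
braiding of the last two legs is defined through this one. *)
Definition pairing3r u v z (t : atensor T OX OO) : A :=
  tsum (fun (th : OX) (s : OO) => pairing2 u (vactr v ((th : oneform X) z)) s) t.

Lemma pairing3r_balanced u v z : balanced (@ract H A OX) (@lact H A OO)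
  (fun (th : OX) (s : OO) => pairing2 u (vactr v ((th : oneform X) z)) s).
Proof.
split=> [th th' s|th s s'|th a s].
- by rewrite /= vactrD pairing2Dr.
- exact: pairing2D.
- by rewrite pairing2_lact /= vactrM.
Qed.

Lemma pairing3r_tens u v z th (s : OO) :
  pairing3r u v z (atens (th : OX) s) = pairing2 u (vactr v (th z)) s.
Proof. exact: (tsum_tens (pairing3r_balanced u v z)). Qed.

Lemma pairing3_sum (I : Type) (s : seq I) u v z (t : I -> atensor T OO OX) :
  pairing3 u v z (\sum_(i <- s) t i) = \sum_(i <- s) pairing3 u v z (t i).
Proof.
by apply: (big_morph (pairing3 u v z)) => [x y|]; [exact: pairing3D|exact: pairing30].
Qed.

Lemma pairing3_ksum (M N : lmodType k) (f : M -> N -> atensor T OO OX)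
    (t : ktensor M N) u v z :
  pairing3 u v z (ksum f t) = ksum (fun m n => pairing3 u v z (f m n)) t.
Proof. exact: pairing3_sum. Qed.

Lemma pairing3r_sum (I : Type) (s : seq I) u v z (t : I -> atensor T OX OO) :
  pairing3r u v z (\sum_(i <- s) t i) = \sum_(i <- s) pairing3r u v z (t i).
Proof.
apply: (big_morph (pairing3r u v z)) => [x y|].
- exact: (tsumD (pairing3r_balanced u v z)).
- exact: (tsum0 (pairing3r_balanced u v z)).
Qed.

Lemma pairing3_assocl u v z (t : atensor T OX OO) :
  pairing3 u v z (assocl t) = pairing3r u v z t.
Proof.
rewrite /assocl /pairing3r /tsum pairing3_sum; apply: eq_bigr => -[th s] _ /=.
rewrite pairing3_sum pairing2_tsum; apply: eq_bigr => -[w1 w2] _ /=.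
by rewrite pairing3_tens !pairing2_tens.
Qed.

Lemma pairing3r_assocr u v z (t : atensor T OO OX) :
  pairing3r u v z (assocr t) = pairing3 u v z t.
Proof.
rewrite /assocr /pairing3 /tsum pairing3r_sum; apply: eq_bigr => -[s th] _ /=.
rewrite pairing3r_sum pairing2_tsum /tsum.
rewrite (big_morph (fun a => th (vactr u a)) (id1 := 0) (op1 := +%R)); first last.
- by rewrite vactr0 form0.
- by move=> a b; rewrite vactrD formD.
by apply: eq_bigr => -[w1 w2] _ /=; rewrite pairing3r_tens !pairing2_tens.
Qed.

(** The extra right factor a stays to the right of u and v while these are
exchanged. *)
Lemma pairing2_braid_vactr u v a (s : OO) :
  pairing2 u (vactr v a) (braid s) =
  ksum (fun r1 r2 => pairing2 (vact r1 v) (vactr (vact r2 u) a) s) R.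
Proof.
rewrite pairing2_braid.
transitivity (ksum (fun r1 r2 => ksum (fun x y =>
    pairing2 (vactr (vact x v) (y |> a)) (vact r2 u) s) (Delta T r1)) R).
  apply: eq_ksum => r1 r2; rewrite vact_vactr.
  by rewrite (map_ksum (h := fun v => pairing2 v _ s) _ _ (fun v v' => pairing2Dl v v' _ s)).
rewrite (sw_RD1 T (f := fun x y r =>
  pairing2 (vactr (vact x v) (y |> a)) (vact r u) s)); last 3 first.
- move=> y r; apply: (eq_klin (f := fun x =>
    pairing2 (vact x v) ((y |> a) *: vact r u) s)).
    by move=> x; rewrite pairing2Zr.
  by hlin.
- move=> y r c p q; rewrite (act_linear X a) vactrD.
  rewrite (_ : (c *: (p |> a)) = (p |> a) * c%:A); last first.
    by rewrite -scalerAr mulr1.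
  rewrite vactrM vactrk pairing2Dl pairing2Zl.
  by rewrite -scalerAl mul1r.
- by hlin.
rewrite ksum_exchange; apply: eq_ksum => s1 s2.
rewrite (map_ksum (h := fun v => pairing2 _ v s) _ _ (fun v v' => pairing2Dr _ v v' s)).
by apply: eq_ksum => r1 r2; rewrite -pairing2Zr vactM.
Qed.

Lemma pairing3_braid23 u v z (t : atensor T OO OX) :
  pairing3 u v z (braid23 t) =
  ksum (fun r1 r2 => pairing3 (vact r1 v) (vact r2 u) z t) R.
Proof.
rewrite /braid23 pairing3_assocl.
under eq_ksum => r1 r2 do rewrite -pairing3r_assocr.
move: (assocr t) => {}t; rewrite [RHS]exchange_big [X in pairing3r _ _ _ X]/tsum.
rewrite pairing3r_sum; apply: eq_bigr => -[th s] _ /=.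
by rewrite pairing3r_tens pairing2_braid_vactr.
Qed.

End Rebracketing.

(** * Evaluation of the lifted dual connection *)
Section DualConnection.
Variables (k : comUnitRingType) (H : algType k) (T : triangularHopf H).
Variables (A : algType k) (X : bcModuleAlgebra T A).
Local Notation D := (Delta T).
Local Notation S := (antip T).
Local Notation SV := (antipV T).
Local Notation eps := (counit T).
Local Notation R := (Rbar T).
Local Notation VX := (Xfields X).
Local Notation OX := (Omega X).
Local Notation OO := (atensor T OX OX).
Local Notation "h |> a" := (hopf_act X h a) (at level 38, right associativity).
Implicit Types (u v : vfield X) (th eta : oneform X) (h : H).

Variables (N : vfield X -> vfield X -> vfield X) (dnabla : OX -> OO).
Hypotheses (lN1 : forall (w : oneform X) v, vlinear (fun u => w (N u v)))
  (lN2 : forall (w : oneform X) u, vlinear (fun v => w (N u v)))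
  (hd : forall u v th, pairing2 u v (dnabla th) = u (th v) - th (N u v)).
Local Notation hm h eta := (hact_map T h dnabla eta : OO).

Lemma pairing2_hact_dual u v c d eta :
  pairing2 u v (hact c (dnabla (factH d eta))) =
  ksum (fun x y => ksum (fun y1 y2 => y2 |> (vact (SV y1) u
      (factH d eta (vact (SV x) v)) - factH d eta (N (vact (SV y1) u) (vact (SV x) v))))
    (D y)) (D c).
Proof.
rewrite pairing2_hact; apply: eq_ksum => x y; apply: eq_ksum => y1 y2.
by rewrite hd.
Qed.

Lemma klin_hact_dual u v c eta :
  klinear (fun d => pairing2 u v (hact c (dnabla (factH d eta)))).
Proof.
apply: eq_klin; first by move=> d; rewrite pairing2_hact_dual.
by hlin.
Qed.

Lemma pairing2_hact_map u v h eta : pairing2 u v (hm h eta) =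
  ksum (fun c d => pairing2 u v (hact c (dnabla (factH (S d) eta)))) (D h).
Proof. exact: pairing2_ksum. Qed.

Lemma klin_hact_map (M : lmodType k) (p : M -> H) u v eta :
  klinear p -> klinear (fun m => pairing2 u v (hm (p m) eta)).
Proof.
move=> lp; apply: eq_klin; first by move=> d; rewrite pairing2_hact_map.
apply: klin_ksumf; last exact: klin_morph.
- by move=> d; exact: (klin_pairing2_hact _ _ _ (@klin_id _ _)).
- move=> c; apply: (klin_comp (klin_hact_dual u v c eta)); exact: klin_morph.
Qed.

(** Evaluation is equivariant, and the action of h_2 S(h_3) on the one-form
cancels. *)
Lemma form_act_antip h eta u :
  ksum (fun g d => g |> factH (S d) eta u) (D h) = eta (vact h u).
Proof.
transitivity (ksum (fun g d => ksum (fun x y =>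
    factH (y * S d) eta (vact x u)) (D g)) (D h)).
  apply: eq_ksum => g d; rewrite form_act; apply: eq_ksum => x y.
  by rewrite factHM.
rewrite (sw_coassoc T (f := fun x y d => factH (y * S d) eta (vact x u)));
  try by hlin.
transitivity (ksum (fun x y => (eps y : k) *: eta (vact x u)) (D h)).
  apply: eq_ksum => x y.
  rewrite (sw_antipR T (f := fun g => factH g eta (vact x u))); last by hlin.
  by rewrite factH1.
by rewrite (sw_counitR T (f := fun g => eta (vact g u))) //; hlin.
Qed.

(** The adjoint action on the map dnabla is invisible once h acts on the vector
fields as well: the first three factors of the coproduct of h act jointly on
the value of the pairing, and the fourth one, through the antipode, undoes the
action on eta.  What remains is the duality relation of dnabla, transported by
h.  This identity gives access to h |> dnabla without computing h |> nabla. *)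
Lemma hact_map_cop3 h u v eta :
  cop3 T (fun x y z => pairing2 (vact x u) (vact y v) (hm z eta)) h =
  ksum (fun x y => vact x u (eta (vact y v))) (D h) - eta (vact h (N u v)).
Proof.
pose f x y c d := pairing2 (vact x u) (vact y v) (hact c (dnabla (factH (S d) eta))).
have l1 y c d : klinear (fun x => f x y c d) by exact: klin_pairing2l.
have l2 x c d : klinear (fun y => f x y c d) by exact: klin_pairing2r.
have l3 x y d : klinear (fun c => f x y c d).
  exact: (klin_pairing2_hact _ _ _ (@klin_id _ _)).
have l4 x y c : klinear (f x y c).
  by apply: (klin_comp (klin_hact_dual _ _ c eta)); exact: klin_morph.
transitivity (ksum (fun g d => g |> pairing2 u v (dnabla (factH (S d) eta))) (D h)).
  symmetry; transitivity (ksum (fun g d => ksum (fun x y => ksum (fun y1 y2 =>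
      f x y1 y2 d) (D y)) (D g)) (D h)).
    by apply: eq_ksum => g d; rewrite pairing2_act.
  rewrite (sw_coassoc T (f := fun x y d => ksum (fun y1 y2 => f x y1 y2 d) (D y)));
    last 3 first.
  - by move=> y d; apply: klin_sum.
  - by move=> x d; apply: klin_ksumf; last exact: klin_morph.
  - by move=> x y; apply: klin_sum.
  apply: eq_ksum => x q; rewrite (sw_coassoc T (f := f x)) //.
  by apply: eq_ksum => y z; rewrite pairing2_hact_map.
transitivity (ksum (fun g d => g |> u (factH (S d) eta v)) (D h) -
  ksum (fun g d => g |> factH (S d) eta (N u v)) (D h)).
  rewrite -ksumN -ksum_split; apply: eq_ksum => g d.
  by rewrite hd linearB.
rewrite form_act_antip; congr (_ - _).
transitivity (ksum (fun g d => ksum (fun x y =>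
    vact x u (y |> factH (S d) eta v)) (D g)) (D h)).
  by apply: eq_ksum => g d; rewrite vact_app.
rewrite (sw_coassoc T (f := fun x y d => vact x u (y |> factH (S d) eta v)));
  try by hlin.
by apply: eq_ksum => x y; rewrite -ksum_vfun form_act_antip.
Qed.

Variables (th eta : oneform X).
Local Notation te := (atens (th : OX) (eta : OX) : OO).

(** First summand of the lift.  The braiding of the last two legs exchanges u
and v; the derivation part then recombines, by R R_21 = 1, with u back in
front. *)
Lemma lift_left u v z :
  pairing3 u v z (braid23 (atens (dnabla th) (eta : OX))) =
  ksum (fun p1 p2 => u (p1 |> th z) * eta (vact p2 v)) R
  - ksum (fun r1 r2 => pairing2 (vact r1 v) (N (vact r2 u) z) te) R.
Proof.
rewrite pairing3_braid23.
transitivity (ksum (fun r1 r2 => eta (vactr (vact r1 v) (vact r2 u (th z))) -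
   pairing2 (vact r1 v) (N (vact r2 u) z) te) R).
  apply: eq_ksum => r1 r2; rewrite pairing3_tens hd pairing2_tens.
  (* the sign is absorbed by the right action as a scalar of k *)
  rewrite -[X in eta (vactr _ (_ + X))]scaleN1r.
  rewrite [X in eta (vactr _ (_ + X))](_ : _ = th (N (vact r2 u) z) * (-1)%:A).
    rewrite vactrD formD vactrM vactrk formZ.
    by rewrite -scalerAl mul1r scaleN1r.
  by rewrite -scalerAr mulr1.
rewrite ksum_split ksumN; congr (_ - _).
transitivity (ksum (fun r1 r2 => ksum (fun p1 p2 => ksum (fun t1 t2 =>
   vact (t1 * r2) u (p1 |> th z) * eta (vact (p2 * (t2 * r1)) v)) R) R) R).
  apply: eq_ksum => r1 r2; rewrite form_vactr.
  transitivity (ksum (fun p1 p2 => ksum (fun x y =>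
      vact (x * r2) u (y |> th z) * eta (vact (p2 * r1) v)) (D p1)) R).
    apply: eq_ksum => p1 p2; rewrite vact_app ksum_mull.
    by apply: eq_ksum => x y; rewrite !vactM.
  rewrite (sw_RD1 T (f := fun x y p =>
    vact (x * r2) u (y |> th z) * eta (vact (p * r1) v))); try by hlin.
  by apply: eq_ksum => p1 p2; apply: eq_ksum => t1 t2; rewrite mulrA.
rewrite ksum_exchange; apply: eq_ksum => p1 p2; rewrite ksum_exchange.
rewrite (sw_Rbar21 T (f := fun x y =>
  vact x u (p1 |> th z) * eta (vact (p2 * y) v))); try by hlin.
by rewrite vact1 mulr1.
Qed.

Lemma pairing2_vactr_R u v a (t : OO) :
  pairing2 u (vactr v a) t =
  ksum (fun p1 p2 => ksum (fun s1 s2 =>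
    ((p1 * s1) |> a) * pairing2 (vact p2 u) (vact s2 v) t) R) R.
Proof.
rewrite (map_ksum (h := fun v => pairing2 u v t) _ _ (fun v v' => pairing2Dr u v v' t)).
rewrite ksum_exchange; apply: eq_ksum => s1 s2; rewrite pairing2ZrR.
by apply: eq_ksum => p1 p2; rewrite actM.
Qed.

(** Psi u v x y h plays the role of <(h |> nabla)_{x u} (y v), eta>; see
Psi_cop3. *)
Let Psi u v x y h : A :=
  (eps h : k) *: vact x u (eta (vact y v)) -
  pairing2 (vact x u) (vact y v) (hm h eta).

Let Psi1 u v y h : klinear (fun x => Psi u v x y h).
Proof. by apply: klin_sub; hlin. Qed.

Let Psi2 u v x h : klinear (fun y => Psi u v x y h).
Proof. by apply: klin_sub; hlin. Qed.

Let Psi3 u v x y : klinear (Psi u v x y).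
Proof.
apply: klin_sub; first by apply: klin_scale; exact: klin_morph.
by apply: klin_hact_map.
Qed.

Let Psi_cop3 u v h : cop3 T (Psi u v) h = eta (vact h (N u v)).
Proof.
rewrite /cop3 /Psi.
transitivity (ksum (fun x y => ksum (fun y1 y2 =>
    (eps y2 : k) *: vact x u (eta (vact y1 v))) (D y)) (D h) -
  cop3 T (fun x y z => pairing2 (vact x u) (vact y v) (hm z eta)) h).
  rewrite -ksumN -ksum_split; apply: eq_ksum => x y.
  by rewrite ksum_split ksumN.
rewrite hact_map_cop3 opprB.
rewrite (_ : ksum _ _ = ksum (fun x y => vact x u (eta (vact y v))) (D h)).
  by rewrite addrCA subrr addr0.
apply: eq_ksum => x y.
by rewrite (sw_counitR T (f := fun y => vact x u (eta (vact y v)))) //; hlin.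
Qed.

(** Both sides pair theta with z and eta with nabla_u v; they differ by the
order in which z is moved across u, v and nabla.  On the left R^a acts on the
value nabla_u v, and Psi_cop3 distributes this action over u, v and nabla; all
the crossings of z with u and v then cancel in pairs (cop3_absorb), and the
crossing with nabla is the one that remains on the right. *)
Lemma lift_right_shift u v z :
  ksum (fun a1 a2 => ksum (fun r1 r2 => ksum (fun q1 q2 =>
    pairing2 (vact a1 (N (vact r2 u) (vact q2 v))) (vact (a2 * r1 * q1) z) te)
    R) R) R =
  ksum (fun p1 p2 => ksum (fun s1 s2 => ksum (fun r1 r2 =>
    ((p1 * s1) |> factH r1 th z) * Psi u v p2 s2 r2) R) R) R.
Proof.
have lP3 := Psi3 u v.
pose F p g x y h := (p |> th (vact g z)) * Psi u v x y h.
have lF1 g x y h : klinear (fun p => F p g x y h) by rewrite /F; hlin.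
have lF2 p x y h : klinear (fun g => F p g x y h) by rewrite /F; hlin.
have lF3 p g y h : klinear (fun x => F p g x y h) by apply: klin_mulr.
have lF4 p g x h : klinear (fun y => F p g x y h) by apply: klin_mulr.
have lF5 p g x y : klinear (F p g x y) by apply: klin_mulr.
pose K g x y h := ksum (fun p1 p2 => ksum (fun s1 s2 => ksum (fun t1 t2 =>
  F (p1 * (s1 * t1)) g (p2 * x) (s2 * y) (t2 * h)) R) R) R.
transitivity (ksum (fun a1 a2 => ksum (fun r1 r2 => ksum (fun q1 q2 =>
    cop3 T (fun x y w => K (a2 * r1 * q1) (x * r2) (y * q2) w) a1) R) R) R).
  apply: eq_ksum => a1 a2; apply: eq_ksum => r1 r2; apply: eq_ksum => q1 q2.
  rewrite pairing2_tensR.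
  transitivity (ksum (fun p1 p2 => cop3 T (fun x y w => cop3 T (fun x' y' w' =>
      F p1 (a2 * r1 * q1) (x * x' * r2) (y * y' * q2) (w * w')) a1) p2) R).
    apply: eq_ksum => p1 p2; rewrite -vactM -Psi_cop3 cop3M; last 3 first.
    - by move=> y w; exact: Psi1.
    - by move=> x w; exact: Psi2.
    - by move=> x y; exact: Psi3.
    rewrite /cop3 ksum_mulr; apply: eq_ksum => x y; rewrite ksum_mulr.
    apply: eq_ksum => y1 y2; rewrite ksum_mulr.
    apply: eq_ksum => x' y'; rewrite ksum_mulr.
    apply: eq_ksum => y1' y2'; rewrite /F /Psi; congr (_ * _).
    by rewrite -!vactM.
  rewrite (Rbar_cop3r T (f := fun p x y w => cop3 T (fun x' y' w' =>
      F p (a2 * r1 * q1) (x * x' * r2) (y * y' * q2) (w * w')) a1)); last 4 first.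
  - by move=> x y w; apply: klin_sum => b c; apply: klin_sum => d e.
  - move=> p y w; apply: klin_sum => b c; apply: klin_sum => d e.
    by apply: (klin_comp (lF3 _ _ _ _)); klin.
  - move=> p x w; apply: klin_sum => b c; apply: klin_sum => d e.
    by apply: (klin_comp (lF4 _ _ _ _)); klin.
  - move=> p x y; apply: klin_sum => b c; apply: klin_sum => d e.
    by apply: (klin_comp (lF5 _ _ _ _)); klin.
  rewrite /K -cop3_ksum; apply: eq_ksum => p1 p2.
  rewrite -cop3_ksum; apply: eq_ksum => s1 s2.
  rewrite -cop3_ksum; apply: eq_ksum => t1 t2.
  by apply: eq_cop3 => x y w; rewrite !mulrA.
rewrite cop3_absorb; last 4 first.
- move=> x y w; apply: klin_sum => b c; apply: klin_sum => d e.
  by apply: klin_sum => b' c'.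
- move=> x y w; apply: klin_sum => b c; apply: klin_sum => d e.
  by apply: klin_sum => b' c'; apply: (klin_comp (lF3 _ _ _ _)); klin.
- move=> x y w; apply: klin_sum => b c; apply: klin_sum => d e.
  by apply: klin_sum => b' c'; apply: (klin_comp (lF4 _ _ _ _)); klin.
- move=> x y w; apply: klin_sum => b c; apply: klin_sum => d e.
  by apply: klin_sum => b' c'; apply: (klin_comp (lF5 _ _ _ _)); klin.
rewrite /K [LHS]ksum_exchange; apply: eq_ksum => p1 p2.
rewrite [LHS]ksum_exchange; apply: eq_ksum => s1 s2.
transitivity (ksum (fun t1 t2 => ksum (fun x y => ksum (fun a1 a2 =>
    ((p1 * s1) |> factH y th (vact (x * a2) z)) * Psi u v p2 s2 (t2 * a1)) R)
    (D t1)) R).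
  rewrite [LHS]ksum_exchange; apply: eq_ksum => t1 t2.
  rewrite [RHS]ksum_exchange; apply: eq_ksum => a1 a2.
  rewrite /F !mulr1 mulrA actM form_act ksum_act ksum_mull.
  by apply: eq_ksum => x y; rewrite vactM.
rewrite (sw_RD1 T (f := fun x y t => ksum (fun a1 a2 =>
    ((p1 * s1) |> factH y th (vact (x * a2) z)) * Psi u v p2 s2 (t * a1)) R));
  last 3 first.
- by hlin.
- by hlin.
- move=> x y; apply: klin_sum => b c; apply: klin_mulr.
  by apply: (klin_comp (lP3 _ _)); klin.
apply: eq_ksum => r1 r2.
transitivity (ksum (fun t1 t2 => ksum (fun a1 a2 =>
    ((p1 * s1) |> factH r1 th (vact (t1 * a2) z)) * Psi u v p2 s2 (r2 * (t2 * a1)))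
    R) R).
  by apply: eq_ksum => t1 t2; apply: eq_ksum => a1 a2; rewrite mulrA.
rewrite (sw_Rbar21 T (f := fun x y =>
  ((p1 * s1) |> factH r1 th (vact x z)) * Psi u v p2 s2 (r2 * y))).
- by rewrite vact1 mulr1.
- by hlin.
- move=> x; apply: klin_mulr.
  by apply: (klin_comp (lP3 _ _)); klin.
Qed.

(** Second summand of the lift.  The part of Psi with the counit is a derivation
u acting on the second factor of a product; the Leibniz rule turns it into the
full Lie derivative minus the term that lift_left produces. *)
Lemma lift_right u v z :
  pairing3 u v z (ksum (fun r1 r2 =>
    assocl (atens (hact r1 (th : OX)) (hm r2 eta))) R) =
  u (pairing2 v z te) - ksum (fun p1 p2 => u (p1 |> th z) * eta (vact p2 v)) R
  - ksum (fun a1 a2 => ksum (fun r1 r2 => ksum (fun q1 q2 =>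
      pairing2 (vact a1 (N (vact r2 u) (vact q2 v))) (vact (a2 * r1 * q1) z) te)
      R) R) R.
Proof.
rewrite lift_right_shift pairing3_ksum.
transitivity (ksum (fun p1 p2 => ksum (fun s1 s2 => ksum (fun r1 r2 =>
    ((p1 * s1) |> factH r1 th z) * ((eps r2 : k) *: vact p2 u (eta (vact s2 v))
      - Psi u v p2 s2 r2)) R) R) R).
  transitivity (ksum (fun r1 r2 => ksum (fun p1 p2 => ksum (fun s1 s2 =>
    ((p1 * s1) |> factH r1 th z) *
     pairing2 (vact p2 u) (vact s2 v) (hm r2 eta)) R) R) R).
    apply: eq_ksum => r1 r2.
    by rewrite pairing3_assocl pairing3r_tens pairing2_vactr_R.
  rewrite ksum_exchange; apply: eq_ksum => p1 p2.
  rewrite ksum_exchange; apply: eq_ksum => s1 s2; apply: eq_ksum => r1 r2.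
  by rewrite /Psi subKr.
transitivity (ksum (fun p1 p2 => ksum (fun s1 s2 => ksum (fun r1 r2 =>
    ((p1 * s1) |> factH r1 th z) * ((eps r2 : k) *: vact p2 u (eta (vact s2 v)))
    ) R) R) R - ksum (fun p1 p2 => ksum (fun s1 s2 => ksum (fun r1 r2 =>
    ((p1 * s1) |> factH r1 th z) * Psi u v p2 s2 r2) R) R) R).
  rewrite -ksumN -ksum_split; apply: eq_ksum => p1 p2.
  rewrite -ksumN -ksum_split; apply: eq_ksum => s1 s2.
  rewrite -ksumN -ksum_split; apply: eq_ksum => r1 r2.
  by rewrite mulrBr.
congr (_ - _); rewrite pairing2_tensR ksum_vfun.
transitivity (ksum (fun s1 s2 => u ((s1 |> th z) * eta (vact s2 v)) -
   u (s1 |> th z) * eta (vact s2 v)) R); last by rewrite ksum_split ksumN.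
rewrite ksum_exchange; apply: eq_ksum => s1 s2.
rewrite (vfieldP u).2 addrC addKr; apply: eq_ksum => p1 p2.
transitivity (ksum (fun r1 r2 => (eps r2 : k) *:
   (((p1 * s1) |> factH r1 th z) * vact p2 u (eta (vact s2 v)))) R).
  by apply: eq_ksum => r1 r2; rewrite scalerAr.
rewrite (Rbar_counitR T (f := fun h => ((p1 * s1) |> factH h th z) *
   vact p2 u (eta (vact s2 v)))); last by hlin.
by rewrite factH1 actM.
Qed.


End DualConnection.

(** * The lift of the dual connection on three vector fields *)
Section MetricCompatibility.
Variables (k : comUnitRingType) (H : algType k) (T : triangularHopf H).
Variables (A : algType k) (X : bcModuleAlgebra T A).
Local Notation R := (Rbar T).
Local Notation OX := (Omega X).
Local Notation OO := (atensor T OX OX).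
Implicit Types (u v : vfield X).

Lemma pairing3_lift (N : vfield X -> vfield X -> vfield X) (dnabla : OX -> OO)
    (g : OO) u v z :
  (forall (w : oneform X) v, vlinear (fun u => w (N u v))) ->
  (forall (w : oneform X) u, vlinear (fun v => w (N u v))) ->
  (forall u v (th : oneform X), pairing2 u v (dnabla th) = u (th v) - th (N u v)) ->
  pairing3 u v z (lift_connection dnabla g) = u (pairing2 v z g)
  - ksum (fun r1 r2 => pairing2 (vact r1 v) (N (vact r2 u) z) g) R
  - ksum (fun a1 a2 => ksum (fun r1 r2 => ksum (fun q1 q2 =>
      pairing2 (vact a1 (N (vact r2 u) (vact q2 v))) (vact (a2 * r1 * q1) z) g)
      R) R) R.
Proof.
move=> l1 l2 hd; rewrite /lift_connection /tsum pairing3_sum.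
transitivity (tsum (fun th eta : OX =>
  u (pairing2 v z (atens th eta : OO))
  - ksum (fun r1 r2 => pairing2 (vact r1 v) (N (vact r2 u) z) (atens th eta : OO)) R
  - ksum (fun a1 a2 => ksum (fun r1 r2 => ksum (fun q1 q2 =>
      pairing2 (vact a1 (N (vact r2 u) (vact q2 v))) (vact (a2 * r1 * q1) z)
        (atens th eta : OO)) R) R) R) g).
  apply: eq_bigr => -[th eta] _ /=.
  rewrite pairing3D (lift_left hd) (lift_right hd).
  by rewrite [LHS]addrA; congr (_ - _); rewrite [LHS]addrC addrA subrK.
rewrite /tsum !big_split /= !sumrN; congr (_ - _ - _).
- rewrite pairing2_tsum; symmetry.
  by apply: (big_morph u (klinD (vlin u)) (klin0 (vlin u))).
- rewrite /ksum [LHS]exchange_big; apply: eq_bigr => p _.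
  by rewrite [RHS]pairing2_tsum.
- rewrite /ksum [LHS]exchange_big; apply: eq_bigr => p _.
  rewrite [LHS]exchange_big; apply: eq_bigr => q _.
  rewrite [LHS]exchange_big; apply: eq_bigr => r _.
  by rewrite [RHS]pairing2_tsum.
Qed.

End MetricCompatibility.

(** * The Koszul combination in the group ring of S_3 *)
Section SymmetricGroup.
Variables (W : zmodType) (s1 s2 : W -> W).
Hypotheses (s1D : {morph s1 : x y / x + y}) (s2D : {morph s2 : x y / x + y}).
Hypotheses (s1N : {morph s1 : x / - x}) (s2N : {morph s2 : x / - x}).
Hypotheses (s1K : involutive s1) (s2K : involutive s2).
Hypothesis s12 : forall x, s1 (s2 (s1 x)) = s2 (s1 (s2 x)).

(** The action is written on the left: s2 (s1 F) is F s1 s2. *)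
Definition koszul_comb (G B : W) : W :=
  G - s1 G + s2 (s1 G) - s2 (s1 B) + B + s1 B.

Let s21 x : s2 (s1 (s2 x)) = s1 (s2 (s1 x)). Proof. by rewrite s12. Qed.
Let sE := (s1D, s2D, s1N, s2N, s1K, s2K, s21).

Lemma koszul_comb_solve G B C :
  G = s1 C + s2 (s1 C) -> C - s2 C = B -> s1 (koszul_comb G B) = C + C.
Proof.
(* the permutations below list the twelve terms in cancelling pairs *)
move=> -> <-; rewrite /koszul_comb !sE !opprD !opprK !addrA.
by rewrite [LHS](ACl (1*11*2*7*9*3*8*4*5*10*6*12))%AC /= !addrK.
Qed.

Lemma koszul_comb_metric G B : s2 G = G -> s2 B = - B ->
  let C := s1 (koszul_comb G B) in s1 C + s2 (s1 C) = G + G.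
Proof.
move=> eG eB; rewrite /= /koszul_comb !sE eG eB !addrA.
by rewrite [LHS](ACl (1*7*9*2*3*8*12*4*5*11*6*10))%AC /= !addrK.
Qed.

Lemma koszul_comb_torsion G B : s2 G = G -> s2 B = - B ->
  let C := s1 (koszul_comb G B) in C - s2 C = B + B.
Proof.
move=> eG eB.
have tG : s1 (s2 (s1 G)) = s2 (s1 G) by rewrite s12 eG.
have tB : s1 (s2 (s1 B)) = - s2 (s1 B) by rewrite s12 eB s1N s2N.
rewrite /= /koszul_comb !(s1D, s1N, s1K) tG tB.
rewrite !(s2D, s2N, s2K) eG eB !opprD !opprK !addrA.
by rewrite [LHS](ACl (6*12*1*9*8*2*3*7*4*11*5*10))%AC /= !addrK.
Qed.

End SymmetricGroup.

(** * Trilinear functions and the action of S_3 *)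
Section Trilinear.
Variables (k : comUnitRingType) (H : algType k) (T : triangularHopf H).
Variables (A : algType k) (X : bcModuleAlgebra T A).
Local Notation D := (Delta T).
Local Notation R := (Rbar T).
Local Notation V := (vfield X).
Local Notation "h |> a" := (hopf_act X h a) (at level 38, right associativity).
Implicit Types (u v z : V).

Definition trilinear (F : V -> V -> V -> A) : Prop :=
  [/\ forall v z, vlinear (fun u => F u v z), forall u z, vlinear (fun v => F u v z)
    & forall u v, vlinear (F u v)].

Record tmap := TMap { tfun :> V -> V -> V -> A; tmapP : trilinear tfun }.
HB.instance Definition _ := gen_eqMixin tmap.
HB.instance Definition _ := gen_choiceMixin tmap.
Implicit Types (F G : tmap).

Lemma tmap_eq F G : (forall u v z, F u v z = G u v z) -> F = G.
Proof.
case: F G => F pF [G pG] /= e.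
have {}e : F = G by do 3![apply: funext => ?]; exact: e.
by case: _ / e pG => pG; congr TMap; exact: Prop_irrelevance.
Qed.

Lemma vlinear0 : vlinear (fun _ : V => 0 : A).
Proof. by move=> c u v; rewrite scaler0 addr0. Qed.

Lemma vlinear_add (f g : V -> A) :
  vlinear f -> vlinear g -> vlinear (fun u => f u + g u).
Proof. by move=> lf lg c u v; rewrite lf lg scalerDr addrACA. Qed.

Lemma vlinear_scale (f : V -> A) (c : k) :
  vlinear f -> vlinear (fun u => c *: f u).
Proof. by move=> lf d u v; rewrite lf scalerDr !scalerA [c * d]mulrC. Qed.

Lemma vlinear_opp (f : V -> A) : vlinear f -> vlinear (fun u => - f u).
Proof. by move=> lf c u v; rewrite lf opprD scalerN. Qed.

Lemma vlinear_ksum (M N : lmodType k) (f : M -> N -> V -> A) (t : ktensor M N) :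
  (forall m n, vlinear (f m n)) -> vlinear (fun u => ksum (fun m n => f m n u) t).
Proof.
move=> lf c u v; rewrite ksumZr -ksum_split; apply: eq_ksum => m n; exact: lf.
Qed.

Lemma vlinear_vact (f : V -> A) h : vlinear f -> vlinear (fun u => f (vact h u)).
Proof. by move=> lf c u v; rewrite vactD vactZk lf. Qed.

Fact tzeroP : trilinear (fun _ _ _ => 0).
Proof. by split=> *; exact: vlinear0. Qed.
Definition tzero := TMap tzeroP.

Fact tplusP F G : trilinear (fun u v z => F u v z + G u v z).
Proof.
by case: (tmapP F) (tmapP G) => ? ? ? [? ? ?]; split=> *; apply: vlinear_add.
Qed.
Definition tplus F G := TMap (tplusP F G).

Fact toppP F : trilinear (fun u v z => - F u v z).
Proof. by case: (tmapP F) => ? ? ?; split=> *; apply: vlinear_opp. Qed.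
Definition tneg F := TMap (toppP F).

Fact tscaleP c F : trilinear (fun u v z => c *: F u v z).
Proof. by case: (tmapP F) => ? ? ?; split=> *; apply: vlinear_scale. Qed.
Definition tscale c F := TMap (tscaleP c F).

Fact tplusA : associative tplus.
Proof. by move=> F G I; apply: tmap_eq => u v z /=; rewrite addrA. Qed.
Fact tplusC : commutative tplus.
Proof. by move=> F G; apply: tmap_eq => u v z /=; rewrite addrC. Qed.
Fact tplus0 : left_id tzero tplus.
Proof. by move=> F; apply: tmap_eq => u v z /=; rewrite add0r. Qed.
Fact tplusN : left_inverse tzero tneg tplus.
Proof. by move=> F; apply: tmap_eq => u v z /=; rewrite addNr. Qed.
HB.instance Definition _ :=
  GRing.isZmodule.Build tmap tplusA tplusC tplus0 tplusN.

Fact tscaleA c d F : tscale c (tscale d F) = tscale (c * d) F.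
Proof. by apply: tmap_eq => u v z /=; rewrite scalerA. Qed.
Fact tscale1 : left_id 1 tscale.
Proof. by move=> F; apply: tmap_eq => u v z /=; rewrite scale1r. Qed.
Fact tscaleDr : right_distributive tscale +%R.
Proof. by move=> c F G; apply: tmap_eq => u v z /=; rewrite scalerDr. Qed.
Fact tscaleDl F : {morph tscale^~ F : c d / c + d}.
Proof. by move=> c d; apply: tmap_eq => u v z /=; rewrite scalerDl. Qed.
HB.instance Definition _ := GRing.Zmodule_isLmodule.Build k tmap
  tscaleA tscale1 tscaleDr tscaleDl.

Lemma tmapD F G u v z : (F + G) u v z = F u v z + G u v z. Proof. by []. Qed.
Lemma tmapN F u v z : (- F) u v z = - F u v z. Proof. by []. Qed.
Lemma tmapZ c F u v z : (c *: F) u v z = c *: F u v z. Proof. by []. Qed.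

Section Linearity.
Variables (M : lmodType k) (p : M -> H).
Hypothesis lp : klinear p.
Lemma klin_tmap1 F u v z : klinear (fun m => F (vact (p m) u) v z).
Proof. by case: (tmapP F) => l _ _; exact: (klin_vlin _ (l _ _) lp). Qed.
Lemma klin_tmap2 F u v z : klinear (fun m => F u (vact (p m) v) z).
Proof. by case: (tmapP F) => _ l _; exact: (klin_vlin _ (l _ _) lp). Qed.
Lemma klin_tmap3 F u v z : klinear (fun m => F u v (vact (p m) z)).
Proof. by case: (tmapP F) => _ _ l; exact: (klin_vlin _ (l _ _) lp). Qed.
End Linearity.

Lemma ksum_tmap1 (M N : lmodType k) F (f : M -> N -> V) (t : ktensor M N) v z :
  F (ksum f t) v z = ksum (fun m n => F (f m n) v z) t.
Proof.
by case: (tmapP F) => l _ _;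
  rewrite (map_ksum (h := fun u => F u v z) _ _ (vlinD (l v z))).
Qed.

Lemma ksum_tmap2 (M N : lmodType k) F (f : M -> N -> V) (t : ktensor M N) u z :
  F u (ksum f t) z = ksum (fun m n => F u (f m n) z) t.
Proof.
by case: (tmapP F) => _ l _;
  rewrite (map_ksum (h := fun v => F u v z) _ _ (vlinD (l u z))).
Qed.

Lemma ksum_tmap3 (M N : lmodType k) F (f : M -> N -> V) (t : ktensor M N) u v :
  F u v (ksum f t) = ksum (fun m n => F u v (f m n)) t.
Proof.
by case: (tmapP F) => _ _ l; rewrite (map_ksum _ _ (vlinD (l u v))).
Qed.

Fact swap12P F :
  trilinear (fun u v z => ksum (fun r1 r2 => F (vact r1 v) (vact r2 u) z) R).
Proof.
case: (tmapP F) => l1 l2 l3; split=> [v z|u z|u v]; apply: vlinear_ksum => r1 r2.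
- exact: (vlinear_vact (f := fun u => F _ u z)).
- exact: (vlinear_vact (f := fun u => F u _ z)).
- exact: l3.
Qed.
Definition swap12 F : tmap := TMap (swap12P F).

Fact swap23P F :
  trilinear (fun u v z => ksum (fun r1 r2 => F u (vact r1 z) (vact r2 v)) R).
Proof.
case: (tmapP F) => l1 l2 l3; split=> [v z|u z|u v]; apply: vlinear_ksum => r1 r2.
- exact: l1.
- exact: (vlinear_vact (f := fun v => F u _ v)).
- exact: (vlinear_vact (f := fun v => F u v _)).
Qed.
Definition swap23 F : tmap := TMap (swap23P F).

Lemma swap12E F u v z :
  swap12 F u v z = ksum (fun r1 r2 => F (vact r1 v) (vact r2 u) z) R.
Proof. by []. Qed.

Lemma swap23E F u v z :
  swap23 F u v z = ksum (fun r1 r2 => F u (vact r1 z) (vact r2 v)) R.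
Proof. by []. Qed.

End Trilinear.

Ltac hextra ::= first
  [ apply: klin_pairing2l | apply: klin_pairing2r
  | apply: klin_tmap1 | apply: klin_tmap2 | apply: klin_tmap3
  | apply: klin_sub
  | match goal with l : forall _ _, vlinear _ |- _ =>
      apply: (klin_vlin _ (l _ _)) end ].

(** * Braid relations and braided A-multilinearity *)
Section BraidRelations.
Variables (k : comUnitRingType) (H : algType k) (T : triangularHopf H).
Variables (A : algType k) (X : bcModuleAlgebra T A).
Local Notation D := (Delta T).
Local Notation R := (Rbar T).
Local Notation V := (vfield X).
Local Notation "h |> a" := (hopf_act X h a) (at level 38, right associativity).
Implicit Types (u v z : V) (F G : tmap X).

Lemma swap12D : {morph @swap12 _ _ _ _ X : F G / F + G}.
Proof. by move=> F G; apply: tmap_eq => u v z; exact: ksum_split. Qed.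

Lemma swap12N : {morph @swap12 _ _ _ _ X : F / - F}.
Proof. by move=> F; apply: tmap_eq => u v z; exact: ksumN. Qed.

Lemma swap23D : {morph @swap23 _ _ _ _ X : F G / F + G}.
Proof. by move=> F G; apply: tmap_eq => u v z; exact: ksum_split. Qed.

Lemma swap23N : {morph @swap23 _ _ _ _ X : F / - F}.
Proof. by move=> F; apply: tmap_eq => u v z; exact: ksumN. Qed.

Lemma swap12K : involutive (@swap12 _ _ _ _ X).
Proof.
move=> F; apply: tmap_eq => u v z; rewrite swap12E.
transitivity (ksum (fun s1 s2 => ksum (fun r1 r2 =>
  F (vact (s1 * r2) u) (vact (s2 * r1) v) z) R) R).
  rewrite [RHS]ksum_exchange; apply: eq_ksum => r1 r2; apply: eq_ksum => s1 s2.
  by rewrite !vactM.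
rewrite (sw_Rbar21 T (f := fun x y => F (vact x u) (vact y v) z)); try by hlin.
by rewrite !vact1.
Qed.

Lemma swap23K : involutive (@swap23 _ _ _ _ X).
Proof.
move=> F; apply: tmap_eq => u v z; rewrite swap23E.
transitivity (ksum (fun s1 s2 => ksum (fun r1 r2 =>
  F u (vact (s1 * r2) v) (vact (s2 * r1) z)) R) R).
  rewrite [RHS]ksum_exchange; apply: eq_ksum => r1 r2; apply: eq_ksum => s1 s2.
  by rewrite !vactM.
rewrite (sw_Rbar21 T (f := fun x y => F u (vact x v) (vact y z))); try by hlin.
by rewrite !vact1.
Qed.

Lemma swap_braid F :
  swap12 (swap23 (swap12 F)) = swap23 (swap12 (swap23 F)).
Proof.
apply: tmap_eq => u v z; rewrite swap12E swap23E.
have := Rbar_YB T (f := fun x y w => F (vact x z) (vact y v) (vact w u)).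
move=> YB; transitivity (ksum (fun a1 a2 => ksum (fun b1 b2 => ksum (fun c1 c2 =>
    F (vact (c1 * b1) z) (vact (c2 * a1) v) (vact (b2 * a2) u)) R) R) R).
  by apply: eq_ksum => a1 a2; apply: eq_ksum => b1 b2; apply: eq_ksum => c1 c2;
    rewrite !vactM.
rewrite YB; try by hlin.
by apply: eq_ksum => a1 a2; apply: eq_ksum => b1 b2; apply: eq_ksum => c1 c2;
  rewrite !vactM.
Qed.

(** Braided A-multilinearity: a coefficient b in any slot may be pulled out to
the left of the function, braided with the vector fields that it crosses.
Balancedness over A is then automatic, and right actions need not be
mentioned.  The defects measure the failure in the second and third slot, and
transform into each other under S_3, also for the functions of connections. *)
Definition lin1 F := forall b u v z, F (b *: u) v z = b * F u v z.

Definition lin2 F := forall b u v z, F u (b *: v) z =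
  ksum (fun r1 r2 => (r1 |> b) * F (vact r2 u) v z) R.

Definition defect3 F u v b z : A := F u v (b *: z) -
  ksum (fun r1 r2 => ksum (fun s1 s2 =>
    ((r1 * s1) |> b) * F (vact r2 u) (vact s2 v) z) R) R.

Definition lin3 F := forall b u v z, defect3 F u v b z = 0.

Definition defect2 F u b v z : A := F u (b *: v) z -
  ksum (fun r1 r2 => (r1 |> b) * F (vact r2 u) v z) R.

Lemma defect2_swap23 F u b v z : defect2 (swap23 F) u b v z =
  ksum (fun r1 r2 => ksum (fun s1 s2 =>
    defect3 F u (vact (r1 * s1) z) (r2 |> b) (vact s2 v)) R) R.
Proof.
rewrite /defect2 swap23E.
transitivity (ksum (fun r1 r2 => ksum (fun s1 s2 =>
    F u (vact (r1 * s1) z) ((r2 |> b) *: vact s2 v)) R) R -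
   ksum (fun r1 r2 => ksum (fun s1 s2 => ksum (fun p1 p2 => ksum (fun q1 q2 =>
    ((p1 * q1) |> r2 |> b) * F (vact p2 u) (vact (q2 * (r1 * s1)) z) (vact s2 v))
      R) R) R) R); last first.
  rewrite -ksumN -ksum_split; apply: eq_ksum => r1 r2.
  rewrite -ksumN -ksum_split; apply: eq_ksum => s1 s2.
  rewrite /defect3; congr (_ - _).
  by apply: eq_ksum => p1 p2; apply: eq_ksum => q1 q2; rewrite [vact (q2 * _) _]vactM.
congr (_ - _).
  transitivity (ksum (fun r1 r2 => ksum (fun x y =>
     F u (vact r1 z) ((x |> b) *: vact y v)) (D r2)) R).
    by apply: eq_ksum => r1 r2; rewrite vactZ ksum_tmap3.
  case: (tmapP F) => _ _ lF.
  rewrite (sw_RD2 T (f := fun r x y => F u (vact r z) ((x |> b) *: vact y v))) //.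
  - by hlin.
  - move=> r y c p q; rewrite (act_linear X b) scalerDl -lF; congr (F _ _ (_ + _)).
    by rewrite scalerA -scalerAl mul1r.
  - move=> r x c p q; rewrite (vact_linp v c p q (@klin_id _ _)) scalerDr.
    rewrite -lF; congr (F _ _ (_ + _)); rewrite !scalerA.
    by rewrite -scalerAr mulr1 -scalerAl mul1r.
rewrite [RHS]ksum_exchange.
transitivity (ksum (fun p1 p2 => ksum (fun s1 s2 =>
   (p1 |> b) * F (vact p2 u) (vact s1 z) (vact s2 v)) R) R).
  by apply: eq_ksum => p1 p2; rewrite swap23E ksum_mulr.
rewrite ksum_exchange; apply: eq_ksum => s1 s2.
rewrite [RHS]ksum_exchange; apply: eq_ksum => p1 p2.
transitivity (ksum (fun q1 q2 => ksum (fun r1 r2 =>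
   ((p1 * (q1 * r2)) |> b) * F (vact p2 u) (vact (q2 * r1 * s1) z) (vact s2 v)) R) R).
  rewrite (sw_Rbar21 T (f := fun x y => ((p1 * x) |> b) *
     F (vact p2 u) (vact (y * s1) z) (vact s2 v))); try by hlin.
  by rewrite mulr1 mul1r.
rewrite ksum_exchange; apply: eq_ksum => r1 r2; apply: eq_ksum => q1 q2.
by rewrite -!actM !mulrA.
Qed.

Lemma defect3_swap12 F u v b z : defect3 (swap12 F) u v b z =
  ksum (fun r1 r2 => defect3 F (vact r1 v) (vact r2 u) b z) R.
Proof.
rewrite /defect3 ksum_split ksumN swap12E; congr (_ - _).
transitivity (ksum (fun t1 t2 => ksum (fun x y => ksum (fun r1 r2 =>
   (t1 |> b) * F (vact (r1 * y) v) (vact (r2 * x) u) z) R) (D t2)) R).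
  rewrite (sw_RD2 T (f := fun t x y => ksum (fun r1 r2 =>
    (t |> b) * F (vact (r1 * y) v) (vact (r2 * x) u) z) R)); try by hlin.
  apply: eq_ksum => r1 r2; apply: eq_ksum => s1 s2; rewrite swap12E ksum_mulr.
  by apply: eq_ksum => p1 p2; rewrite !vactM.
transitivity (ksum (fun t1 t2 => ksum (fun x y => ksum (fun r1 r2 =>
   (t1 |> b) * F (vact (x * r1) v) (vact (y * r2) u) z) R) (D t2)) R).
  apply: eq_ksum => t1 t2.
  rewrite (sw_Rcop T (f := fun x y => (t1 |> b) * F (vact x v) (vact y u) z));
    try by hlin.
  by rewrite ksum_exchange.
rewrite (sw_RD2 T (f := fun t x y => ksum (fun r1 r2 =>
    (t |> b) * F (vact (x * r1) v) (vact (y * r2) u) z) R)); try by hlin.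
rewrite [RHS]ksum_exchange; apply: eq_ksum => s1 s2.
rewrite [RHS]ksum_exchange; apply: eq_ksum => q1 q2.
by apply: eq_ksum => r1 r2; rewrite !vactM.
Qed.

Lemma lin2_swap12 F : lin1 F -> lin2 (swap12 F).
Proof.
move=> F1 b u v z; rewrite swap12E.
transitivity (ksum (fun r1 r2 => ksum (fun x y =>
  (x |> b) * F (vact y v) (vact r2 u) z) (D r1)) R).
  apply: eq_ksum => r1 r2; rewrite vactZ ksum_tmap1; apply: eq_ksum => x y.
  exact: F1.
rewrite (sw_RD1 T (f := fun x y r => (x |> b) * F (vact y v) (vact r u) z));
  try by hlin.
rewrite ksum_exchange; apply: eq_ksum => s1 s2; rewrite swap12E ksum_mulr.
by apply: eq_ksum => r1 r2; rewrite vactM.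
Qed.

Lemma lin1_swap12 F : lin2 F -> lin1 (swap12 F).
Proof.
move=> F2 b u v z; rewrite swap12E.
transitivity (ksum (fun r1 r2 => ksum (fun x y => ksum (fun t1 t2 =>
  ((t1 * x) |> b) * F (vact (t2 * r1) v) (vact y u) z) R) (D r2)) R).
  apply: eq_ksum => r1 r2; rewrite vactZ ksum_tmap2; apply: eq_ksum => x y.
  by rewrite F2; apply: eq_ksum => t1 t2; rewrite actM vactM.
rewrite (sw_RD2 T (f := fun r x y => ksum (fun t1 t2 =>
  ((t1 * x) |> b) * F (vact (t2 * r) v) (vact y u) z) R)); try by hlin.
rewrite ksum_exchange swap12E ksum_mulr; apply: eq_ksum => s1 s2.
rewrite ksum_exchange.
transitivity (ksum (fun t1 t2 => ksum (fun r1 r2 =>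
  ((t1 * r2) |> b) * F (vact (t2 * r1 * s1) v) (vact s2 u) z) R) R).
  by apply: eq_ksum => t1 t2; apply: eq_ksum => r1 r2; rewrite !mulrA.
rewrite (sw_Rbar21 T (f := fun x y =>
  (x |> b) * F (vact (y * s1) v) (vact s2 u) z)); try by hlin.
by rewrite mul1r act1.
Qed.

Lemma lin3_swap12 F : lin3 F -> lin3 (swap12 F).
Proof.
move=> F3 b u v z; rewrite defect3_swap12; apply: big1 => r _; exact: F3.
Qed.

Lemma lin1_swap23 F : lin1 F -> lin1 (swap23 F).
Proof.
by move=> F1 b u v z; rewrite !swap23E ksum_mulr; apply: eq_ksum => r1 r2.
Qed.

Lemma lin2P F : lin2 F <-> forall b u v z, defect2 F u b v z = 0.
Proof.
split=> F2 b u v z; first by rewrite /defect2 F2 subrr.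
by apply/eqP; rewrite -subr_eq0; apply/eqP/F2.
Qed.

Lemma lin2_swap23 F : lin3 F -> lin2 (swap23 F).
Proof.
move=> F3; apply/lin2P => b u v z; rewrite defect2_swap23.
by apply: big1 => r _; apply: big1 => s _; exact: F3.
Qed.

Lemma lin3_swap23 F : lin2 F -> lin3 (swap23 F).
Proof.
move=> F2 b u v z; apply/eqP; rewrite subr_eq0; apply/eqP; rewrite swap23E.
transitivity (ksum (fun r1 r2 => ksum (fun x y => ksum (fun p1 p2 =>
  ((p1 * x) |> b) * F (vact p2 u) (vact y z) (vact r2 v)) R) (D r1)) R).
  apply: eq_ksum => r1 r2; rewrite vactZ ksum_tmap2; apply: eq_ksum => x y.
  by rewrite F2; apply: eq_ksum => p1 p2; rewrite actM.
rewrite (sw_RD1 T (f := fun x y r => ksum (fun p1 p2 =>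
  ((p1 * x) |> b) * F (vact p2 u) (vact y z) (vact r v)) R)); try by hlin.
rewrite [RHS]ksum_exchange [LHS]ksum_exchange; apply: eq_ksum => s1 s2.
rewrite [LHS]ksum_exchange; apply: eq_ksum => p1 p2.
rewrite swap23E ksum_mulr; apply: eq_ksum => r1 r2.
by rewrite vactM.
Qed.

End BraidRelations.

(** * Connections as covariant derivatives *)
Section Connections.
Variables (k : comUnitRingType) (H : algType k) (T : triangularHopf H).
Variables (A : algType k) (X : bcModuleAlgebra T A).
Local Notation D := (Delta T).
Local Notation R := (Rbar T).
Local Notation V := (vfield X).
Local Notation VX := (Xfields X).
Local Notation OX := (Omega X).
Local Notation OO := (atensor T OX OX).
Local Notation OV := (atensor T OX VX).
Local Notation "h |> a" := (hopf_act X h a) (at level 38, right associativity).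
Implicit Types (u v : V) (th : oneform X).

(** The properties that characterise (u, v) |-> nabla_u v; no tensor product
over A is involved. *)
Definition covariant (N : V -> V -> V) : Prop :=
  [/\ forall a u u' v, N (a *: u + u') v = a *: N u v + N u' v,
      forall u v v', N u (v + v') = N u v + N u v'
    & forall a u v, N u (a *: v) = u a *: v + N (vactr u a) v].

Lemma covariant0 N v : covariant N -> N 0 v = 0.
Proof.
case=> Nl _ _; apply: (addrI (N 0 v)).
by have := Nl 1 0 0 v; rewrite !scale1r !addr0 => <-.
Qed.

Lemma vfield1 u : u 1 = 0.
Proof.
by have := vfieldM u 1 1; rewrite !mulr1 vactr1 -{1}[u 1]addr0 => /addrI.
Qed.

Lemma atens_lact_balancedV a : balanced (@ract H A OX) (@lact H A VX)
  (fun (m : OX) (n : VX) => atens (lact a m) n).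
Proof.
split=> [m m' n|m n n'|m b n].
- by rewrite -atensDl; congr atens; exact: factlDr.
- exact: atensDr.
- rewrite -(balS (atens_balanced OX VX)); congr atens.
  exact: form_eq.
Qed.

Lemma contr_lact u a (t : OV) : contr u (lact a t) = contr (vactr u a) t.
Proof.
elim/tensor_ind: t => [|th v|t t' IH IH'].
- by rewrite [lact _ _](tsum0 (atens_lact_balancedV a)) !contr0.
- rewrite [lact _ _](tsum_tens (atens_lact_balancedV a)) -[tens th v]/(atens th v).
  by rewrite !contr_tens.
- by rewrite [lact _ _](tsumD (atens_lact_balancedV a)) !contrD IH IH'.
Qed.

Lemma covder_covariant (nabla : VX -> OV) :
  is_left_connection nabla -> covariant (covder nabla).
Proof.
case=> nD _ nZ; split=> [a u u' v|u v v'|a u v].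
- exact: contr_lin.
- by rewrite -[LHS]/(contr u (nabla (v + v'))) nD contrD.
- by rewrite -[LHS]/(contr u (nabla (a *: v))) nZ contrD contr_tens contr_lact.
Qed.

Section Exists.
Variables (n : nat) (e : 'I_n -> V) (w : 'I_n -> oneform X).
Hypothesis ew : dual_basis e w.

Lemma contr_surj (f : V -> V) :
  (forall a u u', f (a *: u + u') = a *: f u + f u') ->
  forall u, contr u (\sum_i atens (w i : OX) (f (e i) : VX) : OV) = f u.
Proof.
move=> lf u; have fD x y : f (x + y) = f x + f y.
  by have := lf 1 x y; rewrite !scale1r.
have f0 : f 0 = 0 by apply: (addrI (f 0)); rewrite -fD !addr0.
rewrite contr_sum {2}[u]ew (big_morph f fD f0); apply: eq_bigr => i _.
by rewrite contr_tens -[w i u *: e i]addr0 lf f0 addr0.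
Qed.

(** With a dual basis, nabla v is the sum of the w^i (x) nabla_{e_i} v. *)
Lemma connection_of_covariant (N : V -> V -> V) : covariant N ->
  exists2 nabla : VX -> OV, is_left_connection nabla & forall u v, covder nabla u v = N u v.
Proof.
case=> Nl ND NZ; pose nabla (v : VX) : OV := \sum_i atens (w i : OX) (N (e i) v : VX).
have nE u v : contr u (nabla v) = N u v by apply: (contr_surj (f := N^~ v)).
exists nabla => //; split=> [u v|c v|a v]; apply: (contr_inj ew) => u'.
- by rewrite contrD !nE ND.
- rewrite contr_lact !nE NZ (_ : u' c%:A = 0) ?scale0r ?add0r //.
  by rewrite (klinZ _ _ (vlin u')) vfield1 scaler0.
- by rewrite contrD contr_lact contr_tens !nE NZ.
Qed.

Lemma connection_ext (nabla nabla' : VX -> OV) :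
  (forall u v, covder nabla u v = covder nabla' u v) -> nabla = nabla'.
Proof.
by move=> h; apply: funext => v; apply: (contr_inj ew) => u; exact: h.
Qed.

(** The covariant derivative of the sum of the d(w^i(v)) (x) e_i, the connection
that projects the trivial one of a free module. *)
Lemma grassmann_covariant : covariant (fun u v => \sum_i u (w i v) *: e i).
Proof.
split=> [a u u' v|u v v'|a u v].
- rewrite scaler_sumr -big_split; apply: eq_bigr => i _ /=.
  by rewrite scalerDl scalerA.
- rewrite -big_split; apply: eq_bigr => i _ /=.
  by rewrite formD (klinD (vlin u)) scalerDl.
- rewrite {2}[v]ew scaler_sumr -big_split; apply: eq_bigr => i _ /=.
  by rewrite formZ vfieldM scalerDl scalerA.
Qed.

Section Dual.
Variable nabla : VX -> OV.

(** Duality evaluated on a vector field u: since the dual connection pairs with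
u and v only, it is the difference of the Lie derivative and of nabla. *)
Lemma dual_connectionP (dnabla : OX -> OO) : is_dual_connection nabla dnabla <->
  forall u v th, pairing2 u v (dnabla th) = u (th v) - th (covder nabla u v).
Proof.
have E u v th : (tsum (fun (eta : OX) (w' : VX) => ract eta ((th : oneform X) w'))
    (nabla v) : oneform X) u = th (covder nabla u v).
  rewrite form_sumE form_sum; apply: eq_bigr => p _ /=.
  by rewrite formZ.
split=> [hd u v th|hd v th].
  have := congr1 (fun f : oneform X => f u) (hd v th).
  rewrite [LHS]/= => ->; rewrite -[X in _ = X - _]/((_ : oneform X) u + (_ : oneform X) u).
  by rewrite E addrC addKr.
apply: form_eq => u; rewrite -[RHS]/((_ : oneform X) u + (_ : oneform X) u) E.
by rewrite -[X in _ + X]/(pairing2 u v (dnabla th)) hd addrC subrK.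
Qed.

(** Pairings with elements of Omega (x)_A Omega are exactly the A-balanced, left
A-linear forms on pairs of vector fields. *)
Lemma flat_surj (Phi : V -> V -> A) :
  (forall v a u u', Phi (a *: u + u') v = a * Phi u v + Phi u' v) ->
  (forall u v v', Phi u (v + v') = Phi u v + Phi u v') ->
  (forall u a v, Phi u (a *: v) = Phi (vactr u a) v) ->
  exists t : OO, forall u v, pairing2 u v t = Phi u v.
Proof.
move=> Pl PD PZ; exists (\sum_i atens (w i : OX) (OneForm (Pl (e i)) : OX)) => u v.
have P0 : Phi u 0 = 0 by apply: (addrI (Phi u 0)); rewrite -PD !addr0.
rewrite pairing2_sum {2}[v]ew (big_morph (Phi u) (PD u) P0).
by apply: eq_bigr => i _; rewrite pairing2_tens PZ.
Qed.

Hypothesis cn : is_left_connection nabla.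

Lemma dual_connection_exists : exists dnabla, is_dual_connection nabla dnabla.
Proof.
case: (covder_covariant cn) => Nl ND NZ.
have ex th : exists t : OO, forall u v,
    pairing2 u v t = u (th v) - th (covder nabla u v).
  apply: flat_surj => [v a u u'|u v v'|u a v].
  - by rewrite Nl formP mulrBr vfunD vfunZ opprD addrACA.
  - by rewrite ND !formD (klinD (vlin u)) opprD addrACA.
  - rewrite NZ formD !formZ vfieldM opprD addrACA.
    by rewrite subrr add0r.
have [dn hd] := choice ex.
by exists dn; apply/dual_connectionP => u v th; exact: hd.
Qed.

End Dual.
End Exists.
End Connections.

(** * Torsion and metric compatibility as equations under S_3 *)
Section KoszulEquations.
Variables (k : comUnitRingType) (H : algType k) (T : triangularHopf H).
Variables (A : algType k) (X : bcModuleAlgebra T A).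
Local Notation D := (Delta T).
Local Notation R := (Rbar T).
Local Notation V := (vfield X).
Local Notation VX := (Xfields X).
Local Notation OX := (Omega X).
Local Notation OO := (atensor T OX OX).
Local Notation OV := (atensor T OX VX).
Local Notation "h |> a" := (hopf_act X h a) (at level 38, right associativity).
Implicit Types (u v z w : V).
Variable g : OO.

Fact lie_trilinear : trilinear (fun u v z => u (pairing2 v z g)).
Proof.
split=> [v z c u u'|u z c v v'|u v c z z'].
- by rewrite vfunD scalek.
- by rewrite vlin_pairing2l vlin.
- by rewrite vlin_pairing2r vlin.
Qed.
Definition lie_map : tmap X := TMap lie_trilinear.

Lemma pairing2_vlinr (f : V -> V) u :
  (forall (c : k) v v', f (c%:A *: v + v') = c%:A *: f v + f v') ->
  vlinear (fun v => pairing2 u (f v) g).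
Proof. by move=> lf c v v'; rewrite lf vlin_pairing2r. Qed.

Lemma bracket_vlinl v (c : k) u u' :
  bracket (c%:A *: u + u') v = c%:A *: bracket u v + bracket u' v.
Proof.
by apply: vfield_eq => a; rewrite vlin_bracketl vfunD scalek.
Qed.

Lemma bracket_vlinr u (c : k) v v' :
  bracket u (c%:A *: v + v') = c%:A *: bracket u v + bracket u v'.
Proof.
by apply: vfield_eq => a; rewrite vlin_bracketr vfunD scalek.
Qed.

Fact bracket_trilinear : trilinear (fun w u v => pairing2 w (bracket u v) g).
Proof.
split=> [u v|w v|w u]; first exact: vlin_pairing2l.
- by apply: (pairing2_vlinr (f := fun u => bracket u v)) => c u u'; rewrite bracket_vlinl.
- by apply: pairing2_vlinr => c v v'; rewrite bracket_vlinr.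
Qed.
Definition bracket_map : tmap X := TMap bracket_trilinear.

Section Christoffel.
Variables (N : V -> V -> V) (cN : covariant N).

Lemma covariant_vlinl v (c : k) u u' :
  N (c%:A *: u + u') v = c%:A *: N u v + N u' v.
Proof. by case: cN => Nl _ _; rewrite Nl. Qed.

Lemma covariant_vlinr u (c : k) v v' :
  N u (c%:A *: v + v') = c%:A *: N u v + N u v'.
Proof.
case: cN => Nl ND NZ; rewrite ND NZ (klinZ _ _ (vlin u)) vfield1 scaler0 scale0r add0r.
by rewrite vactrk -[c%:A *: u]addr0 Nl covariant0 ?addr0 //.
Qed.

Fact christoffel_trilinear : trilinear (fun w u v => pairing2 w (N u v) g).
Proof.
split=> [u v|w v|w u]; first exact: vlin_pairing2l.
- by apply: (pairing2_vlinr (f := fun u => N u v)) => c u u'; rewrite covariant_vlinl.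
- by apply: pairing2_vlinr => c v v'; rewrite covariant_vlinr.
Qed.
Definition christoffel : tmap X := TMap christoffel_trilinear.

End Christoffel.

Hypothesis gsym : braid g = g.

Lemma pairing2_sym u v :
  pairing2 u v g = ksum (fun r1 r2 => pairing2 (vact r1 v) (vact r2 u) g) R.
Proof. by rewrite -pairing2_braid gsym. Qed.

Lemma lie_map_sym : swap23 lie_map = lie_map.
Proof.
apply: tmap_eq => u v z; rewrite swap23E [RHS]/= pairing2_sym ksum_vfun.
by [].
Qed.

Lemma pairing2N u v : pairing2 u (- v) g = - pairing2 u v g.
Proof.
apply: (addrI (pairing2 u v g)); rewrite -pairing2Dr !subrr.
exact: (vlin0 (vlin_pairing2r u g)).
Qed.

Lemma bracket_map_anti : swap23 bracket_map = - bracket_map.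
Proof.
apply: tmap_eq => w u v; rewrite swap23E tmapN /=.
rewrite -[RHS](_ : pairing2 w (- bracket u v) g = _); last first.
  exact: pairing2N.
rewrite -bracket_anti.
by rewrite (map_ksum (h := fun v => pairing2 w v g) _ _ (fun v v' => pairing2Dr w v v' g)).
Qed.

(** By symmetry of g and equivariance of the bracket, <[u,v] (x) z, g> is the
value at (u,v,z) of B s1 s2; the last term of the Koszul expression is then
B s1 s2 s2 = B s1. *)
Lemma koszulE u v z :
  koszul g u v z =
  koszul_comb (@swap12 _ _ _ _ X) (@swap23 _ _ _ _ X) lie_map bracket_map u v z.
Proof.
have E u' v' z' : swap23 (swap12 bracket_map) u' v' z' = pairing2 (bracket u' v') z' g.
  rewrite pairing2_sym swap23E.
  transitivity (ksum (fun r1 r2 => ksum (fun x y => pairing2 (vact r1 z')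
      (bracket (vact x u') (vact y v')) g) (D r2)) R).
    rewrite (sw_RD2 T (f := fun r x y => pairing2 (vact r z')
      (bracket (vact x u') (vact y v')) g)); last 3 first.
    - by hlin.
    - move=> p q; have := @klin_tmap2 _ _ _ _ X _ _ (@klin_id _ H) bracket_map
        (vact p z') u' (vact q v').
      exact.
    - move=> p q; have := @klin_tmap3 _ _ _ _ X _ _ (@klin_id _ H) bracket_map
        (vact p z') (vact q u') v'.
      exact.
    rewrite [RHS]ksum_exchange; apply: eq_ksum => s1 s2; rewrite swap12E.
    by apply: eq_ksum => r1 r2; rewrite vactM.
  apply: eq_ksum => r1 r2; rewrite vact_bracket.
  by rewrite (map_ksum (h := fun v => pairing2 _ v g) _ _ (fun v v' => pairing2Dr _ v v' g)).
rewrite /koszul /koszul_comb !(tmapD, tmapN) E; congr (_ - _ + _ - _ + _ + _).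
- rewrite swap23E [LHS]ksum_exchange; apply: eq_ksum => s1 s2.
  by rewrite swap12E; apply: eq_ksum => r1 r2; rewrite vactM.
- rewrite -[swap12 bracket_map]swap23K [RHS]swap23E.
  by apply: eq_ksum => r1 r2; rewrite E.
Qed.

Section Equations.
Variables (n : nat) (e : 'I_n -> V) (w : 'I_n -> oneform X).
Hypothesis ew : dual_basis e w.
Variables (nabla : VX -> OV) (cn : is_left_connection nabla).
Local Notation N := (covder nabla).
Local Notation Gam := (christoffel (covder_covariant cn)).

(** In pairing3_lift the third term has the value of nabla on the left; by
symmetry of g it moves to the right, back to where R^a sent z. *)
Lemma metric_compatibleP : metric_compatible g nabla <->
  lie_map = swap12 Gam + swap23 (swap12 Gam).
Proof.
have E dnabla u v z : is_dual_connection nabla dnabla ->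
    pairing3 u v z (lift_connection dnabla g) =
    lie_map u v z - swap12 Gam u v z - swap23 (swap12 Gam) u v z.
  move=> /dual_connectionP hd; rewrite (pairing3_lift _ _ _ _ _ _ hd); last 2 first.
  - by move=> th v' c u1 u2; rewrite covariant_vlinl ?vlin_form //; exact: covder_covariant.
  - by move=> th u' c v1 v2; rewrite covariant_vlinr ?vlin_form //; exact: covder_covariant.
  congr (_ - _ - _); rewrite swap23E.
  transitivity (ksum (fun r1 r2 => ksum (fun q1 q2 =>
      pairing2 (vact (r1 * q1) z) (N (vact r2 u) (vact q2 v)) g) R) R).
    rewrite ksum_exchange; apply: eq_ksum => r1 r2.
    rewrite ksum_exchange; apply: eq_ksum => q1 q2.
    rewrite [RHS]pairing2_sym; apply: eq_ksum => a1 a2.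
    by rewrite -vactM mulrA.
  rewrite [LHS]ksum_exchange; apply: eq_ksum => q1 q2; rewrite swap12E.
  by apply: eq_ksum => r1 r2; rewrite vactM.
split=> [[dn hd l0]|mc].
  apply: tmap_eq => u v z; apply/eqP; rewrite -subr_eq0 tmapD opprD addrA.
  by rewrite -(E dn) // l0 pairing30.
have [dn hd] := dual_connection_exists ew cn; exists dn => //.
apply: (pairing3_inj ew) => u v z; rewrite pairing30 E // mc tmapD.
by rewrite -addrA -opprD subrr.
Qed.

Lemma torsion_freeP : bijective (flat g) ->
  torsion_free nabla <-> Gam - swap23 Gam = bracket_map.
Proof.
move=> /bij_inj ginj.
have E u v z : (Gam - swap23 Gam - bracket_map) z u v =
   pairing2 z (N u v - ksum (fun r1 r2 => N (vact r1 v) (vact r2 u)) R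
     - bracket u v) g.
  rewrite !(tmapD, tmapN) swap23E !pairing2Dr !pairing2N.
  congr (_ - _ - _).
  by rewrite (map_ksum (h := fun v => pairing2 z v g) _ _ (fun v v' => pairing2Dr z v v' g)).
split=> [tf|tf u v].
  apply/eqP; rewrite -subr_eq0; apply/eqP/tmap_eq => z u v; rewrite E tf.
  exact: (vlin0 (vlin_pairing2r z g)).
apply: ginj; apply: form_eq => z; rewrite -[LHS]/(pairing2 z _ g) -E tf subrr.
exact/esym/(vlin0 (vlin_pairing2r z g)).
Qed.

End Equations.
End KoszulEquations.

(** * Stability of braided A-multilinearity *)
Section Tensors.
Variables (k : comUnitRingType) (H : algType k) (T : triangularHopf H).
Variables (A : algType k) (X : bcModuleAlgebra T A).
Local Notation R := (Rbar T).
Local Notation V := (vfield X).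
Local Notation "h |> a" := (hopf_act X h a) (at level 38, right associativity).
Implicit Types (u v z : V) (F G : tmap X).

Definition tensorial F := [/\ lin1 F, lin2 F & lin3 F].

Lemma defect2D F G u b v z :
  defect2 (F + G) u b v z = defect2 F u b v z + defect2 G u b v z.
Proof.
rewrite /defect2 tmapD addrACA -opprD -ksum_split; congr (_ - _).
by apply: eq_ksum => r1 r2; rewrite tmapD mulrDr.
Qed.

Lemma defect3D F G u v b z :
  defect3 (F + G) u v b z = defect3 F u v b z + defect3 G u v b z.
Proof.
rewrite /defect3 tmapD addrACA -opprD -ksum_split; congr (_ - _).
apply: eq_ksum => r1 r2; rewrite -ksum_split; apply: eq_ksum => s1 s2.
by rewrite tmapD mulrDr.
Qed.

Lemma defect2Z c F u b v z : defect2 (c *: F) u b v z = c *: defect2 F u b v z.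
Proof.
rewrite /defect2 tmapZ scalerBr ksumZr; congr (_ - _).
by apply: eq_ksum => r1 r2; rewrite tmapZ -scalerAr.
Qed.

Lemma defect3Z c F u v b z : defect3 (c *: F) u v b z = c *: defect3 F u v b z.
Proof.
rewrite /defect3 tmapZ scalerBr ksumZr; congr (_ - _).
apply: eq_ksum => r1 r2; rewrite ksumZr; apply: eq_ksum => s1 s2.
by rewrite tmapZ -scalerAr.
Qed.

Lemma tensorialD F G : tensorial F -> tensorial G -> tensorial (F + G).
Proof.
case=> F1 /lin2P F2 F3 [G1 /lin2P G2 G3]; split.
- by move=> b u v z; rewrite !tmapD F1 G1 mulrDr.
- by apply/lin2P => b u v z; rewrite defect2D F2 G2 addr0.
- by move=> b u v z; rewrite defect3D F3 G3 addr0.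
Qed.

Lemma tensorialZ c F : tensorial F -> tensorial (c *: F).
Proof.
case=> F1 /lin2P F2 F3; split.
- by move=> b u v z; rewrite !tmapZ F1 scalerAr.
- by apply/lin2P => b u v z; rewrite defect2Z F2 scaler0.
- by move=> b u v z; rewrite defect3Z F3 scaler0.
Qed.

Lemma tensorialN F : tensorial F -> tensorial (- F).
Proof. by rewrite -scaleN1r; exact: tensorialZ. Qed.

Lemma tensorial_swap12 F : tensorial F -> tensorial (swap12 F).
Proof.
by case=> F1 F2 F3; split; [exact: lin1_swap12|exact: lin2_swap12|exact: lin3_swap12].
Qed.

Lemma tensorial_swap23 F : tensorial F -> tensorial (swap23 F).
Proof.
by case=> F1 F2 F3; split; [exact: lin1_swap23|exact: lin2_swap23|exact: lin3_swap23].
Qed.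

Lemma tensorial_koszul F G : tensorial F -> tensorial G ->
  tensorial (koszul_comb (@swap12 _ _ _ _ X) (@swap23 _ _ _ _ X) F G).
Proof.
move=> tF tG; rewrite /koszul_comb.
do ?[apply: tensorialD | apply: tensorialN | apply: tensorial_swap12
    | apply: tensorial_swap23 | by []].
Qed.

Lemma swap12Z c F : swap12 (c *: F) = c *: swap12 F.
Proof.
apply: tmap_eq => u v z; rewrite tmapZ !swap12E ksumZr.
by apply: eq_ksum.
Qed.

Lemma swap23Z c F : swap23 (c *: F) = c *: swap23 F.
Proof.
apply: tmap_eq => u v z; rewrite tmapZ !swap23E ksumZr.
by apply: eq_ksum.
Qed.

End Tensors.

(** * Existence: correcting a connection by its contorsion *)
Section Existence.
Variables (k : comUnitRingType) (H : algType k) (T : triangularHopf H).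
Variables (A : algType k) (X : bcModuleAlgebra T A).
Local Notation D := (Delta T).
Local Notation R := (Rbar T).
Local Notation V := (vfield X).
Local Notation VX := (Xfields X).
Local Notation OX := (Omega X).
Local Notation OO := (atensor T OX OX).
Local Notation OV := (atensor T OX VX).
Local Notation "h |> a" := (hopf_act X h a) (at level 38, right associativity).
Implicit Types (u v z w : V).
Variables (g : OO) (gsym : braid g = g).
Variables (N : V -> V -> V) (cN : covariant N).
Local Notation Gam := (christoffel g cN).
Local Notation s1 := (@swap12 _ _ _ _ X).
Local Notation s2 := (@swap23 _ _ _ _ X).

Lemma christoffel_lin1 : lin1 Gam.
Proof. by move=> b w u v; exact: pairing2Zl. Qed.

Lemma christoffel_lin2 : lin2 Gam.
Proof.
move=> b w u v /=; case: cN => Nl _ _.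
by rewrite -[b *: u]addr0 Nl covariant0 ?addr0 // pairing2ZrR.
Qed.

(** The defect is the inhomogeneous term of the Leibniz rule; it depends on the
metric only, and the bracket has the same one. *)
Lemma christoffel_defect3 b w u v : defect3 Gam w u b v =
  ksum (fun r1 r2 => (r1 |> u b) * pairing2 (vact r2 w) v g) R.
Proof.
rewrite /defect3 /=; case: (cN) => Nl _ NZ.
rewrite NZ pairing2Dr pairing2ZrR -[RHS]addr0 -addrA; congr (_ + _).
apply/eqP; rewrite subr_eq0; apply/eqP.
have ND x y : N (x + y) v = N x v + N y v by rewrite -{1}[x]scale1r Nl scale1r.
rewrite (map_ksum (h := N^~ v) _ _ ND).
rewrite (map_ksum (h := fun v => pairing2 w v g) _ _ (fun v v' => pairing2Dr w v v' g)).
rewrite [RHS]ksum_exchange; apply: eq_ksum => s1 s2.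
rewrite -[_ *: _]addr0 Nl covariant0 ?addr0 // pairing2ZrR.
by apply: eq_ksum => r1 r2; rewrite actM.
Qed.

Lemma bracket_map_defect3 b w u v : defect3 (bracket_map g) w u b v =
  ksum (fun r1 r2 => (r1 |> u b) * pairing2 (vact r2 w) v g) R.
Proof.
rewrite /defect3 /= bracketZ pairing2Dr pairing2ZrR -[RHS]addr0 -addrA; congr (_ + _).
apply/eqP; rewrite subr_eq0; apply/eqP.
rewrite (map_ksum (h := fun v => pairing2 w v g) _ _ (fun v v' => pairing2Dr w v v' g)).
rewrite [RHS]ksum_exchange; apply: eq_ksum => s1 s2; rewrite pairing2ZrR.
by apply: eq_ksum => r1 r2; rewrite actM.
Qed.

(** Minus the torsion of N, lowered with g. *)
Definition torsion_map : tmap X := bracket_map g - (Gam - s2 Gam).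

Definition metricity_map : tmap X := lie_map g - (s1 Gam + s2 (s1 Gam)).

Lemma torsion_map_anti : s2 torsion_map = - torsion_map.
Proof.
rewrite /torsion_map !(swap23D, swap23N) (bracket_map_anti g) swap23K.
by rewrite opprB [RHS]opprB addrC.
Qed.

Lemma metricity_map_sym : s2 metricity_map = metricity_map.
Proof.
rewrite /metricity_map !(swap23D, swap23N) (lie_map_sym gsym) swap23K.
by rewrite [s2 _ + _]addrC.
Qed.

Lemma defect3N (F : tmap X) u v b z : defect3 (- F) u v b z = - defect3 F u v b z.
Proof. by rewrite -scaleN1r defect3Z scaleN1r. Qed.

Lemma defect2N (F : tmap X) u v b z : defect2 (- F) u b v z = - defect2 F u b v z.
Proof. by rewrite -scaleN1r defect2Z scaleN1r. Qed.

(** In the third slot the Leibniz terms of nabla_u v and [u,v] cancel, while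
nabla is A-linear in its direction.  The second slot follows by
antisymmetry. *)
Lemma tensorial_torsion : tensorial torsion_map.
Proof.
have l1 : lin1 torsion_map.
  move=> b u v z; rewrite /torsion_map !(tmapD, tmapN).
  rewrite christoffel_lin1 (lin1_swap23 christoffel_lin1) /= pairing2Zl.
  by rewrite -mulrBr -mulrBr.
have l3 : lin3 torsion_map.
  move=> b u v z; rewrite /torsion_map !(defect3D, defect3N).
  rewrite (lin3_swap23 christoffel_lin2) bracket_map_defect3 christoffel_defect3.
  by rewrite oppr0 addr0 subrr.
split=> //; rewrite -[torsion_map]opprK -torsion_map_anti.
apply/lin2P => b u v z; rewrite defect2N.
by move/lin2P: (lin2_swap23 l3) => ->; rewrite oppr0.
Qed.

(** The defect of christoffel in its third slot is transported by s1 s2 to the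
second one, where it matches the Leibniz term of u<b v (x) z, g>. *)
Lemma swap_christoffel_defect2 b u v z :
  defect2 (s2 (s1 Gam)) u b v z = u b * pairing2 v z g.
Proof.
rewrite defect2_swap23.
transitivity (ksum (fun r1 r2 => ksum (fun s1 s2 => ksum (fun q1 q2 =>
   ksum (fun p1 p2 => ksum (fun t1 t2 => vact (t1 * q2) u ((p1 * r2) |> b) *
     pairing2 (vact (p2 * (t2 * q1) * r1 * s1) z) (vact s2 v) g) R) R) R) R) R).
  apply: eq_ksum => r1 r2; apply: eq_ksum => s1 s2; rewrite defect3_swap12.
  apply: eq_ksum => q1 q2; rewrite christoffel_defect3.
  transitivity (ksum (fun p1 p2 => ksum (fun x y =>
    vact (x * q2) u ((y * r2) |> b) *
      pairing2 (vact (p2 * (q1 * r1 * s1)) z) (vact s2 v) g) (Delta T p1)) R).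
    apply: eq_ksum => p1 p2; rewrite vact_app ksum_mull.
    by apply: eq_ksum => x y; rewrite actM !vactM.
  rewrite (sw_RD1 T (f := fun x y p => vact (x * q2) u ((y * r2) |> b) *
      pairing2 (vact (p * (q1 * r1 * s1)) z) (vact s2 v) g)); try by hlin.
  by apply: eq_ksum => p1 p2; apply: eq_ksum => t1 t2; rewrite !mulrA.
transitivity (ksum (fun r1 r2 => ksum (fun s1 s2 => ksum (fun p1 p2 =>
    u ((p1 * r2) |> b) *
     pairing2 (vact (p2 * r1 * s1) z) (vact s2 v) g) R) R) R).
  apply: eq_ksum => r1 r2; apply: eq_ksum => s1 s2.
  rewrite ksum_exchange; apply: eq_ksum => p1 p2; rewrite ksum_exchange.
  rewrite (sw_Rbar21 T (f := fun x y => vact x u ((p1 * r2) |> b) *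
     pairing2 (vact (p2 * y * r1 * s1) z) (vact s2 v) g)); try by hlin.
  by rewrite vact1 mulr1.
rewrite ksum_exchange (pairing2_sym gsym v z) ksum_mulr; apply: eq_ksum => s1 s2.
rewrite ksum_exchange.
rewrite (sw_Rbar21 T (f := fun x y => u (x |> b) *
     pairing2 (vact (y * s1) z) (vact s2 v) g)); try by hlin.
by rewrite mul1r act1.
Qed.

(** The Leibniz terms cancel in the second slot; the third slot follows by
symmetry. *)
Lemma tensorial_metricity : tensorial metricity_map.
Proof.
have l1 : lin1 metricity_map.
  move=> b u v z; rewrite /metricity_map !(tmapD, tmapN).
  rewrite (lin1_swap12 christoffel_lin2).
  rewrite (lin1_swap23 (lin1_swap12 christoffel_lin2)) /=.
  by rewrite -mulrDr -mulrBr.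
have l2 : lin2 metricity_map.
  apply/lin2P => b u v z; rewrite /metricity_map !(defect2D, defect2N).
  move/lin2P: (lin2_swap12 christoffel_lin1) => ->.
  rewrite swap_christoffel_defect2 add0r {1}/defect2 /=.
  by rewrite pairing2Zl (vfieldP u).2 addrK subrr.
split=> //; rewrite -metricity_map_sym.
exact: lin3_swap23.
Qed.

Hypothesis two : (2%:R : k) \is a GRing.unit.

Lemma half_double (F : tmap X) : (2%:R^-1 : k) *: (F + F) = F.
Proof. by rewrite -mulr2n -scaler_nat scalerA mulVr // scale1r. Qed.

Hypothesis gbij : bijective (flat g).

(** The contorsion C solves the two equations with the nonmetricity and minus
the torsion of N on the right-hand sides.  Being A-multilinear, it is
<w (x) c(u,v), g> for a unique c, and N + c is again a covariant
derivative. *)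
Lemma koszul_covariant : exists2 N' : V -> V -> V, covariant N' &
  forall cN' : covariant N', let C := christoffel g cN' in
    lie_map g = s1 C + s2 (s1 C) /\ C - s2 C = bracket_map g.
Proof.
pose C2 := s1 (koszul_comb s1 s2 metricity_map torsion_map).
pose C := (2%:R^-1 : k) *: C2.
have s1D := @swap12D _ _ _ _ X; have s2D := @swap23D _ _ _ _ X.
have s1N := @swap12N _ _ _ _ X; have s2N := @swap23N _ _ _ _ X.
have s1K := @swap12K _ _ _ _ X; have s2K := @swap23K _ _ _ _ X.
have sb := @swap_braid _ _ _ _ X.
have eQ : s1 C + s2 (s1 C) = metricity_map.
  rewrite /C swap12Z swap23Z -scalerDr.
  by rewrite (koszul_comb_metric s2D s2N s1K s2K metricity_map_sym
    torsion_map_anti) half_double.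
have eT : C - s2 C = torsion_map.
  rewrite /C swap23Z -scalerBr.
  by rewrite (koszul_comb_torsion s1D s2D s1N s2N s1K s2K sb metricity_map_sym
    torsion_map_anti) half_double.
have [C1 Cl2 Cl3] : tensorial C.
  apply/tensorialZ/tensorial_swap12/tensorial_koszul.
    exact: tensorial_metricity.
  exact: tensorial_torsion.
have [f fK Kf] := gbij.
have CP u v a w w' : C (a *: w + w') u v = a * C w u v + C w' u v.
  case: (tmapP C) => /(_ u v)/vlinD CD _ _.
  by rewrite CD C1.
pose c u v : V := f (OneForm (CP u v)).
have cE w u v : pairing2 w (c u v) g = C w u v by rewrite /pairing2 Kf.
have cP u v x : (forall w, pairing2 w x g = C w u v) -> c u v = x.
  move=> h; rewrite -[RHS]fK; congr f; apply: form_eq => w; exact/esym/h.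
case: (cN) => Nl ND NZ.
have cZl a u v : c (a *: u) v = a *: c u v.
  apply: cP => w; rewrite pairing2ZrR Cl2; apply: eq_ksum => r1 r2.
  by rewrite cE.
have cDl u u' v : c (u + u') v = c u v + c u' v.
  apply: cP => w; rewrite pairing2Dr !cE.
  by case: (tmapP C) => _ /(_ w v)/vlinD CD _; rewrite CD.
have cDr u v v' : c u (v + v') = c u v + c u v'.
  apply: cP => w; rewrite pairing2Dr !cE.
  by case: (tmapP C) => _ _ /(_ w u)/vlinD CD; rewrite CD.
have cZr a u v : c u (a *: v) = c (vactr u a) v.
  apply: cP => w; rewrite cE.
  move/eqP: (Cl3 a w u v); rewrite subr_eq0 => /eqP ->.
  rewrite ksum_exchange ksum_tmap2; apply: eq_ksum => s1 s2; rewrite Cl2.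
  by apply: eq_ksum => r1 r2; rewrite actM.
have cN' : covariant (fun u v => N u v + c u v).
  split=> [a u u' v|u v v'|a u v].
  - by rewrite Nl cDl cZl scalerDr addrACA.
  - by rewrite ND cDr addrACA.
  - by rewrite NZ cZr addrA.
exists (fun u v => N u v + c u v) => // {}cN' /=.
have -> : christoffel g cN' = Gam + C.
  by apply: tmap_eq => w u v; rewrite tmapD /= pairing2Dr cE.
split; last first.
  by rewrite s2D opprD addrACA eT /torsion_map addrC subrK.
rewrite s1D s2D [in RHS]addrACA eQ /metricity_map addrC subrK.
by [].
Qed.

End Existence.

(** * The inverse metric *)
Section InverseMetric.
Variables (k : comUnitRingType) (H : algType k) (T : triangularHopf H).
Variables (A : algType k) (X : bcModuleAlgebra T A).
Local Notation D := (Delta T).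
Local Notation SV := (antipV T).
Local Notation eps := (counit T).
Local Notation R := (Rbar T).
Local Notation V := (vfield X).
Local Notation VX := (Xfields X).
Local Notation OX := (Omega X).
Local Notation OO := (atensor T OX OX).
Local Notation VV := (atensor T VX VX).
Local Notation "h |> a" := (hopf_act X h a) (at level 38, right associativity).
Implicit Types (u v : V) (th : oneform X).

(** The right action on one-forms is the braided left action; this is braided
commutativity of A together with equivariance of evaluation. *)
Lemma fractr_braid th u a :
  ksum (fun r1 r2 => factH r2 th (vactr u (r1 |> a))) R = th u * a.
Proof.
rewrite (bcomm X).
transitivity (ksum (fun q1 q2 => ksum (fun x y =>
  (q1 |> a) * factH y th (vact x u)) (D q2)) R); last first.
  by apply: eq_ksum => q1 q2; rewrite form_act ksum_mulr.
rewrite (sw_RD2 T (f := fun q x y => (q |> a) * factH y th (vact x u))); try by hlin.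
rewrite [RHS]ksum_exchange; apply: eq_ksum => r1 r2; rewrite form_vactr.
by apply: eq_ksum => p1 p2; rewrite actM.
Qed.

Lemma form_vactr_braid th u a :
  th (vactr u a) = ksum (fun r1 r2 => factH r1 th u * (r2 |> a)) R.
Proof.
symmetry; transitivity (ksum (fun s1 s2 => ksum (fun r1 r2 =>
    factH (s2 * r1) th (vactr u ((s1 * r2) |> a))) R) R).
  rewrite [RHS]ksum_exchange; apply: eq_ksum => r1 r2.
  rewrite -fractr_braid; apply: eq_ksum => s1 s2.
  by rewrite factHM actM.
rewrite (sw_Rbar21 T (f := fun x y => factH y th (vactr u (x |> a)))).
- by rewrite factH1 act1.
- move=> y; apply: eq_klin; first by move=> x; rewrite form_vactr.
  by hlin.
- by hlin.
Qed.

Lemma pairing'_vactr th u a : pairing' th (vactr u a) = pairing' th u * a.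
Proof.
rewrite /pairing' ksum_mull.
transitivity (ksum (fun r1 r2 => ksum (fun x y =>
    factH r2 th (vactr (vact x u) (y |> a))) (D r1)) R).
  by apply: eq_ksum => r1 r2; rewrite vact_vactr ksum_form.
rewrite (sw_RD1 T (f := fun x y r => factH r th (vactr (vact x u) (y |> a)))).
- rewrite ksum_exchange; apply: eq_ksum => s1 s2; rewrite -fractr_braid.
  by apply: eq_ksum => r1 r2; rewrite factHM.
- move=> y r; apply: eq_klin; first by move=> x; rewrite form_vactr_braid.
  by hlin.
- move=> y r; apply: eq_klin; first by move=> x; rewrite form_vactr_braid.
  by hlin.
- by hlin.
Qed.

Lemma sharp_balanced th : balanced (@ract H A VX) (@lact H A VX)
  (fun u1 u2 : VX => pairing' th u1 *: (u2 : V)).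
Proof.
have pD u u' : pairing' th (u + u') = pairing' th u + pairing' th u'.
  by rewrite /pairing' -ksum_split; apply: eq_ksum => r1 r2; rewrite vactD formD.
split=> [u u' v|u v v'|u a v].
- by rewrite pD scalerDl.
- exact: scalerDr.
- by rewrite pairing'_vactr scalerA.
Qed.

Lemma sharp_sum (I : Type) (s : seq I) (t : I -> VV) th :
  sharp (\sum_(i <- s) t i) th = \sum_(i <- s) sharp (t i) th.
Proof.
apply: (big_morph (fun t : VV => sharp t th)) => [x y|].
  exact: (tsumD (sharp_balanced th)).
exact: (tsum0 (sharp_balanced th)).
Qed.

Section DualBasis.
Variables (n : nat) (e : 'I_n -> V) (w : 'I_n -> oneform X).
Hypothesis ew : dual_basis e w.

(** The element sum of the w^i (x) e_i of Omega (x)_A X represents the identity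
of X, so it is H-invariant although its terms are not. *)
Lemma coevaluation_invariant h u :
  \sum_i ksum (fun x y => factH x (w i) u *: vact y (e i)) (D h) =
  (eps h : k)%:A *: u.
Proof.
have vsum (F : 'I_n -> V) a : (\sum_i F i) a = \sum_i F i a.
  exact: (big_morph (fun v : V => v a)).
apply: vfield_eq => a; rewrite vsum scalek.
have lSV := antipV_lin T.
transitivity (ksum (fun p q => vact (q * SV p) u a) (D h)); last first.
  rewrite (sw_antipV1 T (f := fun g => vact g u a)); last by hlin.
  by rewrite vact1.
transitivity (\sum_i ksum (fun p q => vact q (w i (vact (SV p) u) *: e i) a) (D h)).
  apply: eq_bigr => i _; rewrite vfun_ksum.
  transitivity (ksum (fun x y => ksum (fun x1 x2 =>
     (x2 |> w i (vact (SV x1) u)) * vact y (e i) a) (D x)) (D h)).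
    by apply: eq_ksum => x y; rewrite vfunZ /= ksum_mull.
  rewrite (sw_coassoc T (f := fun x1 x2 y =>
     (x2 |> w i (vact (SV x1) u)) * vact y (e i) a)); try by hlin.
  by apply: eq_ksum => p q; rewrite vactZ vfun_ksum.
rewrite /ksum /tsum exchange_big; apply: eq_bigr => p _.
rewrite vactM -vsum {2}[vact (SV p.1) u]ew; congr (_ a).
rewrite (big_morph (vact p.2) (vactD p.2) (id1 := 0)) //.
by apply: (addrI (vact p.2 0)); rewrite -vactD !addr0.
Qed.

(** Starting from theta = w^i <e_i, theta>, move theta to the left across the
invariant element w^i (x) e_i, which costs nothing, and then exchange w^i and
e_i.  In the computation below this is the Yang-Baxter equation followed by
R R_21 = 1. *)
Lemma form_expand' th : th = \sum_i ksum (fun r1 r2 =>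
  factl (pairing' th (vact r1 (e i))) (factH r2 (w i))) R.
Proof.
apply: form_eq => u; rewrite form_sumE.
transitivity (\sum_i ksum (fun r1 r2 => ksum (fun x y =>
    factH x (w i) u * factH r2 th (vact y (e i))) (D r1)) R).
  transitivity (ksum (fun r1 r2 => (eps r1 : k) *: factH r2 th u) R).
    rewrite (Rbar_counitL T (f := fun h => factH h th u)); last by hlin.
    by rewrite factH1.
  rewrite /ksum [RHS]exchange_big; apply: eq_bigr => p _.
  rewrite -(vlinZ _ _ (vlin_form (factH p.2 th))) -coevaluation_invariant.
  rewrite form_sum; apply: eq_bigr => i _; rewrite ksum_form.
  by apply: eq_ksum => x y; rewrite formZ.
apply: eq_bigr => i _; rewrite ksum_formE.
transitivity (ksum (fun b1 b2 => ksum (fun c1 c2 =>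
    factH b1 (w i) u * factH (c2 * b2) th (vact c1 (e i))) R) R).
  rewrite (sw_RD1 T (f := fun x y r =>
    factH x (w i) u * factH r th (vact y (e i)))); try by hlin.
  by rewrite ksum_exchange.
symmetry.
transitivity (ksum (fun R1 R2 => ksum (fun S1 S2 => ksum (fun b1 b2 =>
  ksum (fun c1 c2 => factH (c1 * b1 * R2) (w i) u *
     factH (b2 * S2) th (vact (c2 * S1 * R1) (e i))) R) R) R) R).
  apply: eq_ksum => R1 R2.
  rewrite -[LHS]/(factH R2 (w i) (vactr u (pairing' th (vact R1 (e i))))).
  rewrite form_vactr_braid.
  transitivity (ksum (fun r1 r2 => ksum (fun S1 S2 => ksum (fun x y =>
     factH (r1 * R2) (w i) u * factH (y * S2) th (vact (x * S1 * R1) (e i)))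
     (D r2)) R) R).
    apply: eq_ksum => r1 r2; rewrite factHM /pairing' ksum_act ksum_mulr.
    apply: eq_ksum => S1 S2; rewrite form_act ksum_mulr.
    by apply: eq_ksum => x y; rewrite factHM !vactM.
  rewrite [LHS]ksum_exchange; apply: eq_ksum => S1 S2.
  rewrite (sw_RD2 T (f := fun r x y => factH (r * R2) (w i) u *
     factH (y * S2) th (vact (x * S1 * R1) (e i)))); try by hlin.
  by rewrite [LHS]ksum_exchange.
transitivity (ksum (fun R1 R2 => ksum (fun a1 a2 => ksum (fun b1 b2 =>
  ksum (fun c1 c2 => factH (b1 * (a1 * R2)) (w i) u *
     factH (c2 * b2) th (vact (c1 * (a2 * R1)) (e i))) R) R) R) R).
  apply: eq_ksum => R1 R2.
  rewrite (Rbar_YB T (f := fun x y z => factH (x * R2) (w i) u *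
     factH z th (vact (y * R1) (e i)))); try by hlin.
  by apply: eq_ksum => a1 a2; apply: eq_ksum => b1 b2; apply: eq_ksum => c1 c2;
    rewrite !mulrA.
rewrite [LHS]ksum_exchange.
rewrite (sw_Rbar21 T (f := fun x y => ksum (fun b1 b2 => ksum (fun c1 c2 =>
   factH (b1 * x) (w i) u * factH (c2 * b2) th (vact (c1 * y) (e i))) R) R));
  try by hlin.
apply: eq_ksum => b1 b2; apply: eq_ksum => c1 c2.
by rewrite !mulr1.
Qed.

(** The inverse of g^flat is left A-linear, so it may be applied termwise to the
expansion of form_expand'. *)
Lemma inverse_metric_exists (g : OO) : bijective (flat g) ->
  exists gb, is_inverse_metric g gb.
Proof.
case=> f fK Kf.
have fZ a th : f (factl a th) = a *: f th.
  by rewrite -[RHS]fK flatZ Kf.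
have flD u v : flat g (u + v) = flat g u + flat g v.
  by apply: form_eq => z; exact: pairing2Dr.
have fD th th' : f (th + th') = f th + f th'.
  by rewrite -[RHS]fK flD !Kf.
have f0 : f 0 = 0 by apply: (addrI (f 0)); rewrite -fD !addr0.
pose gb : VV := \sum_i ksum (fun r1 r2 =>
  atens (vact r1 (e i) : VX) (f (factH r2 (w i)) : VX)) R.
have gbE th : sharp gb th = f th.
  rewrite sharp_sum [in RHS](form_expand' th) (big_morph f fD f0).
  apply: eq_bigr => i _; rewrite sharp_sum [RHS](big_morph f fD f0).
  apply: eq_bigr => p _; rewrite fZ.
  exact: (tsum_tens (sharp_balanced th)).
by exists gb; split=> x; rewrite gbE.
Qed.

End DualBasis.
End InverseMetric.

(** * Invertibility of 2 and existence of a dual basis *)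
Section Generalities.

Lemma two_unit (k : comUnitRingType) :
  char0_field k \/ char0_power_series k -> (2%:R : k) \is a GRing.unit.
Proof.
case=> [[F [phi [ch0 _]]]|[F [phi [ch0 [psi phiK psiK] phi1 phiD phiM]]]].
  rewrite -(rmorph_nat phi); apply: rmorph_unit.
  by rewrite unitfE (pcharf0P F).1.
pose y := psi (fun n => (n == 0)%:R / 2%:R : F).
apply/unitrPr; exists y; apply: (can_inj phiK); apply: funext => n.
rewrite mulr_natl mulr2n phiD phi1 psiK -mulr2n -[LHS]mulr_natr /= divfK //.
by rewrite (pcharf0P F).1.
Qed.

(** A splitting of the surjection from a free module of row vectors given by
generators has the forms w^i as its coordinates. *)
Lemma dual_basis_exists (k : comUnitRingType) (H : algType k)
    (T : triangularHopf H) (A : algType k) (X : bcModuleAlgebra T A) :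
  finitely_generated (vfield X) -> projective (vfield X) ->
  exists (n : nat) (e : 'I_n -> vfield X) (w : 'I_n -> oneform X), dual_basis e w.
Proof.
move=> [n [e gen]] proj.
pose q (x : 'rV[A]_n) : vfield X := \sum_i x 0 i *: e i.
have lq : linear q.
  move=> a x y; rewrite /q scaler_sumr -big_split; apply: eq_bigr => i _ /=.
  by rewrite !mxE scalerDl scalerA.
pose ql := HB.pack_for {linear 'rV[A]_n -> vfield X} q
  (GRing.isLinear.Build _ _ _ _ q lq).
have [|s sK] := proj _ _ ql (idfun : {linear vfield X -> vfield X}).
  move=> y; have [c ->] := gen y; exists (\row_i c i).
  by apply: eq_bigr => i _; rewrite mxE.
have wP i a u v : s (a *: u + v) 0 i = a * s u 0 i + s v 0 i.
  by rewrite linearP !mxE.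
exists n, e, (fun i => OneForm (wP i)) => u.
exact: esym (sK u).
Qed.

End Generalities.

(** * The Levi-Civita connection *)
Section LeviCivita.
Variables (k : comUnitRingType) (H : algType k) (T : triangularHopf H).
Variables (A : algType k) (X : bcModuleAlgebra T A).
Local Notation R := (Rbar T).
Local Notation V := (vfield X).
Local Notation VX := (Xfields X).
Local Notation OX := (Omega X).
Local Notation OO := (atensor T OX OX).
Local Notation OV := (atensor T OX VX).
Implicit Types (u v z : V).
Variables (g : OO) (hg : is_metric g).
Variables (n : nat) (e : 'I_n -> V) (w : 'I_n -> oneform X).
Hypothesis ew : dual_basis e w.
Hypothesis two : (2%:R : k) \is a GRing.unit.

Lemma koszul_formula (nabla : VX -> OV) u v z : levi_civita g nabla ->
  ksum (fun r1 r2 => koszul g (vact r1 v) (vact r2 u) z) R =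
  pairing2 u (covder nabla v z) g + pairing2 u (covder nabla v z) g.
Proof.
case: hg => gsym gbij [cn tf mc].
move/(metric_compatibleP gsym ew cn): mc => mc.
move/(torsion_freeP cn gbij): tf => tf.
have := koszul_comb_solve (@swap12D _ _ _ _ X) (@swap23D _ _ _ _ X)
  (@swap12N _ _ _ _ X) (@swap23N _ _ _ _ X) (@swap12K _ _ _ _ X)
  (@swap_braid _ _ _ _ X) mc tf.
move/(congr1 (fun F : tmap X => F u v z)); rewrite swap12E => K.
by apply: etrans K; apply: eq_ksum => r1 r2; rewrite koszulE.
Qed.

Lemma levi_civita_unique (nabla nabla' : VX -> OV) :
  levi_civita g nabla -> levi_civita g nabla' -> nabla = nabla'.
Proof.
move=> lc lc'; apply: (connection_ext ew) => v z; case: (hg) => _ /bij_inj ginj.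
apply: ginj; apply: form_eq => u.
rewrite -[LHS]/(pairing2 u _ g) -[RHS]/(pairing2 u _ g).
have := koszul_formula u v z lc; rewrite (koszul_formula u v z lc') -!mulr2n => h.
have {}h : (2%:R : k) *: pairing2 u (covder nabla' v z) g =
    (2%:R : k) *: pairing2 u (covder nabla v z) g by rewrite !scaler_nat.
by have := congr1 (fun x => (2%:R^-1 : k) *: x) h; rewrite !scalerA mulVr // !scale1r.
Qed.

Lemma levi_civita_exists : exists nabla : VX -> OV, levi_civita g nabla.
Proof.
case: (hg) => gsym gbij.
have [N cN eqN] := koszul_covariant gsym (grassmann_covariant ew) two gbij.
have [nabla cn NE] := connection_of_covariant ew cN.
have NE' : covder nabla = N by do 2![apply: funext => ?]; exact: NE.
exists nabla.
have [mc tf] : lie_map g = swap12 (christoffel g (covder_covariant cn)) +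
     swap23 (swap12 (christoffel g (covder_covariant cn))) /\
    christoffel g (covder_covariant cn) - swap23 (christoffel g (covder_covariant cn))
     = bracket_map g.
  by move: (covder_covariant cn); rewrite NE'.
split=> //.
- exact/(torsion_freeP cn gbij).
- exact/(metric_compatibleP gsym ew cn).
Qed.

Lemma levi_civita_formula (nabla : VX -> OV) v z : levi_civita g nabla ->
  covder nabla v z = (2%:R^-1 : k)%:A *: sharp (inverse_metric g)
    (\sum_(i < n) fractr (w i)
       (ksum (fun r1 r2 => koszul g (vact r1 v) (vact r2 (e i)) z) R)).
Proof.
move=> lc; case: (hg) => gsym gbij.
have [_ gK] : is_inverse_metric g (inverse_metric g).
  exact: (xgetPex 0 (inverse_metric_exists ew gbij)).
set kap := (\sum_(i < n) _).
have E : flat g (covder nabla v z + covder nabla v z) = kap.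
  apply: form_eq => u; rewrite -[LHS]/(pairing2 u _ g) pairing2Dr form_sumE.
  rewrite /pairing2 {1 2}[u]ew form_sum -big_split; apply: eq_bigr => i _.
  rewrite [LHS]/= !formZ -mulrDr [RHS]/=.
  by rewrite (koszul_formula (e i) v z lc).
have -> : sharp (inverse_metric g) kap = covder nabla v z + covder nabla v z.
  by apply: (bij_inj gbij); rewrite E gK.
apply: vfield_eq => a; rewrite scalek vfunD -mulr2n -scaler_nat scalerA.
by rewrite mulVr // scale1r.
Qed.

End LeviCivita.

Theorem theorem6p7 (k : comUnitRingType)
    (hk : char0_field k \/ char0_power_series k)
    (H : algType k) (T : triangularHopf H)
    (A : algType k) (X : bcModuleAlgebra T A)
    (hfg : finitely_generated (vfield X)) (hproj : projective (vfield X))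
    (g : atensor T (Omega X) (Omega X)) (hg : is_metric g) :
  (exists! nabla : Xfields X -> atensor T (Omega X) (Xfields X),
     levi_civita g nabla) /\
  (forall nabla : Xfields X -> atensor T (Omega X) (Xfields X),
     levi_civita g nabla ->
     forall (n : nat) (e : 'I_n -> vfield X) (w : 'I_n -> oneform X),
       dual_basis e w ->
       forall v z : vfield X,
         covder nabla v z =
         (2%:R^-1 : k)%:A *:
           sharp (inverse_metric g)
             (\sum_(i < n) fractr (w i)
                (ksum (fun r1 r2 => koszul g (vact r1 v) (vact r2 (e i)) z)
                   (Rbar T)))).
Proof.
have two := two_unit hk; have [n [e [w ew]]] := dual_basis_exists hfg hproj.
split=> [|nabla lc n' e' w' ew' v z]; last exact: levi_civita_formula.
have [nabla lc] := levi_civita_exists hg ew two.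
by exists nabla; split=> // nabla'; exact: (levi_civita_unique hg ew).
Qed.
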